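(* Let $\Psi = H^\infty(\mathbb{R}^n;\mathbb{C})$ be equipped with the Poisson structure $\{F,G\}_{\mathrm{NLS}}(\psi) = \langle \nabla F, -\tfrac{i}{2}\nabla G\rangle$, and let the semidirect product Lie algebra $\mathfrak{s} = \mathrm{vect}(\mathbb{R}^n)\ltimes H^\infty(\mathbb{R}^n;\mathbb{R})$ act on $\Psi$ by assigning to each $\xi = (v,\alpha)\in\mathfrak{s}$ the vector field $\xi_\Psi$ on $\Psi$ given by $$\xi_\Psi(\psi) = -\tfrac12 \psi\, \nabla\cdot v - i\alpha\psi - \nabla\psi\cdot v .$$ Then this Lie algebra action admits a momentum map, and the (inverse) Madelung transform $$\mathbf{M}:\Psi\to\mathfrak{s}^*,\qquad \mathbf{M}(\psi) = (\mu,\rho) = \left(\mathrm{Im}\,(\bar\psi\nabla\psi),\ \bar\psi\psi\right),$$ is a momentum map associated with it. That is, for every $\xi = (v,\alpha)\in\mathfrak{s}$ the function $M(\xi):\Psi\to\mathbb{R}$, $M(\xi)(\psi) := \langle\!\langle \mathbf{M}(\psi),\xi\rangle\!\rangle$, has Hamiltonian vector field $$X_{M(\xi)} = \xi_\Psi .$$ Here $\langle\!\langle\cdot,\cdot\rangle\!\rangle$ denotes the pairing of $\mathfrak{s}^*$ with $\mathfrak{s}$.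
   Context: Function spaces: $H^\infty(\mathbb{R}^n;E) := \bigcap_{k\ge 0}H^k(\mathbb{R}^n;E)$ for $E=\mathbb{R},\mathbb{C},\mathbb{R}^n$. The space $\Psi$ is regarded as a real vector space, with real inner product $\langle f,g\rangle := \mathrm{Re}\int_{\mathbb{R}^n}\bar f g\,dx$. For a functional $F$ on $\Psi$, its gradient $\nabla F(\psi)\in\Psi$ is taken with respect to this inner product, i.e. $\frac{d}{d\epsilon}F(\psi+\epsilon\phi)|_{\epsilon=0} = \langle \nabla F(\psi),\phi\rangle$. The bracket $\{F,G\}_{\mathrm{NLS}}$ is defined for functionals admitting such gradients, and the Hamiltonian vector field of $H$ is $X_H(\psi) = -\tfrac{i}{2}\nabla H(\psi)$. Lie algebra: $\mathfrak{s}$ is the Lie algebra of the group $S=\mathrm{Diff}(\mathbb{R}^n)\ltimes H^\infty(\mathbb{R}^n;\mathbb{R})$, where $\mathrm{Diff}(\mathbb{R}^n)$ is the group of diffeomorphisms of the form $\mathrm{id}+f$ with $f\in H^\infty(\mathbb{R}^n;\mathbb{R}^n)$. Its elements are pairs $(v,\alpha)$ with $v\in\mathrm{vect}(\mathbb{R}^n)=H^\infty(\mathbb{R}^n;\mathbb{R}^n)$ and $\alpha\in H^\infty(\mathbb{R}^n;\mathbb{R})$. The given action of $\mathfrak{s}$ is the infinitesimal action of the group action $(g,a)\cdot\psi = \sqrt{|\det(Dg^{-1})|}\,e^{-ia}(\psi\circ g^{-1})$. Dual: $\mathfrak{s}^*$ is the smooth dual of $\mathfrak{s}$, consisting of pairs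 $(\mu,\rho)$ where $\mu$ is a 1-form (identified with a vector field via the Euclidean metric) and $\rho$ is a density (identified with a function), paired with $\mathfrak{s}$ by $\langle\!\langle(\mu,\rho),(v,\alpha)\rangle\!\rangle = \int_{\mathbb{R}^n}(\rho\alpha + \mu\cdot v)\,dx$. Momentum map: for a Poisson space $P$ and an action $\xi\mapsto\xi_P$ of a Lie algebra $\mathfrak{g}$ by vector fields on $P$, a momentum map is a map $\mathbf{J}:P\to\mathfrak{g}^*$ such that for every $\xi\in\mathfrak{g}$ the function $J(\xi)(p):=\langle\!\langle\mathbf{J}(p),\xi\rangle\!\rangle$ satisfies $X_{J(\xi)}=\xi_P$. The action admits a momentum map if such a $\mathbf{J}$ exists. *)

(* Defs.v *)
From HB Require Import structures.
From mathcomp Require Import all_boot all_order all_algebra.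
From mathcomp Require Import complex.
From mathcomp Require Import all_classical all_reals all_analysis.

Set Implicit Arguments.
Unset Strict Implicit.
Unset Printing Implicit Defensive.

Import Order.TTheory GRing.Theory Num.Theory.
Import numFieldNormedType.Exports.

Local Open Scope classical_set_scope.
Local Open Scope ring_scope.

Section row_measurable.
Context {d : measure_display} {T : measurableType d} {n : nat}.

Let coords : 'I_n -> 'rV[T]_n -> T := fun i x => x ord0 i.

Let row_set0 : g_sigma_preimage coords set0.
Proof. exact: sigma_algebra0. Qed.

Let row_setC A : g_sigma_preimage coords A -> g_sigma_preimage coords (~` A).
Proof. exact: sigma_algebraC. Qed.

Let row_bigcup (F : _^nat) : (forall i, g_sigma_preimage coords (F i)) ->
  g_sigma_preimage coords (\bigcup_i (F i)).
Proof. exact: sigma_algebra_bigcup. Qed.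

HB.instance Definition _ := @isMeasurable.Build (measure_tuple_display d)
  'rV[T]_n (g_sigma_preimage coords) row_set0 row_setC row_bigcup.

Lemma measurable_row_coord (i : 'I_n) :
  measurable_fun [set: 'rV[T]_n] (fun x => x ord0 i).
Proof.
move=> _ Y mY; rewrite setTI; apply: sub_sigma_algebra => /=.
rewrite -bigcup_seq/=; exists i => /=; first by rewrite mem_index_enum.
by exists Y => //; rewrite setTI.
Qed.

Lemma measurable_fun_row d1 (T1 : measurableType d1) (f : T1 -> 'rV[T]_n) :
  (forall i, measurable_fun [set: T1] (fun t => f t ord0 i)) ->
  measurable_fun [set: T1] f.
Proof.
move=> mf.
have sub : preimage_set_system [set: T1] f (g_sigma_preimage coords) `<=`
    measurable.
  rewrite /g_sigma_preimage -[X in X `<=` _]g_sigma_preimageE.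
  apply: smallest_sub; first exact: sigma_algebra_measurable.
  move=> A [B + <-]; rewrite -bigcup_seq/= => -[i _ [C mC <-]].
  by rewrite !setTI; have := mf i measurableT _ mC; rewrite setTI.
by move=> _ A mA; apply: sub; exists A.
Qed.

End row_measurable.

Section lebesgue_row.
Context {R : realType}.

Definition row_cons {n : nat} (p : R * 'rV[R]_n) : 'rV[R]_n.+1 :=
  \row_i (if unlift ord0 i is Some j then p.2 ord0 j else p.1).

Definition row_uncons {n : nat} (x : 'rV[R]_n.+1) : R * 'rV[R]_n :=
  (x ord0 ord0, \row_j x ord0 (lift ord0 j)).

Lemma row_consK {n : nat} : cancel (@row_cons n) row_uncons.
Proof.
move=> [t x]; rewrite /row_uncons/= mxE unlift_none; congr pair.
by apply/rowP => j; rewrite !mxE liftK.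
Qed.

Lemma measurable_row_cons {n : nat} :
  measurable_fun [set: measurableTypeR R * 'rV[R]_n] (@row_cons n).
Proof.
apply: measurable_fun_row => i.
rewrite (_ : (fun _ => _) = fun p : R * 'rV[R]_n =>
    if unlift ord0 i is Some j then p.2 ord0 j else p.1); last first.
  by apply/funext => p; rewrite mxE.
case: unlift => [j|]; last exact: measurable_fst.
exact: measurableT_comp (measurable_row_coord j) measurable_snd.
Qed.

Lemma measurable_row_uncons {n : nat} :
  measurable_fun [set: 'rV[R]_n.+1]
    (@row_uncons n : _ -> measurableTypeR R * 'rV[R]_n).
Proof.
apply: measurable_fun_pair; first exact: measurable_row_coord.
apply: measurable_fun_row => i.
rewrite (_ : (fun _ => _) = fun x : 'rV[R]_n.+1 => x ord0 (lift ord0 i)).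
  exact: measurable_row_coord.
by apply/funext => x; rewrite mxE.
Qed.

Section successor.
Context {n : nat} (mu : {sigma_finite_measure set 'rV[R]_n -> \bar R}).

Definition lebesgue_rowS : set 'rV[R]_n.+1 -> \bar R :=
  pushforward (@lebesgue_measure R \x mu)%E (@row_cons n).

Let measurable_preimage (A : set 'rV[R]_n.+1) : measurable A ->
  measurable (@row_cons n @^-1` A : set (measurableTypeR R * 'rV[R]_n)).
Proof.
by move=> mA; rewrite -[X in measurable X]setTI; exact: measurable_row_cons.
Qed.

Let lebesgue_rowS0 : lebesgue_rowS set0 = 0%E.
Proof. by rewrite /lebesgue_rowS /pushforward preimage_set0 measure0. Qed.

Let lebesgue_rowS_ge0 A : (0 <= lebesgue_rowS A)%E.
Proof. exact: (@measure_ge0 _ _ _ (@lebesgue_measure R \x mu)%E). Qed.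

Let lebesgue_rowS_sigma_additive : semi_sigma_additive lebesgue_rowS.
Proof.
move=> F mF tF mUF; rewrite /lebesgue_rowS /pushforward preimage_bigcup.
apply: measure_semi_sigma_additive.
- by move=> k; exact: measurable_preimage.
- apply/trivIsetP => /= i j _ _ ij; rewrite -preimage_setI.
  by move/trivIsetP : tF => /(_ _ _ _ _ ij) ->//; rewrite preimage_set0.
- by rewrite -preimage_bigcup; exact: measurable_preimage.
Qed.

HB.instance Definition _ := isMeasure.Build _ _ _
  lebesgue_rowS lebesgue_rowS0 lebesgue_rowS_ge0 lebesgue_rowS_sigma_additive.

Let lebesgue_rowS_sigma_finite : sigma_finite setT lebesgue_rowS.
Proof.
have /sigma_finiteP[F [TF ndF Foo]] := sigma_finiteT (@lebesgue_measure R).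
have /sigma_finiteP[G [TG ndG Goo]] := sigma_finiteT mu.
exists (fun k => row_uncons @^-1` (F k `*` G k)).
  rewrite -preimage_bigcup (_ : \bigcup_k _ = setT) ?preimage_setT//.
  rewrite -setXTT TF TG predeqE => -[x y]; split.
    by move=> [k _ [/= Fkx Gky]]; split; exists k.
  move=> [/= [k _ Fkx] [l _ Gly]]; exists (maxn k l) => //; split.
  - by move: x Fkx; exact/subsetPset/ndF/leq_maxl.
  - by move: y Gly; exact/subsetPset/ndG/leq_maxr.
move=> k; have [mFk Fkoo] := Foo k; have [mGk Gkoo] := Goo k; split.
  rewrite -[X in measurable X]setTI; apply: measurable_row_uncons => //.
  exact: measurableX.
rewrite /lebesgue_rowS /pushforward -comp_preimage.
rewrite (_ : row_uncons \o row_cons = id).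
  by rewrite preimage_id product_measure1E// lte_mul_pinfty// ge0_fin_numE.
by apply/funext => p; exact: row_consK.
Qed.

HB.instance Definition _ := Measure_isSigmaFinite.Build _ _ _
  lebesgue_rowS lebesgue_rowS_sigma_finite.

End successor.

Fixpoint lebesgue_row (n : nat) : {sigma_finite_measure set 'rV[R]_n -> \bar R} :=
  match n return {sigma_finite_measure set 'rV[R]_n -> \bar R} with
  | 0 => \d_(0 : 'rV[R]_0)
  | m.+1 => lebesgue_rowS (lebesgue_row m)
  end.

Lemma measurable_row_box (n : nat) (A : 'I_n -> set R) :
  (forall i, measurable (A i)) ->
  measurable [set x : 'rV[R]_n | forall i, A i (x ord0 i)].
Proof.
move=> mA; pose E i := (fun x : 'rV[R]_n => x ord0 i) @^-1` A i.
rewrite (_ : [set x | _] = \bigcap_(i in [set` enum 'I_n]) E i).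
  rewrite bigcap_seq; apply: bigsetI_measurable => i _.
  by rewrite -[X in measurable X]setTI; exact: measurable_row_coord.
apply/seteqP; split => x Ax i; first by move=> _; exact: Ax.
by apply: Ax; rewrite /= mem_enum.
Qed.

Lemma lebesgue_row_box (n : nat) (A : 'I_n -> set R) :
  (forall i, measurable (A i)) ->
  lebesgue_row n [set x | forall i, A i (x ord0 i)] =
  (\prod_(i < n) lebesgue_measure (A i))%E.
Proof.
elim: n A => [|n IHn] A mA /=.
  by rewrite big_ord0 diracE mem_set//= => -[].
rewrite /lebesgue_rowS /pushforward big_ord_recl -IHn; last by move=> i.
have mB : measurable [set x : 'rV[R]_n | forall i, A (lift ord0 i) (x ord0 i)].
  exact: (@measurable_row_box n (fun i => A (lift ord0 i))).
rewrite -product_measure1E//=; last exact: (mA ord0).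
congr (product_measure1 _ _ _); apply/seteqP; split => [[t x]|[t x]]/=.
  move=> Ax; split; first by have := Ax ord0; rewrite mxE unlift_none.
  by move=> i; have := Ax (lift ord0 i); rewrite mxE liftK.
by move=> [At Ax] i; rewrite mxE; case: unliftP => [j ->|->].
Qed.

End lebesgue_row.

Local Open Scope complex_scope.

Section sobolev_spaces.
Context {R : realType} {n : nat}.
Local Notation E := 'rV[R]_n.
Local Notation leb := (@lebesgue_row R n).
Implicit Types (f g phi : E -> R) (s : seq 'I_n).

(* partials [:: j1; ...; jm] phi = D_j1 (... (D_jm phi)) *)
Definition partials s phi : E -> R :=
  foldr (fun j g => fun x => 'D_(delta_mx ord0 j) g x) phi s.

Definition smooth phi := forall s,
  continuous (partials s phi) /\
  forall (j : 'I_n) (x : E), derivable (partials s phi) x (delta_mx ord0 j).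

Definition test_function phi :=
  smooth phi /\ exists K : set E, compact K /\ forall x, ~ K x -> phi x = 0.

Definition weak_derivative s f g := g \in Lfun leb 2%:E /\
  forall phi, test_function phi ->
    \int[leb]_x (f x * partials s phi x) =
    (-1) ^+ size s * \int[leb]_x (g x * phi x).

(* Elements of H^k are classes of functions modulo equality a.e.; they are
   handled through Borel representatives. *)
Definition sobolev (k : nat) f := f \in Lfun leb 2%:E /\
  forall s, (size s <= k)%N -> exists g, weak_derivative s f g.

Definition Hinfty f := forall k, sobolev k f.

Definition HinftyV (v : E -> E) := forall j, Hinfty (fun x => v x ord0 j).

(* A representative, unique up to equality a.e., of the weak derivative. *)
Definition wpartial (j : 'I_n) f : E -> R :=
  xget (fun=> 0) [set g | weak_derivative [:: j] f g].

Definition div (v : E -> E) : E -> R :=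
  fun x => \sum_j wpartial j (fun y => v y ord0 j) x.

End sobolev_spaces.

Section wave_functions.
Context {R : realType} {n : nat}.
Local Notation E := 'rV[R]_n.
Local Notation C := R[i].
Local Notation leb := (@lebesgue_row R n).
Implicit Types (f g psi phi : E -> C) (F G H : (E -> C) -> R).

Definition Psi psi :=
  Hinfty (fun x => complex.Re (psi x)) /\ Hinfty (fun x => complex.Im (psi x)).

Definition cpartial (j : 'I_n) psi : E -> C := fun x =>
  wpartial j (fun y => complex.Re (psi y)) x +i*
  wpartial j (fun y => complex.Im (psi y)) x.

Definition cintegral f : C :=
  (\int[leb]_x complex.Re (f x)) +i* (\int[leb]_x complex.Im (f x)).

Definition inner f g : R := complex.Re (cintegral (fun x => conjc (f x) * g x)).

Definition has_gradient F psi g := Psi g /\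
  forall phi, Psi phi ->
    is_derive (0 : R) (1 : R) (fun e : R => F (fun x => psi x + e%:C * phi x))
      (inner g phi).

Definition admits_gradients F :=
  forall psi, Psi psi -> exists g, has_gradient F psi g.

(* A representative, unique up to equality a.e. *)
Definition gradient F psi : E -> C :=
  xget (fun=> 0) [set g | has_gradient F psi g].

Definition ham_field H psi : E -> C := fun x => - ('i%C / 2) * gradient H psi x.

Definition nls_bracket F G psi : R := inner (gradient F psi) (ham_field G psi).

End wave_functions.

Section momentum_maps.
Context {R : realType} {n : nat}.
Local Notation E := 'rV[R]_n.
Local Notation C := R[i].
Local Notation leb := (@lebesgue_row R n).

Definition salg_carrier : Type := ((E -> E) * (E -> R))%type.

Definition salg (xi : salg_carrier) := HinftyV xi.1 /\ Hinfty xi.2.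

(* The bracket of the Lie algebra of Diff(R^n) |x H^oo(R^n; R) acting by
   (g, a) (h, b) = (g o h, a + b o g^-1); on vector fields it is minus the
   usual bracket, as always for the Lie algebra of a diffeomorphism group. *)
Definition salg_bracket (xi eta : salg_carrier) : salg_carrier :=
  let: (v, alpha) := xi in let: (w, beta) := eta in
  (fun x => \row_j \sum_k (w x ord0 k * wpartial k (fun y => v y ord0 j) x -
                            v x ord0 k * wpartial k (fun y => w y ord0 j) x),
   fun x => \sum_k (w x ord0 k * wpartial k alpha x -
                    v x ord0 k * wpartial k beta x)).

Definition sdual_carrier : Type := ((E -> E) * (E -> R))%type.

Definition sdual (m : sdual_carrier) := HinftyV m.1 /\ Hinfty m.2.

Definition pairing (m : sdual_carrier) (xi : salg_carrier) : R :=
  \int[leb]_x (m.2 x * xi.2 x + \sum_j m.1 x ord0 j * xi.1 x ord0 j).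

Definition vfield_family := salg_carrier -> (E -> C) -> (E -> C).

(* A Lie algebra action of s on Psi by linear vector fields.  It comes from a
   left group action, so that xi |-> act xi is a representation: [xi, eta] acts
   by the commutator of operators (the Jacobi-Lie bracket of the corresponding
   vector fields on Psi is the opposite). *)
Definition lie_algebra_action (act : vfield_family) :=
  [/\ forall xi psi, salg xi -> Psi psi -> Psi (act xi psi),
      forall xi (a : R) psi phi, salg xi -> Psi psi -> Psi phi ->
        act xi (fun x => a%:C * psi x + phi x) =
          (fun x => a%:C * act xi psi x + act xi phi x) %[ae leb],
      forall (a : R) xi eta psi, salg xi -> salg eta -> Psi psi ->
        act (a *: xi + eta) psi =
          (fun x => a%:C * act xi psi x + act eta psi x) %[ae leb] &
      forall xi eta, salg xi -> salg eta -> salg (salg_bracket xi eta) /\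
        forall psi, Psi psi ->
          act (salg_bracket xi eta) psi =
            (fun x => act xi (act eta psi) x - act eta (act xi psi) x)
              %[ae leb]].

Definition momentum_map (act : vfield_family) (J : (E -> C) -> sdual_carrier) :=
  (forall psi, Psi psi -> sdual (J psi)) /\
  forall xi, salg xi ->
    admits_gradients (fun psi => pairing (J psi) xi) /\
    forall psi, Psi psi ->
      ham_field (fun psi => pairing (J psi) xi) psi = act xi psi %[ae leb].

Definition admits_momentum_map (act : vfield_family) :=
  exists J, momentum_map act J.

Definition xi_Psi : vfield_family := fun xi psi =>
  let: (v, alpha) := xi in
  fun x => - (1 / 2) * psi x * (div v x)%:C - 'i%C * (alpha x)%:C * psi x
           - \sum_j cpartial j psi x * (v x ord0 j)%:C.

Definition madelung (psi : E -> C) : sdual_carrier :=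
  (fun x => \row_j complex.Im (conjc (psi x) * cpartial j psi x),
   fun x => complex.Re (conjc (psi x) * psi x)).

End momentum_maps.

(* Main.v *)
Require Import Defs.
From HB Require Import structures.
From mathcomp Require Import all_boot all_order all_algebra.
From mathcomp Require Import complex.
From mathcomp Require Import all_classical all_reals all_analysis.
From mathcomp Require Import measurable_realfun.
From mathcomp Require Import ring lra.

(** Write a wave function as [psi = r + i s] and let [T u] be minus the Lie
    derivative along [v] of the half-density with coefficient [u], that is
    [T u = - (1/2) u div v - v . grad u]. The action of [(v, alpha)] is
    [T psi - i alpha psi]: it applies [T] to [r] and [s] and rotates the phase.
    The pairing of the Madelung transform with [(v, alpha)] is the integral of

      [alpha (r^2 + s^2) + s T r - r T s],

    a quadratic form in [(r, s)] (the terms in [div v] cancel). Transport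
    preserves the integral of a product of two half-densities, so [T] is skew
    ([transport_skew]) and the bilinear form behind this quadratic form is
    symmetric ([madelung_formC]). Its gradient is therefore twice the operator
    representing it, which is [2 i (T psi - i alpha psi)]
    ([has_gradient_pairing]), and multiplying by [- i/2] gives back the action.
    Gradients are unique because the difference of two gradients at a point is
    a direction orthogonal to itself ([has_gradient_unique]). That the formula defines an
    action of the Lie algebra is the commutator identity
    [transport_vbracket], a consequence of the product rule and of the symmetry
    of second derivatives.

    All of this is formal once [H^oo] is known to be an algebra
    ([HinftyM]) on which weak derivatives satisfy the product rule
    ([wpartialM]), integration by parts ([wpartial_by_parts]) and symmetry
    ([wpartialC]). These facts are proved without mollification or Fourier
    transform, by means of translations along the axes.

    - A function [f] of [L^2] with a weak derivative [g] along an axis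
      satisfies [f (x + h e) - f x = h * (mean of g from x to x + h e)] for
      almost every [x] ([increments_weak_derivative]). The identity holds for
      test functions by the fundamental theorem of calculus, and testing it
      against them proves it in general. Tensor products of one-variable
      cutoffs are enough test functions, because boxes generate the Borel sets
      ([ae_eq0_of_tensor]).
    - If [g] has a weak derivative too, the translates of [f] expand as
      [f + h g + O(h^2)] in [L^2] ([taylor_increments]). Pairing the
      expansions of two functions and using translation invariance gives
      integration by parts ([taylor_by_parts]); with a test function as the
      second one, an expansion yields a weak derivative
      ([weak_derivative_taylor]).
    - The identity on increments bounds [f x ^ 2] by integrals of [f ^ 2] and
      [g ^ 2] over the line through [x]. Iterating this along all axes
      bounds [f] almost everywhere: functions of [H^oo] are essentially
      bounded ([Hinfty_ae_bounded]).
    - The product of two expansions with bounded coefficients is an expansion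
      ([taylorM]); this is the product rule, and stability of [H^oo] under
      products follows by induction on the order of derivation. *)

Set Implicit Arguments.
Unset Strict Implicit.
Unset Printing Implicit Defensive.

Import Order.TTheory GRing.Theory Num.Theory.
Import numFieldNormedType.Exports.

Local Open Scope classical_set_scope.
Local Open Scope ring_scope.

(** * Translations, and means along coordinate lines *)

Definition shift_row {R : realType} {n : nat} (j : 'I_n) (t : R) (x : 'rV[R]_n) :=
  x + t *: delta_mx ord0 j.

Section translation.
Context {R : realType}.
Local Notation leb n := (@lebesgue_row R n).
Local Notation l1 := (@lebesgue_measure R).

Lemma shift_rowE n (j : 'I_n) t (x : 'rV[R]_n) i :
  shift_row j t x ord0 i = x ord0 i + t * (i == j)%:R.
Proof. by rewrite /shift_row !mxE eqxx. Qed.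

Lemma shift_row_cons0 n t s (y : 'rV[R]_n) :
  shift_row ord0 t (row_cons (s, y)) = row_cons (s + t, y).
Proof.
apply/rowP => i; rewrite shift_rowE !mxE.
by case: unliftP => [k ->|->] /=; rewrite ?eqxx ?mulr1 // mulr0 addr0.
Qed.

Lemma shift_row_consS n (j : 'I_n) t s (y : 'rV[R]_n) :
  shift_row (lift ord0 j) t (row_cons (s, y)) = row_cons (s, shift_row j t y).
Proof.
apply/rowP => i; rewrite shift_rowE !mxE.
case: unliftP => [k ->|->] /=; first by rewrite shift_rowE (inj_eq lift_inj).
by rewrite mulr0 addr0.
Qed.

Lemma measurable_shift_row2 n (j : 'I_n) (c : R) :
  measurable_fun setT
    (fun p : 'rV[R]_n * measurableTypeR R => shift_row j (c * p.2) p.1).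
Proof.
apply: measurable_fun_row => i.
under eq_fun do rewrite shift_rowE.
apply: measurable_funD.
  exact: measurableT_comp (measurable_row_coord i) measurable_fst.
apply: measurable_funM => //; apply: measurable_funM => //.
Qed.

Lemma measurable_shift_row n (j : 'I_n) (t : R) :
  measurable_fun setT (@shift_row R n j t).
Proof.
apply: measurable_fun_row => i.
under eq_fun do rewrite shift_rowE.
apply: measurable_funD => //; exact: measurable_row_coord.
Qed.

Lemma lebesgue_measure_shift (t : R) (A : set R) : measurable A ->
  pushforward l1 (+%R^~ t : _ -> measurableTypeR R) A = l1 A.
Proof.
have mt : measurable_fun setT (+%R^~ t : R -> measurableTypeR R).
  exact: measurable_funD.
move=> mA; apply/esym.
pose mf_mixin := isMeasurableFun.Build _ _ R (measurableTypeR R) _ mt.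
pose mf : {mfun R >-> measurableTypeR R} := HB.pack (+%R^~ t : R -> measurableTypeR R) mf_mixin.
apply: (lebesgue_measure_unique (mu := [the measure _ _ of pushforward l1 mf])) mA.
move=> _ [[a b] _ <-] /=; rewrite /pushforward.
rewrite (_ : _ @^-1` _ = `](a - t), (b - t)]%classic); last first.
  by apply/seteqP; split => x /=; rewrite !in_itv/= ltrBlDr lerBrDr.
by rewrite !lebesgue_measure_itv/= !lte_fin ltrD2r -!EFinB opprB addrA subrK.
Qed.

Section nonneg.
Local Open Scope ereal_scope.

Lemma ge0_integral_shift (t : R) (F : R -> \bar R) :
  measurable_fun setT F -> (forall x, 0 <= F x) ->
  \int[l1]_x F (x + t)%R = \int[l1]_x F x.
Proof.
move=> mF F0.
have mt : measurable_fun setT (+%R^~ t : R -> measurableTypeR R).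
  exact: measurable_funD.
transitivity (\int[pushforward l1 (+%R^~ t : R -> measurableTypeR R)]_x F x).
  by rewrite ge0_integral_pushforward.
by apply: eq_measure_integral => A mA _; exact: lebesgue_measure_shift.
Qed.

(** Lebesgue measure is an iterated product: a shift of the first coordinate
    acts within the first factor, any other shift within the slices. *)
Lemma lebesgue_row_shift n (j : 'I_n) t (A : set 'rV[R]_n) : measurable A ->
  leb n (shift_row j t @^-1` A) = leb n A.
Proof.
elim: n j A => [[]//|n IHn] j A mA /=.
rewrite /lebesgue_rowS /pushforward.
set B := row_cons @^-1` A.
have mB : measurable (B : set (measurableTypeR R * 'rV[R]_n)).
  by rewrite -[X in measurable X]setTI; exact: measurable_row_cons.
case: (unliftP ord0 j) => [k ->|->].
  rewrite /product_measure1; apply: eq_integral => s _ /=.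
  rewrite -[RHS](IHn k); last exact: measurable_xsection mB.
  congr (leb n _); apply/seteqP; split => y /=;
    by rewrite /xsection/= !inE /B/= shift_row_consS.
rewrite /product_measure1 -(@ge0_integral_shift t (fun s => leb n (xsection B s))).
- apply: eq_integral => s _ /=.
  congr (leb n _); apply/seteqP; split => y /=;
    by rewrite /xsection/= !inE /B/= shift_row_cons0.
- exact: measurable_fun_xsection.
- by [].
Qed.

Lemma integral_shift_row n (j : 'I_n) t (F : 'rV[R]_n -> \bar R) :
  measurable_fun setT F ->
  \int[leb n]_x F (shift_row j t x) = \int[leb n]_x F x.
Proof.
move=> mF.
have ge0 (G : 'rV[R]_n -> \bar R) : measurable_fun setT G -> (forall x, 0 <= G x) ->
    \int[leb n]_x G (shift_row j t x) = \int[leb n]_x G x.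
  move=> mG G0.
  transitivity (\int[pushforward (leb n) (shift_row j t)]_x G x).
    by rewrite ge0_integral_pushforward//; exact: measurable_shift_row.
  apply: eq_measure_integral => [|? A mA _]; [exact: measurable_shift_row|exact: lebesgue_row_shift].
rewrite integralE [RHS]integralE; congr (_ - _).
  rewrite -[RHS]ge0//; last exact: measurable_funepos.
  by apply: eq_integral => x _; rewrite !funeposE.
rewrite -[RHS]ge0//; last exact: measurable_funeneg.
by apply: eq_integral => x _; rewrite !funenegE.
Qed.

Lemma ae_shift_row n (j : 'I_n) t (P : 'rV[R]_n -> Prop) :
  {ae leb n, forall x, P x} -> {ae leb n, forall x, P (shift_row j t x)}.
Proof.
move=> [N [mN N0 PN]]; exists (shift_row j t @^-1` N); split.
- by rewrite -[X in measurable X]setTI; exact: measurable_shift_row.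
- by rewrite lebesgue_row_shift.
- by move=> x /= nP; exact: PN.
Qed.

(** Slicing either way computes the same product measure of [N], which
    therefore vanishes. *)
Lemma ae_ae_section d1 d2 (T1 : measurableType d1) (T2 : measurableType d2)
    (mu : {sigma_finite_measure set T1 -> \bar R})
    (nu : {sigma_finite_measure set T2 -> \bar R}) (N : set (T1 * T2)) :
  measurable N -> (forall u, mu (ysection N u) = 0) ->
  {ae mu, forall x, {ae nu, forall u, ~ N (x, u)}}.
Proof.
move=> mN N0.
have mf : measurable_fun setT (fun x => nu (xsection N x)).
  exact: measurable_fun_xsection.
have : \int[mu]_x `| nu (xsection N x) | = 0.
  transitivity ((mu \x nu) N).
    by apply: eq_integral => x _; rewrite gee0_abs.
  transitivity ((mu \x^ nu) N).
    by apply: product_measure_unique => //= A B mA mB; rewrite product_measure2E.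
  by rewrite /product_measure2; apply: integral0_eq => u _ /=.
move/(ae_eq_integral_abs mu measurableT mf); apply: filterS => x /(_ I) /= h.
exists (xsection N x); split => //; first exact: measurable_xsection.
by move=> u /=; rewrite /xsection/= inE => /contrapT.
Qed.

(** Every translation preserves null sets. Exchanging the two variables makes
    the exceptional set of translations null for almost every base point, so
    that properties true almost everywhere can be integrated along lines. *)
Lemma ae_shift_section n (j : 'I_n) (c : R)
    (nu : {sigma_finite_measure set (measurableTypeR R) -> \bar R})
    (P : 'rV[R]_n -> Prop) : {ae leb n, forall x, P x} ->
  {ae leb n, forall x, {ae nu, forall u, P (shift_row j (c * u)%R x)}}.
Proof.
move=> [N [mN N0 PN]].
have := @ae_ae_section _ _ _ _ (leb n) nu
  ((fun p => shift_row j (c * p.2)%R p.1) @^-1` N).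
move=> /(_ _ _)/wrap[].
- by rewrite -[X in measurable X]setTI; exact: measurable_shift_row2.
- move=> u; rewrite -[RHS]N0 -[RHS](lebesgue_row_shift j (c * u)%R mN).
  by congr (leb n _); apply/seteqP; split => x; rewrite /ysection/= inE.
- apply: filterS => x; apply: filterS => u /= h.
  by apply: contrapT => nP; apply: h; exact: PN.
Qed.

(** With the uniform probability on the unit interval this is the mean over a
    segment of length [c]; with Lebesgue measure and [c = 1] it is the
    integral over a whole line. *)
Definition line_mean n (nu : {sigma_finite_measure set (measurableTypeR R) -> \bar R})
    (c : R) (j : 'I_n) (F : 'rV[R]_n -> \bar R) : 'rV[R]_n -> \bar R :=
  fun x => \int[nu]_u F (shift_row j (c * u)%R x).

Section line_mean.
Context n (nu : {sigma_finite_measure set (measurableTypeR R) -> \bar R})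
  (c : R) (j : 'I_n).
Implicit Types F G : 'rV[R]_n -> \bar R.

Lemma measurable_fun_shift_row2 d (T : measurableType d) (F : 'rV[R]_n -> T) :
  measurable_fun setT F ->
  measurable_fun setT
    (fun p : 'rV[R]_n * measurableTypeR R => F (shift_row j (c * p.2)%R p.1)).
Proof.
by move=> mF; exact: measurableT_comp mF (@measurable_shift_row2 n j c).
Qed.

Lemma measurable_shift_line d (T : measurableType d) (F : 'rV[R]_n -> T) x :
  measurable_fun setT F ->
  measurable_fun setT (fun u : measurableTypeR R => F (shift_row j (c * u)%R x)).
Proof.
move=> mF.
exact: (measurableT_comp (measurable_fun_shift_row2 mF) (pair1_measurable x)).
Qed.

Lemma line_mean_ge0 F x : (forall y, 0 <= F y) -> 0 <= line_mean nu c j F x.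
Proof. by move=> F0; exact: integral_ge0. Qed.

Lemma measurable_line_mean F : measurable_fun setT F -> (forall x, 0 <= F x) ->
  measurable_fun setT (line_mean nu c j F).
Proof.
move=> mF F0.
apply: (measurable_fun_fubini_tonelli_F
  (fun p : 'rV[R]_n * measurableTypeR R => F (shift_row j (c * p.2)%R p.1))) => //.
exact: measurable_fun_shift_row2.
Qed.

(** Tonelli and translation invariance. *)
Lemma integral_line_mean F : measurable_fun setT F -> (forall x, 0 <= F x) ->
  \int[leb n]_x line_mean nu c j F x = nu setT * \int[leb n]_x F x.
Proof.
move=> mF F0; rewrite /line_mean.
rewrite (@fubini_tonelli _ _ _ _ _ (leb n) nu
  (fun p => F (shift_row j (c * p.2)%R p.1)))//=; last exact: measurable_fun_shift_row2.
under eq_integral do rewrite integral_shift_row//.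
by rewrite integral_cst// muleC.
Qed.

Lemma ae_le_line_mean F G : measurable_fun setT F -> (forall x, 0 <= F x) ->
  measurable_fun setT G -> (forall x, 0 <= G x) ->
  {ae leb n, forall x, F x <= G x} ->
  {ae leb n, forall x, line_mean nu c j F x <= line_mean nu c j G x}.
Proof.
move=> mF F0 mG G0 /(@ae_shift_section _ j c nu).
apply: filterS => x FG; apply: ae_ge0_le_integral => //.
- exact: measurable_shift_line.
- exact: measurable_shift_line.
- case: FG => N [mN N0 FGN]; exists N; split => // u /= nFG; apply: FGN => h; apply: nFG => _; exact: h.
Qed.

Lemma line_meanD F G x : measurable_fun setT F -> (forall x, 0 <= F x) ->
  measurable_fun setT G -> (forall x, 0 <= G x) ->
  line_mean nu c j (F \+ G) x = line_mean nu c j F x + line_mean nu c j G x.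
Proof.
move=> mF F0 mG G0; rewrite /line_mean ge0_integralD//; exact: measurable_shift_line.
Qed.

End line_mean.

Definition iter_line_mean n (js : seq 'I_n) (F : 'rV[R]_n -> \bar R) :=
  foldr (line_mean l1 1%R) F js.

Lemma iter_line_mean_measurable_ge0 n js (F : 'rV[R]_n -> \bar R) :
  measurable_fun setT F -> (forall x, 0 <= F x) ->
  measurable_fun setT (iter_line_mean js F) /\ forall x, 0 <= iter_line_mean js F x.
Proof.
move=> mF F0; elim: js => [//|j js [mI I0]] /=; split.
  exact: measurable_line_mean.
by move=> x; exact: line_mean_ge0.
Qed.

Lemma iter_line_mean_lift n (js : seq 'I_n) (F : 'rV[R]_n.+1 -> \bar R) s y :
  iter_line_mean (map (lift ord0) js) F (row_cons (s, y)) =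
  iter_line_mean js (fun z => F (row_cons (s, z))) y.
Proof.
elim: js y => [//|j js IH] y /=; apply: eq_integral => u _.
by rewrite shift_row_consS IH.
Qed.

Lemma row_unconsK n : cancel (@row_uncons R n) row_cons.
Proof.
move=> x; apply/rowP => i; rewrite !mxE.
by case: unliftP => [j ->|->] /=; rewrite ?mxE.
Qed.

(** Lebesgue measure is an iterated product, so integrating along every
    coordinate line in turn integrates over the whole space; the base point is
    absorbed by translation invariance. *)
Lemma iter_line_mean_enum n (F : 'rV[R]_n -> \bar R) x :
  measurable_fun setT F -> (forall x, 0 <= F x) ->
  iter_line_mean (enum 'I_n) F x = \int[leb n]_y F y.
Proof.
elim: n F x => [|n IHn] F x mF F0.
  rewrite (_ : enum 'I_0 = [::]); last by apply/eqP; rewrite -size_eq0 size_enum_ord.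
  rewrite /= integral_dirac//= diracT mul1e.
  by congr F; apply/rowP => -[].
rewrite enum_ordSl /= -[x]row_unconsK; case: (row_uncons x) => s y.
have mFc (t : R) : measurable_fun setT (fun z => F (row_cons (t, z))).
  apply: (measurableT_comp mF).
  apply: (measurableT_comp measurable_row_cons).
  exact: pair1_measurable.
transitivity (\int[l1]_u \int[leb n]_z F (row_cons ((s + u)%R, z))).
  apply: eq_integral => u _.
  rewrite shift_row_cons0 mul1r iter_line_mean_lift IHn//.
have mFr : measurable_fun setT (F \o row_cons : measurableTypeR R * 'rV[R]_n -> \bar R).
  exact: measurableT_comp mF measurable_row_cons.
under eq_integral do rewrite addrC.
rewrite (@ge0_integral_shift s (fun u => \int[leb n]_z F (row_cons (u, z)))); last 2 first.
- apply: (measurable_fun_fubini_tonelli_F (F \o row_cons)); first exact: mFr.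
  by move=> p; exact: F0.
- by move=> u; exact: integral_ge0.
rewrite /= /lebesgue_rowS.
rewrite ge0_integral_pushforward//; last exact: measurable_row_cons.
rewrite fubini_tonelli1; [by []|exact: mFr|by move=> p; exact: F0].
Qed.

Lemma iter_line_meanD n js (F G : 'rV[R]_n -> \bar R) :
  measurable_fun setT F -> (forall x, 0 <= F x) ->
  measurable_fun setT G -> (forall x, 0 <= G x) ->
  iter_line_mean js (F \+ G) = iter_line_mean js F \+ iter_line_mean js G.
Proof.
move=> mF F0 mG G0; elim: js => [//|j js IH] /=; rewrite IH.
have [? ?] := iter_line_mean_measurable_ge0 js mF F0.
have [? ?] := iter_line_mean_measurable_ge0 js mG G0.
by apply/funext => x; exact: line_meanD.
Qed.

End nonneg.

End translation.

(** * Square-integrable functions *)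

Section square_integrable.
Context d (T : measurableType d) (R : realType) (mu : {measure set T -> \bar R}).
Implicit Types f g h : T -> R.
Local Notation L2 := (Lfun mu 2%:E).

Lemma Lfun2_measurable f : f \in L2 -> measurable_fun setT f.
Proof. by move=> /andP[]; rewrite inE. Qed.

Lemma Lfun2P f :
  f \in L2 <-> measurable_fun setT f /\ (\int[mu]_x ((f x) ^+ 2)%:E < +oo)%E.
Proof.
split=> [fL|[mf fi]].
  split; first exact: Lfun2_measurable.
  have /integrableP[_] := Lfun2_integrable_sqr fL.
  by under eq_integral do rewrite /= ger0_norm ?sqr_ge0//.
apply/andP; split; rewrite inE//=.
rewrite /finite_norm unlock/=; apply: poweR_lty.
apply: le_lt_trans fi; rewrite le_eqVlt; apply/orP; left; apply/eqP.
apply: eq_integral => x _ /=.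
by rewrite powR_mulrn// real_normK ?num_real.
Qed.

Lemma Lfun2_integrableM f g : f \in L2 -> g \in L2 ->
  mu.-integrable setT (fun x => (f x * g x)%:E).
Proof. by move=> fL gL; apply/Lfun1_integrable; exact: Lfun2_mul_Lfun1. Qed.

Lemma Lfun2_dominated f (F : T -> \bar R) : measurable_fun setT f ->
  measurable_fun setT F ->
  {ae mu, forall x, ((f x ^+ 2)%:E <= F x)%E} -> (forall x, 0 <= F x)%E ->
  (\int[mu]_x F x < +oo)%E -> f \in L2.
Proof.
move=> mf mF fF F0 Foo; apply/Lfun2P; split=> //.
apply: le_lt_trans Foo; apply: ae_ge0_le_integral => //.
- by move=> x _; rewrite lee_fin sqr_ge0.
- by apply/measurable_EFinP; exact: measurable_funX.
- by apply: filterS fF => x ? _.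
Qed.

Lemma Lfun2Z a f : f \in L2 -> (fun x => a * f x) \in L2.
Proof.
move=> /Lfun2P[mf fi]; apply/Lfun2P; split; first exact: measurable_funM.
under eq_integral do rewrite exprMn EFinM.
rewrite ge0_integralZl//; last first.
- by rewrite lee_fin sqr_ge0.
- by move=> x _; rewrite lee_fin sqr_ge0.
- by apply/measurable_EFinP; exact: measurable_funX.
by rewrite lte_mul_pinfty// lee_fin sqr_ge0.
Qed.

Lemma Lfun2D f g : f \in L2 -> g \in L2 -> (fun x => f x + g x) \in L2.
Proof. exact: (Lfun_addr_closed mu (lee1n 2)).2. Qed.

Lemma Lfun2N f : f \in L2 -> (fun x => - f x) \in L2.
Proof.
move=> fL; rewrite (_ : (fun _ => _) = fun x => -1 * f x); first exact: Lfun2Z.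
by apply/funext => x; rewrite mulN1r.
Qed.

Lemma Lfun2B f g : f \in L2 -> g \in L2 -> (fun x => f x - g x) \in L2.
Proof. by move=> fL gL; apply: Lfun2D => //; exact: Lfun2N. Qed.

Lemma Lfun2_0 : (fun=> 0) \in L2.
Proof.
apply/Lfun2P; split => //.
by under eq_integral do rewrite expr0n/=; rewrite integral0.
Qed.

Definition ae_bounded f := exists M, {ae mu, forall x, f x ^+ 2 <= M}.

Lemma Lfun2_ae_boundedM f g : f \in L2 -> measurable_fun setT g -> ae_bounded g ->
  (fun x => g x * f x) \in L2.
Proof.
move=> fL mg [M gM].
have /Lfun2P[mf fi] := Lfun2Z (1 + `|M|) fL.
apply: (@Lfun2_dominated _ (fun x => (((1 + `|M|) * f x) ^+ 2)%:E)) => //.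
- by apply: measurable_funM => //; exact: Lfun2_measurable.
- by apply/measurable_EFinP; exact: measurable_funX.
- apply: filterS gM => x gx; rewrite lee_fin !exprMn ler_wpM2r ?sqr_ge0//.
  apply: (le_trans gx); rewrite (le_trans (ler_norm _))//.
  by have := normr_ge0 M; nra.
- by move=> x; rewrite lee_fin sqr_ge0.
Qed.

Lemma ae_eq_Rintegral f g : measurable_fun setT f -> measurable_fun setT g ->
  f = g %[ae mu] -> \int[mu]_x f x = \int[mu]_x g x.
Proof.
move=> mf mg fg; congr fine; apply: ae_eq_integral => //; [exact/measurable_EFinP..|].
by apply: filterS fg => x h _; rewrite h.
Qed.

Lemma Lfun2_integral_sqr f : f \in L2 ->
  (\int[mu]_x ((f x) ^+ 2)%:E = (\int[mu]_x (f x ^+ 2))%:E)%E.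
Proof.
by move=> fL; rewrite /Rintegral fineK//; exact: integrable_fin_num (Lfun2_integrable_sqr fL).
Qed.

Lemma Lfun2_sqr_eq0 f : f \in L2 -> \int[mu]_x (f x * f x) = 0 -> f = cst 0 %[ae mu].
Proof.
move=> fL f0; have mf := Lfun2_measurable fL.
have : (\int[mu]_x `| (f x ^+ 2)%:E | = 0)%E.
  under eq_integral do rewrite gee0_abs ?lee_fin ?sqr_ge0//.
  rewrite Lfun2_integral_sqr//; congr EFin; rewrite -[RHS]f0.
  by apply: eq_Rintegral => x _; rewrite expr2.
have mf2 : measurable_fun setT (fun x => ((f x) ^+ 2)%:E).
  by apply/measurable_EFinP; exact: measurable_funX.
move/(ae_eq_integral_abs mu measurableT mf2).
by apply: filterS => x /= h _; move: (h I) => -[] /eqP; rewrite sqrf_eq0 => /eqP.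
Qed.

(** The Cauchy-Schwarz inequality in additive form, which is enough to show
    that inner products with small remainders are small. *)
Lemma Rintegral_mul_le f g : f \in L2 -> g \in L2 ->
  `|\int[mu]_x (f x * g x)| <= \int[mu]_x (f x ^+ 2) + \int[mu]_x (g x ^+ 2).
Proof.
move=> fL gL.
have fgi := Lfun2_integrableM fL gL.
apply: (le_trans (le_normr_Rintegral measurableT fgi)).
rewrite -RintegralD//; [|exact: Lfun2_integrable_sqr..].
apply: le_Rintegral => //.
- exact: (integrable_norm fgi).
- by apply: (@integrableD _ _ _ _ _ measurableT (EFin \o (fun x => f x ^+ 2)) (EFin \o (fun x => g x ^+ 2))); rewrite //; exact: Lfun2_integrable_sqr.
move=> x _; rewrite normrM -(real_normK (num_real (f x))) -(real_normK (num_real (g x))).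
by move: (normr_ge0 (f x)) (normr_ge0 (g x)); nra.
Qed.

End square_integrable.

(** * Smooth cutoffs on the line *)

Section smooth_functions_on_the_line.
Context {R : realType}.
Implicit Types (b c : R -> R) (k m : nat).

Fixpoint times_derivable m b : Prop :=
  if m is m'.+1 then (forall x, derivable b x 1) /\ times_derivable m' b^`()%classic
  else True.

Definition smooth1 b := forall m, times_derivable m b.

Lemma times_derivableW m b : times_derivable m.+1 b -> times_derivable m b.
Proof. by elim: m b => [//|m IH] b [db /IH]. Qed.

Lemma times_derivableD m b c : times_derivable m b -> times_derivable m c ->
  times_derivable m (b \+ c).
Proof.
elim: m b c => [//|m IH] b c [db mb] [dc mc]; split.
  by move=> x; exact: derivableD.
rewrite (_ : _^`()%classic = b^`()%classic \+ c^`()%classic); first exact: IH.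
by apply/funext => x; rewrite derive1E deriveD//= !derive1E.
Qed.

Lemma times_derivableM m b c : times_derivable m b -> times_derivable m c ->
  times_derivable m (b \* c).
Proof.
elim: m b c => [//|m IH] b c mb mc; split.
  by move=> x; apply: derivableM; [exact: mb.1|exact: mc.1].
rewrite (_ : _^`()%classic = (b \* c^`()%classic) \+ (c \* b^`()%classic)).
  apply: times_derivableD; apply: IH.
  - exact: times_derivableW.
  - exact: mc.2.
  - exact: times_derivableW.
  - exact: mb.2.
apply/funext => x; rewrite !derive1E/= deriveM ?derive1E//; [exact: mb.1|exact: mc.1].
Qed.

Lemma times_derivable_cst m (a : R) : times_derivable m (cst a).
Proof.
elim: m a => [//|m IH] a; split => [x|]; first exact: derivable_cst.
by rewrite (_ : _^`()%classic = cst 0)//; apply/funext => x; rewrite derive1_cst.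
Qed.

Lemma is_derive_affine (a s x : R) : is_derive x 1 (fun t => a * t + s) a.
Proof.
have : is_derive x 1 (a \*: id + cst s) (a *: 1 + 0) by exact: is_deriveD.
by rewrite addr0 /GRing.scale/= mulr1.
Qed.

Lemma times_derivable_affine m b (a s : R) : times_derivable m b ->
  times_derivable m (fun t => b (a * t + s)).
Proof.
elim: m b => [//|m IH] b [db mb].
have daf t : derivable (fun t => a * t + s) t 1 by have [] := is_derive_affine a s t.
split=> [x|].
  by apply/derivable1_diffP/(@differentiable_comp _ _ _ _ (fun t => a * t + s) b);
    apply/derivable1_diffP.
rewrite (_ : _^`()%classic = (cst a) \* (fun t => b^`()%classic (a * t + s))).
  by apply: times_derivableM; [exact: times_derivable_cst|exact: IH].
apply/funext => t; rewrite (derive1_comp (daf t) (db _))/=.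
by have [_] := is_derive_affine a s t; rewrite -derive1E => ->; rewrite mulrC.
Qed.

Lemma smooth1_derive b : smooth1 b -> smooth1 b^`()%classic.
Proof. by move=> sb m; have [] := sb m.+1. Qed.

Lemma smooth1_derivable b x : smooth1 b -> derivable b x 1.
Proof. by move=> sb; have [] := sb 1%N. Qed.

Lemma smooth1_continuous b : smooth1 b -> continuous b.
Proof.
by move=> sb x; apply/differentiable_continuous/derivable1_diffP; exact: smooth1_derivable.
Qed.

(** The function [x^-k exp(-1/x)], extended by zero. The linear span of these
    functions is stable under derivation, which makes them smooth across the
    origin and gives cutoffs that vanish on a half-line. *)
Definition flat k (x : R) : R := if 0 < x then x^-1 ^+ k * expR (- x^-1) else 0.

Lemma flat_ge0 k x : 0 <= flat k x.
Proof.
rewrite /flat; case: ifP => // x0.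
by rewrite mulr_ge0 ?expR_ge0// exprn_ge0// invr_ge0 ltW.
Qed.

(** With [y = 1/x] this is [y^(k+1) / (k+1)! <= exp y]. *)
Lemma flat_le k (x : R) : flat k x <= (k.+1)`!%:R * `|x|.
Proof.
rewrite /flat; case: ifP => x0; last by rewrite mulr_ge0.
have y0 : 0 < x^-1 by rewrite invr_gt0.
rewrite gtr0_norm// -[x in leRHS]invrK; move: (x^-1) y0 => y y0.
rewrite ler_pdivlMr// mulrAC -exprSr expRN ler_pdivrMr ?expR_gt0//.
rewrite -ler_pdivrMl ?ltr0n ?fact_gt0// mulrC.
by apply: le_trans (expR_ge1Dxn k (ltW y0)); rewrite lerDr.
Qed.

(** At the origin the growth rate is a value of [flat k.+1], which [flat_le]
    bounds linearly. *)
Lemma is_derive_flat k (x : R) :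
  is_derive x 1 (flat k) (flat k.+2 x - k%:R * flat k.+1 x).
Proof.
have [x0|x0|->] := ltgtP x 0.
- rewrite /flat ltNge (ltW x0)/= mulr0 subrr.
  apply: (@near_eq_is_derive _ _ _ (cst 0)) => //.
  near=> y; rewrite ifF//; apply/negbTE; rewrite -leNgt ltW//.
  by near: y; exact: lt_nbhsl.
- apply: (@near_eq_is_derive _ _ _
    ((fun y : R => y^-1) ^+ k * (expR \o (fun y => - y^-1)))).
    near=> y; rewrite /flat ifT//=; first by rewrite mulrfctE exprfctE.
    by near: y; exact: lt_nbhsr.
  have dV : is_derive x 1 (fun y : R => y^-1) (- x ^- 2).
    have := @is_deriveV R id x 1 1 (lt0r_neq0 x0) (is_derive_id _ _).
    by rewrite /GRing.scale/= mulr1.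
  have dE : is_derive x 1 (expR \o (fun y : R => - y^-1)) (expR (- x^-1) * x ^- 2).
    have := @is_derive1_comp R expR (fun y => - y^-1) x _ _ (is_derive_expR _) (is_deriveN dV).
    by rewrite opprK.
  apply: is_derive_eq.
  rewrite /flat x0 /GRing.scale/= !exprfctE -exprVn.
  by case: k => [|k] /=; rewrite ?mulr0 ?mul0r ?addr0 ?subr0 !exprS; ring.
- have cv : (fun h => h^-1 *: ((flat k \o shift 0) (h *: 1) - flat k 0)) @ 0^' --> (0:R).
    have flat0 : flat k 0 = 0 by rewrite /flat ltxx.
    have bound (h : R) : `|h^-1 *: ((flat k \o shift 0) (h *: 1) - flat k 0)| <=
        (k.+2)`!%:R * `|h|.
      rewrite flat0 subr0 /= addr0 /GRing.scale/= mulr1.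
      apply: le_trans (flat_le k.+1 h); rewrite normrM (ger0_norm (flat_ge0 _ _)).
      rewrite /flat; case: ifP => h0; last by rewrite mulr0.
      by rewrite gtr0_norm ?invr_gt0// mulrA -exprS.
    apply/cvgr0Pnorm_lt => e e0; near=> h.
    apply: (le_lt_trans (bound h)); rewrite -ltr_pdivlMl ?ltr0n ?fact_gt0//.
    by near: h; apply: (@cvgr0_norm_lt _ _ _ (0^') _ id);
      [exact: nbhs_dnbhs|rewrite mulr_gt0 ?invr_gt0 ?ltr0n ?fact_gt0].
  have -> : flat k.+2 0 - k%:R * flat k.+1 0 = 0 :> R by rewrite /flat ltxx mulr0 subrr.
  by apply: DeriveDef; [apply/cvg_ex; exists 0|exact: cvg_lim cv].
Unshelve. all: by end_near. Qed.

Lemma smooth1_flat k : smooth1 (flat k).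
Proof.
move=> m; elim: m k => [//|m IH] k; split.
  by move=> x; have [] := is_derive_flat k x.
rewrite (_ : _^`()%classic = flat k.+2 \+ (cst (- k%:R) \* flat k.+1)).
  apply: times_derivableD; first exact: IH.
  by apply: times_derivableM; [exact: times_derivable_cst|exact: IH].
by apply/funext => x; have [_] := is_derive_flat k x; rewrite -derive1E => -> /=; rewrite mulNr.
Qed.

(** A smooth function supported in the segment from [a] to [e], tending to the
    indicator of its interior as [k] grows. *)
Definition cutoff (a e : R) k (x : R) : R :=
  flat 0 (k%:R * (x - a)) * flat 0 (k%:R * (e - x)).

Lemma smooth1_cutoff a e k : smooth1 (cutoff a e k).
Proof.
move=> m; rewrite (_ : cutoff a e k = (fun x => flat 0 (k%:R * x + - (k%:R * a))) \*
    (fun x => flat 0 (- k%:R * x + k%:R * e))); last first.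
  by apply/funext => x; rewrite /cutoff /=; congr (flat _ _ * flat _ _); ring.
by apply: times_derivableM; apply: times_derivable_affine; exact: smooth1_flat.
Qed.

Lemma flat0_itv (x : R) : 0 <= flat 0 x <= 1.
Proof.
rewrite flat_ge0/= /flat; case: ifP => // x0.
by rewrite expr0 mul1r -expR0 ler_expR oppr_le0 invr_ge0 ltW.
Qed.

Lemma cutoff_itv a e k x : 0 <= cutoff a e k x <= 1.
Proof.
have /andP[p0 p1] := flat0_itv (k%:R * (x - a)).
have /andP[q0 q1] := flat0_itv (k%:R * (e - x)).
by rewrite /cutoff mulr_ge0//= mulr_ile1.
Qed.

Lemma cutoff_out a e k x : ~ (a < x < e) -> cutoff a e k x = 0.
Proof.
move=> out; rewrite /cutoff /flat.
have [xa|ax] := leP x a.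
  by rewrite ifF ?mul0r//; apply/negbTE; rewrite -leNgt mulr_ge0_le0// subr_le0.
rewrite [X in _ * X]ifF ?mulr0//; apply/negbTE; rewrite -leNgt mulr_ge0_le0// subr_le0.
by rewrite leNgt; apply/negP => xe; apply: out; rewrite ax.
Qed.

Lemma cvg_flat0 (y : R) : 0 < y -> flat 0 (k%:R * y) @[k --> \oo] --> (1 : R).
Proof.
move=> y0.
have h : expR (- (y^-1 * k%:R^-1)) @[k --> \oo] --> (1 : R).
  have h0 : - (y^-1 * k%:R^-1) @[k --> \oo] --> (0 : R).
    rewrite -[X in _ --> X]oppr0 -(mulr0 y^-1); apply: cvgN; apply: cvgMl_tmp.
    apply/gtr0_cvgV0; last exact: cvgr_idn.
    by near=> k; rewrite ltr0n; near: k; exact: nbhs_infty_gt.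
  have := cvg_comp _ _ h0 (@continuous_expR R 0).
  by rewrite expR0.
apply: cvg_trans h; apply: near_eq_cvg; near=> k.
have k0 : (0 < k)%N by near: k; exact: nbhs_infty_gt.
by rewrite /flat mulr_gt0 ?ltr0n// expr0 mul1r invfM mulrC.
Unshelve. all: by end_near. Qed.

Lemma cvg_cutoff a e (x : R) : cutoff a e k x @[k --> \oo] --> ((a < x < e)%R%:R : R).
Proof.
case: (boolP (a < x < e)) => [/andP[ax xe]|/negP out].
  rewrite -[X in _ --> X]mulr1; apply: cvgM; apply: cvg_flat0; by rewrite subr_gt0.
by under eq_fun do rewrite cutoff_out//; exact: cvg_cst.
Qed.

End smooth_functions_on_the_line.

(** * Tensor products of smooth functions *)

Section derivatives_along_lines.
Context {R : realType}.

(** A directional derivative only sees the restriction to a line, where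
    one-variable calculus applies. *)
Lemma growth_rate_line (V : normedModType R) (f : V -> R) (g : R -> R) (a v : V) s :
  (forall h, f (h *: v + a) = g (h + s)) ->
  (fun h => h^-1 *: ((f \o shift a) (h *: v) - f a)) =
  (fun h => h^-1 *: ((g \o shift s) (h *: 1) - g s)).
Proof.
move=> fg; apply/funext => h /=.
rewrite fg [_%:A]mulr1; congr (_ *: (_ - _)).
by have := fg 0; rewrite scale0r !add0r.
Qed.

Lemma derivable_line (V : normedModType R) (f : V -> R) (g : R -> R) (a v : V) s :
  (forall h, f (h *: v + a) = g (h + s)) -> derivable g s 1 -> derivable f a v.
Proof. by move=> /growth_rate_line E; rewrite /derivable E. Qed.

Lemma derive_line (V : normedModType R) (f : V -> R) (g : R -> R) (a v : V) s :
  (forall h, f (h *: v + a) = g (h + s)) -> 'D_v f a = g^`()%classic s.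
Proof. by move=> /growth_rate_line E; rewrite derive1E /derive E. Qed.

End derivatives_along_lines.

Section tensor_products.
Context {R : realType} {n : nat}.
Local Notation E := 'rV[R]_n.
Implicit Types (b : 'I_n -> R -> R).

Definition tensor b : E -> R := fun x => \prod_i b i (x ord0 i).

Definition subst_derivative b (j : 'I_n) : 'I_n -> R -> R :=
  fun i => if i == j then (b i)^`()%classic else b i.

Lemma tensor_line b j (x : E) h :
  tensor b (h *: delta_mx ord0 j + x) =
  (\prod_(i | i != j) b i (x ord0 i)) * b j (h + x ord0 j).
Proof.
rewrite /tensor (bigD1 j)//= !mxE !eqxx mulr1 mulrC; congr (_ * _).
by apply: eq_bigr => i ij; rewrite !mxE eqxx (negbTE ij) mulr0 add0r.
Qed.

Lemma derivable_tensor b j x : (forall i, smooth1 (b i)) ->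
  derivable (tensor b) x (delta_mx ord0 j).
Proof.
move=> sb.
apply: (@derivable_line _ _ _ (cst (\prod_(i | i != j) b i (x ord0 i)) \* b j) _ _ (x ord0 j)).
  exact: tensor_line.
apply: derivableM; first exact: derivable_cst.
exact: smooth1_derivable.
Qed.

(** Along the axis [j] all factors but one are constant, so deriving a tensor
    product derives a single factor. *)
Lemma partials_tensor1 b j : (forall i, smooth1 (b i)) ->
  partials [:: j] (tensor b) = tensor (subst_derivative b j).
Proof.
move=> sb; apply/funext => x /=.
rewrite (@derive_line _ _ _ (cst (\prod_(i | i != j) b i (x ord0 i)) \* b j) _ _ (x ord0 j));
  last exact: tensor_line.
rewrite derive1E deriveM; [|exact: derivable_cst|exact: smooth1_derivable].
rewrite derive_cst scaler0 addr0 -derive1E /GRing.scale/= /tensor [RHS](bigD1 j)//= mulrC /subst_derivative.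
by rewrite eqxx; congr (_ * _); apply: eq_bigr => i /negbTE ->.
Qed.

Lemma smooth1_subst_derivative b j : (forall i, smooth1 (b i)) ->
  forall i, smooth1 (subst_derivative b j i).
Proof. by move=> sb i; rewrite /subst_derivative; case: ifP => _ //; exact: smooth1_derive. Qed.

Lemma partials_tensor b s : (forall i, smooth1 (b i)) ->
  exists2 c : 'I_n -> R -> R, (forall i, smooth1 (c i)) & partials s (tensor b) = tensor c.
Proof.
move=> sb; elim: s => [|j s [c sc E]]; first by exists b.
exists (subst_derivative c j); first exact: smooth1_subst_derivative.
by rewrite -partials_tensor1//= -E.
Qed.

Lemma continuous_tensor b : (forall i, smooth1 (b i)) -> continuous (tensor b).
Proof.
move=> sb.
have cb i : continuous (fun x : E => b i (x ord0 i)).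
  move=> x; apply: (@continuous_comp _ _ _ (fun y : E => y ord0 i) (b i) x).
    exact: coord_continuous.
  exact: smooth1_continuous.
rewrite /tensor; elim: (index_enum _) => [|i r IH].
  by under eq_fun do rewrite big_nil; exact: cst_continuous.
under eq_fun do rewrite big_cons.
by move=> x; exact: (continuousM (cb i x) (IH x)).
Qed.

(** Partial derivatives of tensor products are tensor products, so smoothness
    in each variable is enough. *)
Lemma test_function_tensor b (M : R) : (forall i, smooth1 (b i)) ->
  (forall i t, M < `|t| -> b i t = 0) -> test_function (tensor b).
Proof.
move=> sb bM; split.
  move=> s; have [c sc ->] := partials_tensor s sb.
  by split=> [|j x]; [exact: continuous_tensor|exact: derivable_tensor].
exists [set x | forall i, `[- M, M]%classic (x ord0 i)]; split.
  apply: (@rV_compact R n (fun=> `[- M, M]%classic)) => i; exact: segment_compact.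
move=> x /existsNP[i xi]; rewrite /tensor (bigD1 i)//= bM ?mul0r//.
by rewrite ltNge; apply/negP; rewrite ler_norml => h; apply: xi; rewrite /= in_itv.
Qed.

(** Swapping the two substitutions is the commutation of partial derivatives. *)
Lemma partials_tensorC b j k : (forall i, smooth1 (b i)) ->
  partials [:: j; k] (tensor b) = partials [:: k; j] (tensor b).
Proof.
move=> sb; have [->//|jk] := eqVneq j k.
rewrite -[LHS]/(partials [:: j] (partials [:: k] (tensor b))).
rewrite -[RHS]/(partials [:: k] (partials [:: j] (tensor b))).
rewrite !partials_tensor1//; try exact: smooth1_subst_derivative.
congr tensor; apply/funext => i; rewrite /subst_derivative.
by case: eqVneq => [->|]; rewrite ?(negbTE jk).
Qed.

End tensor_products.

(** * The fundamental lemma of the calculus of variations *)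

Section fundamental_lemma.
Context {R : realType} {n : nat}.
Local Notation E := 'rV[R]_n.
Local Notation leb := (@lebesgue_row R n).
Implicit Types (a e : 'I_n -> R) (b : 'I_n -> R -> R).

Definition open_box a e : set E := [set x | forall i, `]a i, e i[%classic (x ord0 i)].

Lemma measurable_open_box a e : measurable (open_box a e).
Proof. by apply: (@measurable_row_box R n (fun i => `]a i, e i[%classic)) => i. Qed.

Lemma open_boxI a e a' e' : open_box a e `&` open_box a' e' =
  open_box (fun i => Num.max (a i) (a' i)) (fun i => Num.min (e i) (e' i)).
Proof.
have inB u v (x : E) : open_box u v x <-> forall i, u i < x ord0 i < v i.
  by split=> h i; have := h i; rewrite /= in_itv.
apply/seteqP; split => [x [/inB xa /inB xe]|x /inB h].
  apply/inB => i; have /andP[? ?] := xa i; have /andP[? ?] := xe i.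
  by rewrite gt_max lt_min; apply/andP; split; apply/andP.
by split; apply/inB => i; have := h i; rewrite gt_max lt_min => /andP[/andP[? ?] /andP[? ?]];
  apply/andP.
Qed.

Lemma lebesgue_open_box_lty a e : (leb (open_box a e) < +oo)%E.
Proof.
rewrite ltey_eq (@lebesgue_row_box R n (fun i => `]a i, e i[%classic))//.
apply/orP; left; apply: (big_ind (fun r : \bar R => r \is a fin_num)) => [//|x y|i _]; first exact: fin_numM.
by rewrite lebesgue_measure_itv/=; case: ifP.
Qed.

Lemma Lfun2_indic_open_box a e : \1_(open_box a e) \in Lfun leb 2%:E.
Proof.
have mB := measurable_open_box a e.
apply/Lfun2P; split; first exact: measurable_indic.
rewrite (eq_integral (fun x => (\1_(open_box a e) x)%:E)); last first.
  by move=> x _; rewrite indicE; case: (_ \in _); rewrite ?expr1n// expr0n.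
by rewrite integral_indic// setIT lebesgue_open_box_lty.
Qed.

Lemma measurable_tensor b : (forall i, smooth1 (b i)) ->
  measurable_fun setT (tensor b).
Proof.
move=> sb; rewrite /tensor; elim: (index_enum _) => [|i r IH].
  by under eq_fun do rewrite big_nil; exact: measurable_cst.
under eq_fun do rewrite big_cons.
apply: measurable_funM IH; apply: measurableT_comp; last exact: measurable_row_coord.
by apply: continuous_measurable_fun; exact: smooth1_continuous.
Qed.

Lemma tensor_cutoff_itv a e k x : 0 <= tensor (fun i => cutoff (a i) (e i) k) x <= 1.
Proof.
rewrite /tensor; apply: (big_ind (fun r : R => 0 <= r <= 1)) => [|r s|i _].
- by rewrite ler01 lexx.
- by move=> /andP[r0 r1] /andP[s0 s1]; rewrite mulr_ge0//= mulr_ile1.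
- exact: cutoff_itv.
Qed.

Lemma tensor_cutoff_out a e k x : ~ open_box a e x ->
  tensor (fun i => cutoff (a i) (e i) k) x = 0.
Proof.
move=> /existsNP[i xi]; rewrite /tensor (bigD1 i)//= cutoff_out ?mul0r//.
Qed.

Lemma cvg_tensor_cutoff a e x :
  tensor (fun i => cutoff (a i) (e i) k) x @[k --> \oo] --> (\1_(open_box a e) x : R).
Proof.
rewrite indicE; case: (boolP (x \in _)) => [|/negP]; rewrite inE => xB.
  rewrite /tensor; elim: (index_enum _) => [|i r IH].
    by under eq_fun do rewrite big_nil; exact: cvg_cst.
  under eq_fun do rewrite big_cons.
  have ci : cutoff (a i) (e i) k (x ord0 i) @[k --> \oo] --> (1 : R).
    have := @cvg_cutoff R (a i) (e i) (x ord0 i).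
    by have := xB i; rewrite /= in_itv/= => ->.
  by have := cvgM ci IH; rewrite mul1r; apply.
by under eq_fun do rewrite tensor_cutoff_out//; exact: cvg_cst.
Qed.

(** A slab [u < x_i < v] is a countable union of boxes, and slabs generate the
    Borel sets. *)
Lemma measurable_rowE : (@measurable _ E : set (set E)) =
  <<s [set A | exists a e, A = open_box a e] >>.
Proof.
rewrite eqEsubset; split; last first.
  apply: smallest_sub; first exact: sigma_algebra_measurable.
  by move=> _ [a [e ->]]; exact: measurable_open_box.
apply: smallest_sub; first exact: smallest_sigma_algebra.
move=> A; rewrite -bigcup_seq/= => -[i _].
suff sub : preimage_set_system [set: E] (fun x => x ord0 i) (@measurable _ R) `<=`
    <<s [set A | exists a e, A = open_box a e] >> by exact: sub.
have -> : (@measurable _ R : set (set R)) = (@RGenOpens.G R).-sigma.-measurable.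
  exact: RGenOpens.measurableE.
rewrite -g_sigma_preimageE; apply: smallest_sub; first exact: smallest_sigma_algebra.
move=> _ [_ [u [v ->]] <-].
pose lo k j : R := if j == i then u else - k%:R.
pose hi k j : R := if j == i then v else k%:R.
rewrite (_ : _ `&` _ = \bigcup_k open_box (lo k) (hi k)).
  apply: sigma_algebra_bigcup => k; apply: sub_sigma_algebra.
  by exists (lo k), (hi k).
rewrite setTI; apply/seteqP; split => x /=; last first.
  by move=> [k _ /(_ i)] /=; rewrite /lo /hi eqxx.
move=> xi; exists (Num.trunc (\sum_j `|x ord0 j|)).+1 => // j; rewrite /lo /hi /=.
case: eqVneq => [->//|ji]; rewrite in_itv/= -ltr_norml.
apply: le_lt_trans (truncnS_gt _).
by rewrite (bigD1 j)//= lerDl sumr_ge0.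
Qed.

Context (w : E -> R) (wL : w \in Lfun leb 2%:E)
  (w0 : forall b (M : R), (forall i, smooth1 (b i)) ->
    (forall i t, M < `|t| -> b i t = 0) -> \int[leb]_x (w x * tensor b x) = 0).

(** The indicator of a box is the dominated limit of tensor products of
    cutoffs. *)
Lemma integral_open_box0 a e : (\int[leb]_(x in open_box a e) (w x)%:E = 0)%E.
Proof.
have mB := measurable_open_box a e.
have mw := Lfun2_measurable wL.
have sb k i : smooth1 (cutoff (a i) (e i) k) by exact: smooth1_cutoff.
pose f_ k x := (w x * tensor (fun i => cutoff (a i) (e i) k) x)%:E.
have f0 k : (\int[leb]_x f_ k x = 0)%E.
  have bL : tensor (fun i => cutoff (a i) (e i) k) \in Lfun leb 2%:E.
    apply: (@Lfun2_dominated _ _ _ _ _ (fun x => (\1_(open_box a e) x ^+ 2)%:E)).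
    - exact: measurable_tensor.
    - by apply/measurable_EFinP; apply: measurable_funX; exact: measurable_indic.
    - apply: aeW => x; rewrite lee_fin indicE.
      case: (boolP (x \in _)) => [_|/negP]; last first.
        by rewrite inE => /tensor_cutoff_out ->.
      by have /andP[? ?] := tensor_cutoff_itv a e k x; rewrite expr1n exprn_ile1.
    - by move=> x; rewrite lee_fin sqr_ge0.
    - by have /Lfun2P[] := Lfun2_indic_open_box a e.
  rewrite -[LHS]fineK; last exact: integrable_fin_num (Lfun2_integrableM wL bL).
  congr EFin; apply: (@w0 _ (\sum_i (`|a i| + `|e i|))) => // i t.
  rewrite (bigD1 i)//= => tM; apply: cutoff_out => /andP[at_ te].
  have s0 : 0 <= \sum_(j | j != i) (`|a j| + `|e j|).
    by apply: sumr_ge0 => j _; rewrite addr_ge0.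
  have : `|t| <= `|a i| + `|e i|.
    rewrite ler_norml; have := ler_norm (e i); have := ler_norm (- a i); rewrite normrN.
    by have := normr_ge0 (a i); have := normr_ge0 (e i); lra.
  by lra.
have := @dominated_convergence _ _ _ leb setT measurableT f_
  (fun x => (w x * \1_(open_box a e) x)%:E) (fun x => (`|w x * \1_(open_box a e) x|)%:E).
case.
- move=> k; apply/measurable_EFinP; apply: measurable_funM => //.
  exact: measurable_tensor.
- by apply/measurable_EFinP; apply: measurable_funM => //; exact: measurable_indic.
- apply: aeW => x _; apply: cvg_EFin; first exact: nearW.
  by apply: cvgMl_tmp; exact: cvg_tensor_cutoff.
- exact: (integrable_norm (Lfun2_integrableM wL (Lfun2_indic_open_box a e))).
- apply: aeW => x k _; rewrite lee_fin !normrM ler_wpM2l// indicE.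
  case: (boolP (x \in _)) => [_|/negP]; last first.
    by rewrite inE => /tensor_cutoff_out ->.
  by have /andP[? ?] := tensor_cutoff_itv a e k x; rewrite normr1 ger0_norm.
move=> _ _ /=; under eq_fun do rewrite f0.
move=> /(cvg_unique _ (cvg_cst _)) ->//.
rewrite integral_mkcond; apply: eq_integral => x _; rewrite patchE indicE.
by case: ifP; rewrite ?mulr1 ?mulr0.
Qed.

(** Boxes generate the Borel sets and are stable under intersection, so by the
    Dynkin argument [w] integrates to zero on every bounded Borel set. *)
Lemma ae_eq0_of_tensor : w = cst 0 %[ae leb].
Proof.
pose Q (k : nat) := open_box (fun=> - k%:R) (fun=> k%:R).
have mQ k : measurable (Q k) by exact: measurable_open_box.
have mw := Lfun2_measurable wL.
have wi k : leb.-integrable (Q k) (EFin \o w).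
  apply/(integrable_mkcond _ (mQ k)).
  apply: eq_integrable (Lfun2_integrableM wL (Lfun2_indic_open_box (fun=> - k%:R) (fun=> k%:R))) => //.
  by move=> x _; rewrite /= patchE indicE; case: ifP => _ /=; rewrite ?mulr1 ?mulr0.
(* Borel sets are cut by a large cube [Q k] because [w] need not be integrable
   on the whole space. *)
have wQ k A : measurable A -> (\int[leb]_(x in A `&` Q k) (w x)%:E = 0)%E.
  rewrite measurable_rowE; move: A.
  apply: (dynkin_induction (P := fun A => (\int[leb]_(x in A `&` Q k) (w x)%:E = 0)%E)).
  - exact: measurable_rowE.
  - move=> _ _ [a [e ->]] [a' [e' ->]]; rewrite open_boxI; eexists; eexists; reflexivity.
  - by rewrite setTI integral_open_box0.
  - by move=> _ [a [e ->]]; rewrite open_boxI integral_open_box0.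
  - move=> A mA A0.
    have := integral_open_box0 (fun=> - k%:R) (fun=> k%:R).
    rewrite -/(Q k) -[X in integral _ X _](setIT (Q k)) -(setUv A) setIUr.
    rewrite integral_setU_EFin//.
    + by rewrite setIC A0 add0e setIC.
    + exact: measurableI.
    + by apply: measurableI => //; exact: measurableC.
    + exact: measurable_funTS.
    + by apply/disj_setPS => x [[_ Ax] [_ nAx]].
  - move=> F mF tF F0; rewrite setI_bigcupl integral_bigcup.
    + by rewrite eseries0.
    + by apply/trivIsetP => i j _ _ ij; rewrite setIACA; move/trivIsetP : tF => ->//; rewrite set0I.
    + by move=> i; exact: measurableI.
    + apply: integrableS (wi k) => //; first by apply: bigcup_measurable => i _; exact: measurableI.
      by move=> x [i _ []].
have wQ0 k : ae_eq leb (Q k) (EFin \o w) (cst 0%E).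
  apply: integral_ae_eq => // A AQ mA.
  by rewrite integral0 -(wQ k A)// setIidl.
have /ae_foralln : forall k, \forall x \ae leb, Q k x -> (EFin \o w) x = 0%E := wQ0.
apply: filterS => x wx _.
have : Q (Num.trunc (\sum_j `|x ord0 j|)).+1 x.
  move=> j; rewrite /= in_itv/= -ltr_norml; apply: le_lt_trans (truncnS_gt _).
  by rewrite (bigD1 j)//= lerDl sumr_ge0.
by move=> /wx [].
Qed.

End fundamental_lemma.

(** * Test functions *)

Section continuous_measurable.
Context {R : realType} {n : nat}.
Local Notation E := 'rV[R]_n.

(** Integer coordinates of the point below [x] on the grid of mesh [1/(k+1)].
    *)
Definition grid k (x : E) : 'rV[int]_n := \row_i Num.floor (k.+1%:R * x ord0 i).

Definition of_grid k (z : 'rV[int]_n) : E := \row_i ((z ord0 i)%:~R / k.+1%:R).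

Lemma measurable_grid_fiber k (z : 'rV[int]_n) : measurable [set x | grid k x = z].
Proof.
rewrite (_ : [set x | _] = [set x : E | forall i,
    `[(z ord0 i)%:~R / k.+1%:R, (z ord0 i + 1)%:~R / k.+1%:R[%classic (x ord0 i)]).
  exact: (@measurable_row_box R n (fun i =>
    `[(z ord0 i)%:~R / k.+1%:R, (z ord0 i + 1)%:~R / k.+1%:R[%classic)).
apply/seteqP; split => x /= h.
  move=> i; rewrite -h mxE /= in_itv/= ler_pdivrMr ?ltr0n// ltr_pdivlMr ?ltr0n//.
  by rewrite mulrC ge_floor floorD1_gt.
apply/rowP => i; rewrite mxE; apply/eqP; rewrite floor_eq.
by have := h i; rewrite /= in_itv/= ler_pdivrMr ?ltr0n// ltr_pdivlMr ?ltr0n// mulrC.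
Qed.

Lemma cvg_grid (x : E) : of_grid k (grid k x) @[k --> \oo] --> x.
Proof.
apply/cvg_ballP => e e0; near=> k; split=> // i j; rewrite (ord1 i) !mxE.
rewrite /ball/= ltr_norml.
have k0 : 0 < k.+1%:R :> R by rewrite ltr0n.
have ke : k.+1%:R^-1 < e.
  by near: k; exact: near_infty_natSinv_lt (PosNum e0).
have h1 : (Num.floor (k.+1%:R * x ord0 j))%:~R / k.+1%:R <= x ord0 j.
  by rewrite ler_pdivrMr// mulrC ge_floor.
have h2 : x ord0 j < (Num.floor (k.+1%:R * x ord0 j))%:~R / k.+1%:R + k.+1%:R^-1.
  rewrite -[X in _ + X]mul1r -mulrDl ltr_pdivlMr// mulrC.
  by have := floorD1_gt (k.+1%:R * x ord0 j); rewrite intrD.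
have aux (q r y : R) : q <= y -> y < q + r -> r < e -> - e < y - q < e.
  by move=> *; apply/andP; split; lra.
exact: aux h1 h2 ke.
Unshelve. all: by end_near. Qed.

(** Measurability refers to the product sigma-algebra and continuity to the
    topology. A continuous function is the limit of its values at grid points,
    and these approximations take countably many values, each on a union of
    measurable boxes. *)
Lemma continuous_row_measurable (f : E -> R) : continuous f -> measurable_fun setT f.
Proof.
move=> cf; apply: (@measurable_fun_cvg _ _ _ _ (fun k x => f (of_grid k (grid k x)))).
  move=> k _ Y mY; rewrite setTI.
  pose B m := if unpickle m is Some z then
    [set x | grid k x = z /\ Y (f (of_grid k z))] else set0.
  rewrite (_ : _ @^-1` Y = \bigcup_m B m).
    apply: bigcupT_measurable => m; rewrite /B; case: unpickle => [z|//].
    case: (pselect (Y (f (of_grid k z)))) => yz.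
      rewrite (_ : [set x | _] = [set x | grid k x = z]); first exact: measurable_grid_fiber.
      by apply/seteqP; split => x /= => [[]|].
    by rewrite (_ : [set x | _] = set0)//; apply/seteqP; split => x /= => [[]|].
  apply/seteqP; split => x /=.
    by move=> Yx; exists (pickle (grid k x)) => //; rewrite /B pickleK.
  by move=> [m _]; rewrite /B; case: unpickle => [z|//] /= [->].
move=> x _; exact: (cvg_comp (fun k => of_grid k (grid k x)) f (@cvg_grid x) (cf x)).
Qed.

End continuous_measurable.

Section test_functions.
Context {R : realType} {n : nat}.
Local Notation E := 'rV[R]_n.
Local Notation leb := (@lebesgue_row R n).
Implicit Types (phi : E -> R) (s : seq 'I_n) (j : 'I_n).

Definition vanishes_outside (M : R) phi := forall (x : E) i, M < `|x ord0 i| -> phi x = 0.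

Lemma compact_cube (M : R) : compact [set x : E | forall i, `[- M, M]%classic (x ord0 i)].
Proof. by apply: (@rV_compact R n (fun=> `[- M, M]%classic)) => i; exact: segment_compact. Qed.

Lemma cubeP (M : R) (x : E) :
  (forall i, `[- M, M]%classic (x ord0 i)) <-> forall i, `|x ord0 i| <= M.
Proof. by split=> h i; have := h i; rewrite /= in_itv/= -ler_norml. Qed.

(** Vanishing outside a cube is easier than a compact support to propagate to
    derivatives and translates. *)
Lemma test_functionP phi :
  test_function phi <-> smooth phi /\ exists M, vanishes_outside M phi.
Proof.
split=> [[sphi [K [cK Kphi]]]|[sphi [M Mphi]]]; split => //; last first.
  exists [set x : E | forall i, `[- M, M]%classic (x ord0 i)].
  split; first exact: compact_cube.
  move=> x /= /cubeP/existsNP[i /negP]; rewrite -ltNge; exact: Mphi.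
have [M [_ KM]] := compact_bounded cK.
exists (M + 1) => x i Mx; apply: Kphi => Kx.
have := KM (M + 1); rewrite ltrDl ltr01 => /(_ isT x Kx) /=; apply/negP; rewrite -ltNge.
apply: (lt_le_trans Mx); suff : `|x ord0 i| <= mx_norm x by [].
by rewrite mx_normrE; exact: (le_trans _ (le_bigmax _ _ (ord0, i))).
Qed.

Lemma partials_cat s s' phi : partials s (partials s' phi) = partials (s ++ s') phi.
Proof. by rewrite /partials foldr_cat. Qed.

(** The complement of a closed cube is open and derivatives are local. *)
Lemma vanishes_outside_partials M s phi :
  vanishes_outside M phi -> vanishes_outside M (partials s phi).
Proof.
move=> phi0; elim: s => [//|j s IH] x i xi /=.
rewrite (@near_eq_derive _ _ _ _ (cst 0)) ?derive_cst//.
have cx : {for x, continuous (fun y : E => `|y ord0 i|)}.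
  apply: (@continuous_comp _ _ _ (fun y : E => y ord0 i) (fun t : R => `|t|) x).
    exact: coord_continuous.
  exact: norm_continuous.
have : \forall y \near x, M < `|(y : E) ord0 i| := cx _ (lt_nbhsr xi).
by apply: filterS => y /(IH y i).
Qed.

Lemma test_function_partials s phi : test_function phi -> test_function (partials s phi).
Proof.
move=> /test_functionP[sphi [M Mphi]]; apply/test_functionP; split.
  by move=> s'; rewrite partials_cat; exact: sphi.
by exists M; exact: vanishes_outside_partials.
Qed.

Lemma continuous_shift_row j t : continuous (@shift_row R n j t).
Proof.
move=> x; exact: (@continuousD R E E id (cst (t *: delta_mx ord0 j)) x
  (@cvg_id _ (nbhs x)) (@cst_continuous _ _ _ _)).
Qed.

Lemma growth_rate_shift phi j t (x v : E) :
  (fun h : R => h^-1 *: (((phi \o shift_row j t) \o shift x) (h *: v) -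
    (phi \o shift_row j t) x)) =
  (fun h : R => h^-1 *: ((phi \o shift (shift_row j t x)) (h *: v) - phi (shift_row j t x))).
Proof. by apply/funext => h /=; rewrite /shift_row addrA. Qed.

Lemma partials_shift s phi j t :
  partials s (phi \o shift_row j t) = partials s phi \o shift_row j t.
Proof.
elim: s => [//|k s IH] /=; apply/funext => x /=.
by rewrite -/(partials s (phi \o shift_row j t)) IH /derive growth_rate_shift.
Qed.

Lemma test_function_shift phi j t : test_function phi -> test_function (phi \o shift_row j t).
Proof.
move=> /test_functionP[sphi [M Mphi]]; apply/test_functionP; split.
  move=> s; rewrite partials_shift; have [c d] := sphi s; split.
    move=> x; apply: (@continuous_comp _ _ _ (shift_row j t) (partials s phi) x); last exact: c.
    exact: continuous_shift_row.
  by move=> k x; have := d k (shift_row j t x); rewrite /derivable growth_rate_shift.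
exists (M + `|t|) => x i xi; apply: (Mphi _ i); rewrite shift_rowE.
have : `|t * (i == j)%:R| <= `|t|.
  by case: eqP => _; rewrite ?mulr1// mulr0 normr0.
have := ler_normD (x ord0 i + t * (i == j)%:R) (- (t * (i == j)%:R)).
by rewrite addrK normrN; move: xi; lra.
Qed.

Lemma test_function_continuous phi : test_function phi -> continuous phi.
Proof. by move=> [/(_ [::])[]]. Qed.

Lemma test_function_measurable phi : test_function phi -> measurable_fun setT phi.
Proof. by move=> /test_function_continuous; exact: continuous_row_measurable. Qed.

Lemma test_function_bounded phi : test_function phi -> exists2 B, 0 <= B & forall x, `|phi x| <= B.
Proof.
move=> tphi; have /test_functionP[_ [M Mphi]] := tphi.
have cphi : compact (phi @` [set x : E | forall i, `[- M, M]%classic (x ord0 i)]).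
  apply: continuous_compact; last exact: compact_cube.
  by apply: continuous_subspaceT; exact: test_function_continuous.
have [B [_ KB]] := compact_bounded cphi.
exists (`|B| + 1) => [|x]; first by rewrite addr_ge0.
have [/cubeP xM|] := pselect (forall i, `|x ord0 i| <= M).
  apply: (KB (`|B| + 1)); first by rewrite (le_lt_trans (ler_norm B))// ltrDl.
  by exists x.
move=> /existsNP[i /negP]; rewrite -ltNge => /Mphi ->; rewrite normr0 addr_ge0//.
Qed.

Lemma test_function_Lfun2 phi : test_function phi -> phi \in Lfun leb 2%:E.
Proof.
move=> tphi; have [B B0 Bphi] := test_function_bounded tphi.
have /test_functionP[_ [M Mphi]] := tphi.
pose Q : set E := open_box (fun=> - (M + 1)) (fun=> M + 1).
have /Lfun2P[m1 i1] := Lfun2Z B (Lfun2_indic_open_box (fun=> - (M + 1)) (fun=> M + 1) : \1_Q \in _).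
apply: (@Lfun2_dominated _ _ _ _ _ (fun x => ((B * \1_Q x) ^+ 2)%:E)) => //.
- exact: test_function_measurable.
- by apply/measurable_EFinP; exact: measurable_funX.
- apply: aeW => x; rewrite lee_fin indicE; case: (boolP (x \in _)) => [_|/negP].
    rewrite mulr1 -(real_normK (num_real (phi x))).
    by have := Bphi x; have := normr_ge0 (phi x); nra.
  rewrite inE => /existsNP[k]; rewrite /= in_itv/= -ltr_norml => /negP; rewrite -leNgt => h.
  by rewrite (Mphi x k) ?expr0n ?sqr_ge0// (lt_le_trans _ h)// ltrDl.
- by move=> x; rewrite lee_fin sqr_ge0.
Qed.

End test_functions.

(** * Means over coordinate segments *)

Section segment_means.
Context {R : realType} {n : nat}.
Local Notation E := 'rV[R]_n.
Local Notation leb := (@lebesgue_row R n).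
Local Notation l1 := (@lebesgue_measure R).
Implicit Types (f g p q phi : E -> R) (j : 'I_n) (c h : R).

Local Notation unif := (uniform_prob (@ltr01 R)).

Lemma integral_unif (F : R -> \bar R) : measurable_fun setT F ->
  (\int[unif]_u F u = \int[l1]_(u in `[0%R, 1%R]) F u)%E.
Proof.
move=> mF; rewrite integralE [RHS]integralE.
rewrite integral_uniform//; last exact: measurable_funepos.
rewrite integral_uniform//; last exact: measurable_funeneg.
by rewrite subr0 invr1 !mul1e.
Qed.

Lemma integral_cst_unif (r : \bar R) : (\int[unif]_u r = r)%E.
Proof.
by rewrite integral_cst// [X in (_ * X)%E](_ : _ = 1%E) ?mule1//; exact: probability_setT.
Qed.

Lemma Rintegral_cst_unif c : \int[unif]_u c = c.
Proof. by rewrite Rintegral_cst//= probability_setT mulr1. Qed.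

Lemma integral_line_mean_unif j c (F : E -> \bar R) :
  measurable_fun setT F -> (forall x, 0 <= F x)%E ->
  (\int[leb]_x line_mean unif c j F x = \int[leb]_x F x)%E.
Proof.
move=> mF F0; rewrite integral_line_mean//.
by rewrite [X in (X * _)%E](_ : _ = 1%E) ?mul1e//; exact: probability_setT.
Qed.

Lemma Lfun2_unif_integrable (X : R -> R) : X \in Lfun unif 2%:E ->
  unif.-integrable setT (EFin \o X).
Proof.
move=> XL; have := Lfun2_integrableM XL (Lfun_cst _ 1 2).
by apply: eq_integrable => // u _ /=; rewrite mulr1.
Qed.

(** Jensen's inequality for the square: a variance is nonnegative. *)
Lemma sqr_Rintegral_unif (X : R -> R) : X \in Lfun unif 2%:E ->
  (\int[unif]_u X u) ^+ 2 <= \int[unif]_u (X u ^+ 2).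
Proof.
move=> XL; set m := \int[unif]_u X u.
have X1 := Lfun2_unif_integrable XL.
have X2 := Lfun2_integrable_sqr XL.
have : 0 <= \int[unif]_u ((X u - m) ^+ 2) by apply: Rintegral_ge0 => u _; exact: sqr_ge0.
have -> : \int[unif]_u ((X u - m) ^+ 2) =
    \int[unif]_u (X u ^+ 2 - (X u * (2 * m) - m ^+ 2)).
  by apply: eq_Rintegral => u _; ring.
have X1' : unif.-integrable setT (fun u => (X u * (2 * m))%:E).
  exact: (Lfun2_integrableM XL (Lfun_cst _ _ 2)).
have c1 : unif.-integrable setT (fun u : measurableTypeR R => (m ^+ 2)%:E).
  exact/Lfun1_integrable/Lfun_cst.
rewrite RintegralB//; last exact: (integrableB measurableT X1' c1).
by rewrite RintegralB// RintegralZr// Rintegral_cst_unif -/m; lra.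
Qed.

(** When [q] is the derivative of a function along the axis [j], [c] times
    this mean is the increment of that function over a step [c]. *)
Definition segment_mean j c q (x : E) : R := \int[unif]_u q (shift_row j (c * u) x).

Lemma measurable_segment_mean j c q : measurable_fun setT q ->
  measurable_fun setT (segment_mean j c q).
Proof.
move=> mq; rewrite /segment_mean /Rintegral.
apply: (measurableT_comp (fine_measurable _)) => //.
have mq' : measurable_fun setT (EFin \o q) by exact/measurable_EFinP.
rewrite (_ : (fun x => _) = fun x => (line_mean unif c j (EFin \o q)^\+ x -
    line_mean unif c j (EFin \o q)^\- x)%E).
  apply: emeasurable_funB; apply: measurable_line_mean => //.
    exact: measurable_funepos.
  exact: measurable_funeneg.
apply/funext => x; rewrite integralE /line_mean; congr (_ - _)%E.
  by apply: eq_integral => u _; rewrite !funeposE.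
by apply: eq_integral => u _; rewrite !funenegE.
Qed.

(** By Tonelli the mean of [q ^+ 2] over segments has a finite integral, hence
    is finite almost everywhere. *)
Lemma ae_segment_Lfun2 j c q : q \in Lfun leb 2%:E ->
  {ae leb, forall x, (fun u => q (shift_row j (c * u) x)) \in Lfun unif 2%:E}.
Proof.
move=> qL; have /Lfun2P[mq qi] := qL.
have mq2 : measurable_fun setT (fun x => ((q x) ^+ 2)%:E).
  by apply/measurable_EFinP; exact: measurable_funX.
have q20 x : (0 <= ((q x) ^+ 2)%:E)%E by rewrite lee_fin sqr_ge0.
have : leb.-integrable setT (line_mean unif c j (fun x => ((q x) ^+ 2)%:E)).
  apply/integrableP; split; first exact: measurable_line_mean.
  under eq_integral do rewrite gee0_abs ?line_mean_ge0//.
  by rewrite integral_line_mean_unif.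
move=> /integrable_ae => /(_ measurableT); apply: filterS => x /(_ I) fx.
apply/Lfun2P; split; first exact: measurable_shift_line.
by rewrite ltey_eq fx.
Qed.

Lemma sqr_segment_mean j c q : q \in Lfun leb 2%:E ->
  {ae leb, forall x,
    ((segment_mean j c q x ^+ 2)%:E <= line_mean unif c j (fun x => ((q x) ^+ 2)%:E) x)%E}.
Proof.
move=> /(@ae_segment_Lfun2 j c); apply: filterS => x qx.
by rewrite /line_mean Lfun2_integral_sqr// lee_fin sqr_Rintegral_unif.
Qed.

Lemma Lfun2_segment_mean j c q : q \in Lfun leb 2%:E ->
  segment_mean j c q \in Lfun leb 2%:E.
Proof.
move=> qL; have /Lfun2P[mq qi] := qL.
have mq2 : measurable_fun setT (fun x => ((q x) ^+ 2)%:E).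
  by apply/measurable_EFinP; exact: measurable_funX.
have q20 x : (0 <= ((q x) ^+ 2)%:E)%E by rewrite lee_fin sqr_ge0.
apply: (Lfun2_dominated _ _ (sqr_segment_mean j c qL)).
- exact: measurable_segment_mean.
- exact: measurable_line_mean.
- by move=> x; exact: line_mean_ge0.
- by rewrite integral_line_mean_unif.
Qed.

Lemma measurable_comp_shift d (T : measurableType d) (f : E -> T) j c :
  measurable_fun setT f -> measurable_fun setT (f \o shift_row j c).
Proof. by move=> mf; exact: measurableT_comp mf (measurable_shift_row j c). Qed.

Lemma Lfun2_shift j c q : q \in Lfun leb 2%:E -> q \o shift_row j c \in Lfun leb 2%:E.
Proof.
move=> /Lfun2P[mq qi]; apply/Lfun2P; split; first exact: measurable_comp_shift.
rewrite (@integral_shift_row _ _ _ _ (fun x => ((q x) ^+ 2)%:E))//.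
by apply/measurable_EFinP; exact: measurable_funX.
Qed.

Lemma Rintegral_shift j c q : measurable_fun setT q ->
  \int[leb]_x q (shift_row j c x) = \int[leb]_x q x.
Proof.
move=> mq; rewrite /Rintegral (@integral_shift_row _ _ _ _ (EFin \o q))//.
exact/measurable_EFinP.
Qed.

(** Fubini, the integrand being dominated by the sum of the squares of its
    factors. *)
Lemma Rintegral_segment_mean j c p q : p \in Lfun leb 2%:E -> q \in Lfun leb 2%:E ->
  \int[leb]_x (p x * segment_mean j c q x) =
  \int[unif]_u \int[leb]_x (p x * q (shift_row j (c * u) x)).
Proof.
move=> pL qL.
have [/Lfun2P[mp pi] /Lfun2P[mq qi]] := (pL, qL).
pose F (z : E * measurableTypeR R) := (p z.1 * q (shift_row j (c * z.2) z.1))%:E.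
have mF : measurable_fun setT F.
  apply/measurable_EFinP; apply: measurable_funM.
    exact: measurableT_comp mp measurable_fst.
  exact: (measurable_fun_shift_row2 c j mq).
have iF : (leb \x unif)%E.-integrable setT F.
  have ip : (leb \x unif)%E.-integrable setT
      (fun z : E * measurableTypeR R => ((p z.1) ^+ 2)%:E).
    have m1 : measurable_fun setT (fun z : E * measurableTypeR R => ((p z.1) ^+ 2)%:E).
      apply/measurable_EFinP; apply: measurable_funX.
      exact: measurableT_comp mp measurable_fst.
    apply/integrable12ltyP => //=.
    apply: le_lt_trans pi; rewrite le_eqVlt; apply/orP; left; apply/eqP.
    by apply: eq_integral => x _; rewrite integral_cst_unif ger0_norm ?sqr_ge0.
  have iq : (leb \x unif)%E.-integrable setT
      (fun z : E * measurableTypeR R => ((q (shift_row j (c * z.2) z.1)) ^+ 2)%:E).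
    have mq2 : measurable_fun setT (fun x => ((q x) ^+ 2)%:E).
      by apply/measurable_EFinP; exact: measurable_funX.
    apply/integrable12ltyP => /=.
      exact: (measurable_fun_shift_row2 c j mq2).
    apply: le_lt_trans qi.
    rewrite -(@integral_line_mean_unif j c _ mq2); last by move=> x; rewrite lee_fin sqr_ge0.
    rewrite le_eqVlt; apply/orP; left; apply/eqP.
    apply: eq_integral => x _; apply: eq_integral => u _.
    by rewrite /= ger0_norm ?sqr_ge0.
  apply: le_integrable (integrableD measurableT ip iq) => //= z _.
  rewrite lee_fin (ger0_norm (addr_ge0 (sqr_ge0 _) (sqr_ge0 _))) normrM.
  rewrite -(real_normK (num_real (p z.1))).
  rewrite -(real_normK (num_real (q (shift_row j (c * z.2) z.1)))).
  by move: (normr_ge0 (p z.1)) (normr_ge0 (q (shift_row j (c * z.2) z.1))); nra.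
have qu u : (q \o shift_row j (c * u)) \in Lfun leb 2%:E by exact: Lfun2_shift.
transitivity (fine (\int[unif]_u \int[leb]_x F (x, u))%E); last first.
  congr fine; apply: eq_integral => u _.
  by rewrite /Rintegral fineK//; exact: integrable_fin_num (Lfun2_integrableM pL (qu u)).
rewrite -(Fubini iF); congr fine; apply: ae_eq_integral => //.
- apply/measurable_EFinP; apply: measurable_funM => //; exact: measurable_segment_mean.
- exact: measurable_fubini_F iF.
apply: filterS (ae_segment_Lfun2 j c qL) => x qx _.
rewrite /F/= /segment_mean EFinM; under [RHS]eq_integral do rewrite EFinM.
have iqx := Lfun2_unif_integrable qx.
rewrite integralZl//; congr (_ * _)%E.
by rewrite /Rintegral fineK//; exact: integrable_fin_num iqx.
Qed.

(** The fundamental theorem of calculus on a segment. *)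
Lemma segment_mean_test_function j h phi : test_function phi -> forall x,
  phi (shift_row j h x) - phi x = h * segment_mean j h (partials [:: j] phi) x.
Proof.
move=> tphi x.
have dphi s : derivable (fun t => phi (shift_row j t x)) s 1 /\
    (fun t => phi (shift_row j t x))^`()%classic s = partials [:: j] phi (shift_row j s x).
  have E k : phi (k *: delta_mx ord0 j + shift_row j s x) = phi (shift_row j (k + s) x).
    by rewrite /shift_row scalerDl addrC addrAC addrA.
  have [_ dd] := tphi.1 [::]; split; last by rewrite /= (derive_line (g := fun t => phi (shift_row j t x)) E).
  have := dd j (shift_row j s x).
  by rewrite /derivable (growth_rate_line (g := fun t => phi (shift_row j t x)) E).
pose F u := phi (shift_row j (h * u) x).
have dF (u : R) : is_derive u 1 F (partials [:: j] phi (shift_row j (h * u) x) * h).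
  have -> : F = (fun t => phi (shift_row j t x)) \o (fun u => h * u + 0).
    by apply/funext => v; rewrite /F /= addr0.
  apply: is_derive1_comp; last exact: is_derive_affine.
  rewrite addr0; have [d1 d2] := dphi (h * u).
  by apply: DeriveDef => //; rewrite -derive1E.
have cF : continuous F.
  by move=> u; apply/differentiable_continuous/derivable1_diffP; have [] := dF u.
have tD := test_function_partials [:: j] tphi.
have cD : continuous (fun u : R => partials [:: j] phi (shift_row j (h * u) x) * h).
  move=> u; apply: cvgMr_tmp.
  apply: (@continuous_comp _ _ _ (fun u : R => shift_row j (h * u) x) (partials [:: j] phi)); last first.
    exact: test_function_continuous.
  apply: cvgD; first exact: cvg_cst.
  by apply: cvgZr_tmp; apply: cvgMl_tmp; exact: cvg_id.
have dF01 : derivable_oo_LRcontinuous F 0 1.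
  split; first by move=> u _; have [] := dF u.
  + exact/cvg_at_right_filter/cF.
  + exact/cvg_at_left_filter/cF.
have F'E : {in `]0, 1[, F^`()%classic =1
    (fun u => partials [:: j] phi (shift_row j (h * u) x) * h)}.
  by move=> u _; have [_] := dF u; rewrite -derive1E.
have := @continuous_FTC2 R _ F 0 1 ltr01 (continuous_subspaceT cD) dF01 F'E.
have F1 : F 1 = phi (shift_row j h x) by rewrite /F mulr1.
have F0 : F 0 = phi x by rewrite /F mulr0 /shift_row scale0r addr0.
rewrite -integral_unif; last first.
  by apply/measurable_EFinP; exact: continuous_measurable_fun.
rewrite F1 F0 -EFinB => /(congr1 fine) /= <-.
rewrite mulrC /segment_mean -RintegralZr//; apply: Lfun2_unif_integrable.
have [B B0 DB] := test_function_bounded tD.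
have DB2 y : partials [:: j] phi y ^+ 2 <= B ^+ 2.
  rewrite -(real_normK (num_real (partials [:: j] phi y))).
  by have := DB y; move: (normr_ge0 (partials [:: j] phi y)); nra.
have mD : measurable_fun setT (partials [:: j] phi) by exact: test_function_measurable.
apply: (@Lfun2_dominated _ _ _ _ _ (fun=> (B ^+ 2)%:E)) => //.
- exact: (measurable_shift_line h j x mD).
- by apply: aeW => u; rewrite lee_fin; exact: DB2.
- by move=> u; rewrite lee_fin sqr_ge0.
- by rewrite integral_cst_unif ltry.
Qed.

End segment_means.

(** * Increments of weakly differentiable functions *)

Section increments.
Context {R : realType} {n : nat}.
Local Notation E := 'rV[R]_n.
Local Notation leb := (@lebesgue_row R n).
Local Notation L2 := (Lfun leb 2%:E).
Implicit Types (f g k p q phi : E -> R) (j : 'I_n) (c h t : R).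

Lemma shift_rowK j t (x : E) : shift_row j t (shift_row j (- t) x) = x.
Proof. by rewrite /shift_row scaleNr subrK. Qed.

Lemma Rintegral_shiftM j t p q : measurable_fun setT p -> measurable_fun setT q ->
  \int[leb]_x (p (shift_row j t x) * q x) = \int[leb]_x (p x * q (shift_row j (- t) x)).
Proof.
move=> mp mq.
rewrite -(@Rintegral_shift _ _ j (- t) (fun x => p (shift_row j t x) * q x)); last first.
  by apply: measurable_funM => //; exact: (measurable_comp_shift j t mp).
by apply: eq_Rintegral => x _; rewrite shift_rowK.
Qed.

(** The integrated form of the statement that [g] is the derivative of [f]
    along the axis [j]. Unlike the weak form it is pointwise, so it can be
    squared, averaged and iterated. *)
Definition increments j f g := forall h,
  {ae leb, forall x, f (shift_row j h x) - f x = h * segment_mean j h g x}.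

Lemma increments_test_function j phi : test_function phi ->
  increments j phi (partials [:: j] phi).
Proof. by move=> tphi h; apply: aeW => x; exact: segment_mean_test_function. Qed.

Lemma weak_derivative_shift j f g phi t : weak_derivative [:: j] f g -> test_function phi ->
  \int[leb]_x (f x * partials [:: j] phi (shift_row j t x)) =
  - \int[leb]_x (g x * phi (shift_row j t x)).
Proof.
move=> [_ fg] tphi; have := fg _ (test_function_shift j t tphi).
by rewrite partials_shift expr1 mulN1r.
Qed.

(** Both sides agree when tested against a tensor product: the translations
    are moved onto the test function, where the identity is the fundamental
    theorem of calculus, and the weak derivative is taken for each translate
    of the test function. *)
Lemma increments_weak_derivative j f g : f \in L2 -> weak_derivative [:: j] f g ->
  increments j f g.
Proof.
move=> fL fg h; have gL := fg.1.
have fhL := Lfun2_shift j h fL.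
have sL := Lfun2_segment_mean j h gL.
have mf := Lfun2_measurable fL; have mg := Lfun2_measurable gL.
suff : (fun x => (f (shift_row j h x) - f x) - h * segment_mean j h g x) = cst 0 %[ae leb].
  by apply: filterS => x /(_ I) /subr0_eq.
apply: ae_eq0_of_tensor.
  by apply: Lfun2B; [exact: (Lfun2B fhL fL)|exact: Lfun2Z].
move=> b M sb Mb; have tphi := test_function_tensor sb Mb.
move: (tensor b) tphi => phi tphi {sb Mb}.
have pL := test_function_Lfun2 tphi; have mp := Lfun2_measurable pL.
have dL := test_function_Lfun2 (test_function_partials [:: j] tphi).
have phL := Lfun2_shift j (- h) pL.
(* The increment of [f] is moved onto the test function. *)
have E1 : \int[leb]_x ((f (shift_row j h x) - f x) * phi x) =
    - h * \int[leb]_x (f x * segment_mean j (- h) (partials [:: j] phi) x).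
  transitivity (\int[leb]_x (f (shift_row j h x) * phi x - f x * phi x)).
    by apply: eq_Rintegral => x _; rewrite mulrBl.
  rewrite RintegralB//; [|exact: Lfun2_integrableM fhL pL|exact: Lfun2_integrableM].
  rewrite Rintegral_shiftM// -RintegralB//; [|exact: Lfun2_integrableM fL phL|exact: Lfun2_integrableM].
  rewrite -RintegralZl//; last exact: (Lfun2_integrableM fL (Lfun2_segment_mean _ _ dL)).
  apply: eq_Rintegral => x _.
  by rewrite -mulrBr (segment_mean_test_function _ _ tphi) mulrCA.
(* The derivative is moved back onto [f], under the mean. *)
have E2 : \int[leb]_x (f x * segment_mean j (- h) (partials [:: j] phi) x) =
    - \int[leb]_x (phi x * segment_mean j h g x).
  transitivity (\int[leb]_x ((-1 * phi x) * segment_mean j h g x)); last first.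
    rewrite -[RHS]mulN1r -RintegralZl//; last exact: Lfun2_integrableM.
    by apply: eq_Rintegral => x _; rewrite mulrA.
  rewrite (Rintegral_segment_mean _ _ fL dL) (Rintegral_segment_mean _ _ (Lfun2Z (-1) pL) gL).
  apply: eq_Rintegral => u _; rewrite (weak_derivative_shift _ fg tphi).
  rewrite mulNr -Rintegral_shiftM// -[LHS]mulN1r -RintegralZl//; last first.
    exact: (Lfun2_integrableM (Lfun2_shift _ _ gL) pL).
  by apply: eq_Rintegral => x _; rewrite -mulrA; congr (_ * _); rewrite mulrC.
transitivity (\int[leb]_x ((f (shift_row j h x) - f x) * phi x - h * (phi x * segment_mean j h g x))).
  by apply: eq_Rintegral => x _; ring.
rewrite RintegralB//; [|exact: (Lfun2_integrableM (Lfun2B fhL fL) pL)|]; last first.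
  by under eq_fun do rewrite mulrA; exact: (Lfun2_integrableM (Lfun2Z _ pL) sL).
rewrite RintegralZl//; last exact: Lfun2_integrableM.
by rewrite E1 E2; ring.
Qed.

End increments.

(** * First-order expansions in L^2 and integration by parts *)

Section taylor.
Context {R : realType} {n : nat}.
Local Notation E := 'rV[R]_n.
Local Notation leb := (@lebesgue_row R n).
Local Notation L2 := (Lfun leb 2%:E).
Local Notation unif := (uniform_prob (@ltr01 R)).
Implicit Types (f g k p q phi : E -> R) (j : 'I_n) (c h t : R).

Lemma le_integral_unif (F : R -> \bar R) (K : R) : measurable_fun setT F ->
  (forall u, 0 <= F u)%E -> (forall u, 0 <= u <= 1 -> (F u <= K%:E)%E) ->
  (\int[unif]_u F u <= K%:E)%E.
Proof.
move=> mF F0 FK; rewrite integral_unif//.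
have K0 : (0 <= K)%R.
  by rewrite -lee_fin; apply: le_trans (F0 0) (FK 0 _); rewrite lexx ler01.
apply: (@le_trans _ _ (\int[lebesgue_measure]_(u in `[0%R, 1%R]) K%:E)%E).
  apply: ge0_le_integral => //.
  - exact: measurable_funTS.
have l01 : lebesgue_measure (`[0%R, 1%R]%classic : set R) = 1%E.
  by rewrite lebesgue_measure_itv/= lte_fin ltr01 -EFinB subr0.
by rewrite integral_cst// [X in (_ * X)%E](_ : _ = 1%E) ?mule1.
Qed.

Definition increment_sqr j h f : R := \int[leb]_x ((f (shift_row j h x) - f x) ^+ 2).

(** The square of a mean is at most the mean of the square, whose integral
    does not depend on the segment. *)
Lemma increment_sqr_le j f g h : f \in L2 -> g \in L2 -> increments j f g ->
  increment_sqr j h f <= h ^+ 2 * \int[leb]_x (g x ^+ 2).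
Proof.
move=> fL gL fg; have sL := Lfun2_segment_mean j h gL.
have dL : (fun x => f (shift_row j h x) - f x) \in L2 by exact: Lfun2B (Lfun2_shift _ _ fL) fL.
have := Lfun2_measurable gL => mg.
have mg2 : measurable_fun setT (fun x => ((g x) ^+ 2)%:E).
  by apply/measurable_EFinP; exact: measurable_funX.
rewrite -lee_fin -Lfun2_integral_sqr// EFinM -Lfun2_integral_sqr//.
rewrite -(@integral_line_mean_unif _ _ j h (fun x => ((g x) ^+ 2)%:E))//; last first.
  by move=> x; rewrite lee_fin sqr_ge0.
have ml : measurable_fun setT (line_mean unif h j (fun x => ((g x) ^+ 2)%:E)).
  by apply: measurable_line_mean => // x; rewrite lee_fin sqr_ge0.
have l0 x : (0 <= line_mean unif h j (fun x => ((g x) ^+ 2)%:E) x)%E.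
  by apply: line_mean_ge0 => y; rewrite lee_fin sqr_ge0.
rewrite -ge0_integralZl_EFin ?sqr_ge0//.
apply: ae_ge0_le_integral => //.
- by move=> x _; rewrite lee_fin sqr_ge0.
- by apply/measurable_EFinP; apply: measurable_funX; exact: Lfun2_measurable dL.
- by move=> x _; rewrite mule_ge0// lee_fin sqr_ge0.
- exact: measurable_funeM.
apply: filterS2 (fg h) (sqr_segment_mean j h gL) => x -> sx _.
by rewrite exprMn EFinM lee_wpmul2l// lee_fin sqr_ge0.
Qed.

Definition remainder j h f g : E -> R := fun x => f (shift_row j h x) - f x - h * g x.

(** The map sending [h] to the translate of [f] by [h] is differentiable at
    the origin in [L^2], with derivative [g] and an error of norm [O(h^2)],
    whose square is [O(h^4)]. Such expansions can be multiplied and paired.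
    The bound is asked for small [h] only, since expanding a product creates
    terms of higher order in [h]. *)
Definition taylor j f g := [/\ f \in L2, g \in L2 & exists C, forall h, `|h| <= 1 ->
  \int[leb]_x (remainder j h f g x ^+ 2) <= C * h ^+ 4].

Lemma Lfun2_remainder j h f g : f \in L2 -> g \in L2 -> remainder j h f g \in L2.
Proof.
by move=> fL gL; apply: Lfun2B; [apply: Lfun2B (Lfun2_shift _ _ fL) fL|exact: Lfun2Z].
Qed.

(** The remainder is [h] times the mean of the increments of [g], and these
    are of order [h] because [g] has itself a derivative [k]. *)
Lemma taylor_increments j f g k : f \in L2 -> g \in L2 -> k \in L2 ->
  increments j f g -> increments j g k -> taylor j f g.
Proof.
move=> fL gL kL fg gk; split=> //; exists (\int[leb]_x (k x ^+ 2)) => h _.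
have mg := Lfun2_measurable gL.
have rL := Lfun2_remainder j h fL gL.
pose G (x : E) (u : R) := (((g (shift_row j (h * u) x) - g x) ^+ 2)%:E)%E.
have mG : measurable_fun setT (fun z : E * measurableTypeR R => G z.1 z.2).
  apply/measurable_EFinP; apply: measurable_funX; apply: measurable_funB.
    exact: (measurable_fun_shift_row2 h j mg).
  exact: measurableT_comp mg measurable_fst.
have G0 z : (0 <= G z.1 z.2)%E by rewrite lee_fin sqr_ge0.
rewrite -lee_fin -Lfun2_integral_sqr//.
apply: (@le_trans _ _ (\int[leb]_x ((h ^+ 2)%:E * \int[unif]_u G x u))%E).
  apply: ae_ge0_le_integral => //.
  - by move=> x _; rewrite lee_fin sqr_ge0.
  - by apply/measurable_EFinP; apply: measurable_funX; exact: Lfun2_measurable rL.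
  - by move=> x _; rewrite mule_ge0// ?lee_fin ?sqr_ge0//; apply: integral_ge0 => u _; exact: (G0 (x, u)).
  - apply: measurable_funeM.
    exact: (measurable_fun_fubini_tonelli_F (m2 := unif) _ mG G0).
  apply: filterS2 (fg h) (ae_segment_Lfun2 j h gL) => x fx gx _.
  rewrite /remainder fx -mulrBr exprMn EFinM lee_wpmul2l ?lee_fin ?sqr_ge0//.
  have XL : (fun u => g (shift_row j (h * u) x) - g x) \in Lfun unif 2%:E.
    exact: Lfun2B gx (Lfun_cst _ _ 2).
  rewrite /G Lfun2_integral_sqr// lee_fin.
  apply: le_trans (sqr_Rintegral_unif XL).
  rewrite RintegralB//; [|exact: Lfun2_unif_integrable|exact/Lfun2_unif_integrable/Lfun_cst].
  by rewrite Rintegral_cst_unif.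
rewrite ge0_integralZl_EFin ?sqr_ge0//; first last.
- exact: (measurable_fun_fubini_tonelli_F (m2 := unif) _ mG G0).
- by move=> x _; apply: integral_ge0 => u _; exact: (G0 (x, u)).
rewrite (fubini_tonelli (m1 := leb) (m2 := unif) (fun z => G z.1 z.2))//=.
rewrite (_ : \int[leb]_x (k x ^+ 2) * h ^+ 4 = h ^+ 2 * (h ^+ 2 * \int[leb]_x (k x ^+ 2)));
  last by ring.
rewrite [leRHS]EFinM lee_wpmul2l ?lee_fin ?sqr_ge0//.
apply: le_integral_unif.
- exact: (measurable_fun_fubini_tonelli_G (m1 := leb) _ mG G0).
- by move=> u; apply: integral_ge0 => x _; exact: (G0 (x, u)).
move=> u /andP[u0 u1]; have := increment_sqr_le (h * u) gL kL gk.
rewrite /increment_sqr -lee_fin -Lfun2_integral_sqr; last exact: Lfun2B (Lfun2_shift _ _ gL) gL.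
move=> /le_trans; apply; rewrite lee_fin ler_wpM2r//.
  by apply: Rintegral_ge0 => x _; exact: sqr_ge0.
by rewrite exprMn ler_piMr ?sqr_ge0// exprn_ile1.
Qed.

Lemma linear_small_eq0 c A : (forall h, `|h| <= 1 -> `|h * c| <= A * h ^+ 2) -> c = 0.
Proof.
move=> cA; apply/eqP; apply: contraT => c0.
have c1 : 0 < `|c| by rewrite normr_gt0.
pose B := `|A| + `|c| + 1.
have B0 : 0 < B by rewrite /B ltr_wpDl// addr_ge0.
have h1 : `|c| / B <= 1 by rewrite ler_pdivrMr// mul1r /B; move: (normr_ge0 A); lra.
have h0 : 0 < `|c| / B by rewrite divr_gt0.
have := cA (`|c| / B); rewrite (gtr0_norm h0) normrM (gtr0_norm h0) => /(_ h1).
rewrite expr2 mulrCA ler_pM2l// mulrA ler_pdivlMr// mulrC ler_pM2r// /B.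
by have := ler_norm A; lra.
Qed.

(** Weighting the two factors by [h] and its inverse balances the two terms of
    the additive Cauchy-Schwarz inequality. *)
Lemma scaled_Rintegral_mul_le h p q C : p \in L2 -> q \in L2 -> h != 0 ->
  \int[leb]_x (q x ^+ 2) <= C * h ^+ 4 ->
  `|\int[leb]_x (p x * q x)| <= (\int[leb]_x (p x ^+ 2) + C) * h ^+ 2.
Proof.
move=> pL qL h0 qC.
have -> : \int[leb]_x (p x * q x) = \int[leb]_x ((h * p x) * (h^-1 * q x)).
  by apply: eq_Rintegral => x _; rewrite mulrACA mulfV// mul1r.
apply: (le_trans (Rintegral_mul_le (Lfun2Z h pL) (Lfun2Z h^-1 qL))).
under eq_Rintegral do rewrite exprMn.
under [X in _ + X]eq_Rintegral do rewrite exprMn.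
rewrite !RintegralZl//; try exact: Lfun2_integrable_sqr.
rewrite mulrDl mulrC lerD2l mulrC exprVn ler_pdivrMr ?exprn_even_gt0//.
by rewrite -mulrA -exprD.
Qed.

(** By translation invariance, pairing [g] with the increment of [f] for the
    step [h] equals pairing [f] with the increment of [g] for the step [- h].
    Comparing the expansions, the terms of order one cancel up to [O(h^2)],
    hence exactly. *)
Lemma taylor_by_parts j f f' g g' : taylor j f f' -> taylor j g g' ->
  \int[leb]_x (f' x * g x) = - \int[leb]_x (f x * g' x).
Proof.
move=> [fL f'L [C fC]] [gL g'L [D gD]].
apply/eqP; rewrite -subr_eq0 opprK; apply/eqP.
apply: (@linear_small_eq0 _ ((\int[leb]_x (f x ^+ 2) + D) + (\int[leb]_x (g x ^+ 2) + C))).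
move=> h h1; have [->|h0] := eqVneq h 0; first by rewrite mul0r expr0n/= mulr0 normr0.
have rL := Lfun2_remainder j h fL f'L.
have qL := Lfun2_remainder j (- h) gL g'L.
have : h * (\int[leb]_x (f' x * g x) + \int[leb]_x (f x * g' x)) =
    \int[leb]_x (f x * remainder j (- h) g g' x) - \int[leb]_x (g x * remainder j h f f' x).
  have -> : \int[leb]_x (f x * remainder j (- h) g g' x) =
      \int[leb]_x (f x * g (shift_row j (- h) x)) - \int[leb]_x (f x * g x)
      + h * \int[leb]_x (f x * g' x).
    rewrite -RintegralZl//; last exact: Lfun2_integrableM.
    have i1 := Lfun2_integrableM fL (Lfun2_shift j (- h) gL).
    have i2 := Lfun2_integrableM fL gL.
    have i3 := Lfun2_integrableM fL (Lfun2Z h g'L).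
    rewrite -RintegralB// -RintegralD//.
    - by apply: eq_Rintegral => x _; rewrite /remainder; ring.
    - exact: (integrableB measurableT i1 i2).
    - by apply: eq_integrable i3 => // x _; rewrite mulrCA.
  have -> : \int[leb]_x (g x * remainder j h f f' x) =
      \int[leb]_x (f (shift_row j h x) * g x) - \int[leb]_x (f x * g x)
      - h * \int[leb]_x (f' x * g x).
    rewrite -RintegralZl//; last exact: Lfun2_integrableM.
    have i1 := Lfun2_integrableM (Lfun2_shift j h fL) gL.
    have i2 := Lfun2_integrableM fL gL.
    have i3 := Lfun2_integrableM (Lfun2Z h f'L) gL.
    rewrite -RintegralB// -RintegralB//.
    - by apply: eq_Rintegral => x _; rewrite /remainder; ring.
    - exact: (integrableB measurableT i1 i2).
    - by apply: eq_integrable i3 => // x _; rewrite /= mulrA.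
  rewrite Rintegral_shiftM//; [ring|exact: Lfun2_measurable fL|exact: Lfun2_measurable gL].
move=> ->; apply: (le_trans (ler_normB _ _)); rewrite mulrDl; apply: lerD.
  apply: scaled_Rintegral_mul_le => //; have := gD (- h); rewrite normrN => /(_ h1).
  by rewrite -[(- h) ^+ 4]/((- h) ^+ (2 * 2)) exprM sqrrN -exprM.
by apply: scaled_Rintegral_mul_le => //; exact: fC.
Qed.

End taylor.

(** * A pointwise bound by means along lines *)

Section scaling.
Context {R : realType}.
Local Notation l1 := (@lebesgue_measure R).

Local Notation image_measure := measure_function_pushforward__canonical__measure_function_Measure.

Lemma measurable_scale (u : R) : measurable_fun setT ( *%R u : R -> measurableTypeR R).
Proof. exact: measurable_funM. Qed.

(** The image of Lebesgue measure under a dilation, normalized so as to be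
    Lebesgue measure again. *)
Definition scaled_lebesgue (u : R) (u0 : 0 < u) : {measure set (measurableTypeR R) -> \bar R} :=
  mscale (NngNum (ltW u0)) (image_measure l1 (measurable_scale u)).

Lemma lebesgue_measure_scale (u : R) (u0 : 0 < u) (A : set R) : measurable A ->
  scaled_lebesgue u0 A = l1 A.
Proof.
move=> mA; apply/esym/lebesgue_measure_unique => // _ [[a b] _ <-] /=.
rewrite /mscale/= /pushforward.
rewrite (_ : _ @^-1` _ = `](a / u), (b / u)]%classic); last first.
  by apply/seteqP; split => x /=; rewrite !in_itv/= ltr_pdivrMr// ler_pdivlMr// mulrC.
rewrite !lebesgue_measure_itv/= !lte_fin ltr_pM2r ?invr_gt0//.
case: ifP => _; last by rewrite mule0.
by rewrite -!EFinB -EFinM -mulrBl mulrCA mulfV ?gt_eqF// mulr1.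
Qed.

Lemma ge0_integral_scale (u : R) (F : R -> \bar R) : 0 < u ->
  measurable_fun setT F -> (forall x, 0 <= F x)%E ->
  (u%:E * \int[l1]_x F (u * x)%R = \int[l1]_x F x)%E.
Proof.
move=> u0 mF F0; transitivity (\int[scaled_lebesgue u0]_x F x)%E; last first.
  by apply: eq_measure_integral => A mA _; exact: lebesgue_measure_scale.
rewrite ge0_integral_mscale//=; congr (_ * _)%E.
by rewrite ge0_integral_pushforward//; exact: measurable_scale.
Qed.

End scaling.

Section sup_bound.
Context {R : realType} {n : nat}.
Local Notation E := 'rV[R]_n.
Local Notation leb := (@lebesgue_row R n).
Local Notation l1 := (@lebesgue_measure R).
Local Notation L2 := (Lfun leb 2%:E).
Local Notation unif := (uniform_prob (@ltr01 R)).
Implicit Types (f g k p q phi : E -> R) (j : 'I_n) (c h t u : R).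

Lemma line_mean_unif_le j u (F : E -> \bar R) x : 0 < u ->
  measurable_fun setT F -> (forall x, 0 <= F x)%E ->
  (u%:E * line_mean unif u j F x <= line_mean l1 1 j F x)%E.
Proof.
move=> u0 mF F0; rewrite /line_mean.
under [leRHS]eq_integral do rewrite mul1r.
have mFx := measurable_shift_line 1 j x mF.
rewrite -(@ge0_integral_scale _ u (fun t => F (shift_row j t x)))//; last first.
  by under eq_fun do rewrite -[X in shift_row _ X]mul1r.
rewrite lee_wpmul2l ?lee_fin ?(ltW u0)// integral_unif; last exact: (measurable_shift_line u j x mF).
apply: ge0_subset_integral => //.
exact: (measurable_shift_line u j x mF).
Qed.

(** Expressing [f x] by the value of [f] at distance [u] and the mean of [g]
    in between bounds [f x ^+ 2] by twice the square of that value plus an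
    integral of [2 * g ^+ 2] over the line. Averaging over [u] between 0 and 1
    turns the value of [f] into an integral as well. *)
Lemma sqr_le_line_mean j f g : f \in L2 -> g \in L2 -> increments j f g ->
  {ae leb, forall x, ((f x ^+ 2)%:E <=
    line_mean l1 1 j (fun y => (2 * f y ^+ 2)%:E) x +
    line_mean l1 1 j (fun y => (2 * g y ^+ 2)%:E) x)%E}.
Proof.
move=> fL gL fg; have mf := Lfun2_measurable fL; have mg := Lfun2_measurable gL.
have m2 (p : E -> R) : measurable_fun setT p -> measurable_fun setT (fun y => (2 * p y ^+ 2)%:E).
  by move=> mp; apply/measurable_EFinP; apply: measurable_funM => //; exact: measurable_funX.
have p2 (p : E -> R) y : (0 <= (2 * p y ^+ 2)%:E)%E.
  by rewrite lee_fin mulr_ge0// sqr_ge0.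
set A := line_mean l1 1 j (fun y => (2 * g y ^+ 2)%:E).
have mA : measurable_fun setT A by apply: measurable_line_mean => //; exact: m2.
have A0 x : (0 <= A x)%E by exact: line_mean_ge0.
have step u : 0 < u -> u <= 1 ->
    {ae leb, forall x, ((f x ^+ 2)%:E <= (2 * f (shift_row j u x) ^+ 2)%:E + A x)%E}.
  move=> u0 u1; apply: filterS2 (fg u) (sqr_segment_mean j u gL) => x fx sx.
  apply: (@le_trans _ _ ((2 * f (shift_row j u x) ^+ 2)%:E +
      (u * (u * (2 * segment_mean j u g x ^+ 2)))%:E)%E).
    rewrite -EFinD lee_fin.
    have -> : f x = f (shift_row j u x) - u * segment_mean j u g x by rewrite -fx; ring.
    move: (f (shift_row j u x)) (segment_mean j u g x) => a s.
    rewrite (_ : 2 * a ^+ 2 + _ = (a - u * s) ^+ 2 + (a + u * s) ^+ 2); last by ring.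
    by rewrite lerDl sqr_ge0.
  rewrite leeD2l//; apply: le_trans (line_mean_unif_le j x u0 (m2 _ mg) (p2 _)).
  rewrite EFinM; apply: (@le_trans _ _ (1 * (u * (2 * segment_mean j u g x ^+ 2))%:E)%E).
    by rewrite lee_wpmul2r ?lee_fin// mulr_ge0 ?(ltW u0)// mulr_ge0// sqr_ge0.
  rewrite mul1e EFinM lee_wpmul2l ?lee_fin ?(ltW u0)//.
  rewrite /line_mean; under [leRHS]eq_integral do rewrite EFinM.
  rewrite ge0_integralZl_EFin//; first by rewrite EFinM lee_wpmul2l.
  - by move=> v _; rewrite lee_fin sqr_ge0.
  - apply/measurable_EFinP; apply: measurable_funX.
    exact: (measurable_shift_line u j x mg).
(* The slices of [N] at fixed [u] are null, so for almost every [x] the bound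
   of [step] holds for almost every [u]. *)
pose N : set (E * measurableTypeR R) := [set z | 0 < z.2 <= 1 /\
  ~ ((f z.1 ^+ 2)%:E <= (2 * f (shift_row j (1 * z.2) z.1) ^+ 2)%:E + A z.1)%E].
have mfA : measurable_fun setT (fun z : E * measurableTypeR R =>
    ((2 * f (shift_row j (1 * z.2) z.1) ^+ 2)%:E + A z.1)%E).
  apply: emeasurable_funD; first exact: (measurable_fun_shift_row2 1 j (m2 _ mf)).
  exact: measurableT_comp mA measurable_fst.
have mfx : measurable_fun setT (fun z : E * measurableTypeR R => (f z.1 ^+ 2)%:E).
  apply/measurable_EFinP; apply: measurable_funX.
  exact: measurableT_comp mf measurable_fst.
have mN : measurable N.
  rewrite (_ : N = (setT `*` `]0, 1]%classic) `\`
      [set z | ((f z.1 ^+ 2)%:E <= (2 * f (shift_row j (1 * z.2) z.1) ^+ 2)%:E + A z.1)%E]).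
    apply: measurableD; first exact: measurableX.
    have := measurable_fun_lee mfx mfA.
    have m1 : measurable [set true] by [].
    by move=> /(_ measurableT _ m1); rewrite setTI.
  by apply/seteqP; split => z; rewrite /N /= in_itv/= => -[]; tauto.
have N0 u : leb (ysection N u) = 0%E.
  have [/andP[u0 u1]|u01] := boolP (0 < u <= 1); last first.
    rewrite (_ : ysection N u = set0)//; apply/seteqP; split => x //.
    by rewrite /ysection /= inE /N/= (negbTE u01) => -[].
  apply: measure_negligible; first exact: measurable_ysection.
  apply: negligibleS (step u u0 u1) => x /=; rewrite /ysection/= inE /N/= mul1r.
  by move=> [].
have := @ae_ae_section R _ _ _ _ leb l1 N mN N0.
apply: filterS => x Nx.
have cst01 (r : \bar R) : (\int[l1]_(u in `]0%R, 1%R]) r = r)%E.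
  have l01 : l1 (`]0%R, 1%R]%classic : set R) = 1%E.
    by rewrite lebesgue_measure_itv/= lte_fin ltr01 -EFinB subr0.
  by rewrite integral_cst// [X in (_ * X)%E](_ : _ = 1%E) ?mule1.
rewrite -[leLHS]cst01.
have mfu := measurable_shift_line 1 j x (m2 _ mf).
apply: (@le_trans _ _ (\int[l1]_(u in `]0%R, 1%R])
   ((2 * f (shift_row j (1 * u) x) ^+ 2)%:E + A x))%E).
  apply: ae_ge0_le_integral => //.
  - by move=> u _; rewrite lee_fin sqr_ge0.
  - by move=> u _; rewrite adde_ge0.
  - by apply: emeasurable_funD => //; exact: measurable_funTS mfu.
  case: Nx => M [mM M0 NM]; exists M; split=> // u /= nu; apply: NM => /= Nu; apply: nu.
  by rewrite in_itv/= => u01; apply: contrapT => h; apply: Nu.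
rewrite ge0_integralD//; last exact: measurable_funTS mfu.
rewrite cst01 leeD2r//; apply: ge0_subset_integral => //.
Qed.

End sup_bound.

(** * Sobolev embedding and products *)

Section sobolev_algebra.
Context {R : realType} {n : nat}.
Local Notation E := 'rV[R]_n.
Local Notation leb := (@lebesgue_row R n).
Local Notation l1 := (@lebesgue_measure R).
Local Notation L2 := (Lfun leb 2%:E).
Implicit Types (f g k p q phi : E -> R) (j : 'I_n) (c h t u : R) (s : seq 'I_n).

Lemma HinftyP f : Hinfty f <-> f \in L2 /\ forall s, exists g, weak_derivative s f g.
Proof.
split=> [Hf|[fL Hf] k]; last by split.
split; first exact: (Hf 0%N).1.
by move=> s; exact: (Hf (size s)).2.
Qed.

Lemma Hinfty_Lfun2 f : Hinfty f -> f \in L2.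
Proof. by move=> /HinftyP[]. Qed.

Lemma Hinfty_measurable f : Hinfty f -> measurable_fun setT f.
Proof. by move=> /Hinfty_Lfun2; exact: Lfun2_measurable. Qed.

Lemma weak_derivative_cons j s f g k : weak_derivative [:: j] f g ->
  weak_derivative s g k -> weak_derivative (j :: s) f k.
Proof.
move=> [gL fg] [kL gk]; split=> // phi tphi.
rewrite -[partials (j :: s) phi]/(partials [:: j] (partials s phi)).
rewrite fg ?gk//; last exact: test_function_partials.
by rewrite mulrA -exprD.
Qed.

(** A weak derivative can be taken out first because partial derivatives of
    test functions are test functions. *)
Lemma weak_derivative_uncons j s f g k : weak_derivative [:: j] f g ->
  weak_derivative (j :: s) f k -> weak_derivative s g k.
Proof.
move=> [gL fg] [kL fk]; split=> // phi tphi.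
have := fk _ tphi; rewrite -[partials (j :: s) phi]/(partials [:: j] (partials s phi)).
rewrite fg; last exact: test_function_partials.
by rewrite /= expr1 exprS -mulrA !mulN1r => /oppr_inj.
Qed.

Lemma Hinfty_weak_derivative j f g : Hinfty f -> weak_derivative [:: j] f g -> Hinfty g.
Proof.
move=> /HinftyP[fL Hf] fg; apply/HinftyP; split; first exact: fg.1.
by move=> s; have [k fk] := Hf (j :: s); exists k; exact: weak_derivative_uncons fg fk.
Qed.

Lemma weak_derivativeD s f f' g g' : f \in L2 -> g \in L2 ->
  weak_derivative s f f' -> weak_derivative s g g' ->
  weak_derivative s (fun x => f x + g x) (fun x => f' x + g' x).
Proof.
move=> fL gL [f'L ff'] [g'L gg']; split=> [|phi tphi]; first exact: Lfun2D.
have pL := test_function_Lfun2 tphi.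
have dL := test_function_Lfun2 (test_function_partials s tphi).
under eq_Rintegral do rewrite mulrDl.
rewrite RintegralD//; [|exact: Lfun2_integrableM..].
rewrite ff'// gg'// -mulrDr -RintegralD//; [|exact: Lfun2_integrableM..].
by congr (_ * _); apply: eq_Rintegral => x _; rewrite mulrDl.
Qed.

Lemma weak_derivativeZ s c f f' : f \in L2 ->
  weak_derivative s f f' -> weak_derivative s (fun x => c * f x) (fun x => c * f' x).
Proof.
move=> fL [f'L ff']; split=> [|phi tphi]; first exact: Lfun2Z.
have pL := test_function_Lfun2 tphi.
have dL := test_function_Lfun2 (test_function_partials s tphi).
under eq_Rintegral do rewrite -mulrA.
rewrite RintegralZl//; last exact: Lfun2_integrableM.
under [X in _ = _ * X]eq_Rintegral do rewrite -mulrA.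
rewrite RintegralZl//; last exact: Lfun2_integrableM.
by rewrite ff'// mulrCA.
Qed.

Lemma HinftyD f g : Hinfty f -> Hinfty g -> Hinfty (fun x => f x + g x).
Proof.
move=> /HinftyP[fL Hf] /HinftyP[gL Hg]; apply/HinftyP; split; first exact: Lfun2D.
move=> s; have [f' ff'] := Hf s; have [g' gg'] := Hg s.
by exists (fun x => f' x + g' x); exact: weak_derivativeD.
Qed.

Lemma HinftyZ c f : Hinfty f -> Hinfty (fun x => c * f x).
Proof.
move=> /HinftyP[fL Hf]; apply/HinftyP; split; first exact: Lfun2Z.
by move=> s; have [f' ff'] := Hf s; exists (fun x => c * f' x); exact: weak_derivativeZ.
Qed.

Lemma HinftyN f : Hinfty f -> Hinfty (fun x => - f x).
Proof. by move=> /(HinftyZ (-1)); under eq_fun do rewrite mulN1r. Qed.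

Lemma HinftyB f g : Hinfty f -> Hinfty g -> Hinfty (fun x => f x - g x).
Proof. by move=> Hf Hg; apply: HinftyD => //; exact: HinftyN. Qed.

Lemma Hinfty0 : Hinfty (fun _ : E => 0 : R).
Proof.
apply/HinftyP; split=> [|s]; first exact: Lfun2_0.
exists (fun=> 0); split=> [|phi _]; first exact: Lfun2_0.
by under eq_Rintegral do rewrite mul0r; under [X in _ * X]eq_Rintegral do rewrite mul0r;
  rewrite Rintegral_cst// mul0r mulr0.
Qed.

Lemma Hinfty_sum I (r : seq I) (F : I -> E -> R) : (forall i, Hinfty (F i)) ->
  Hinfty (fun x => \sum_(i <- r) F i x).
Proof.
move=> HF; elim: r => [|i r IH]; first by under eq_fun do rewrite big_nil; exact: Hinfty0.
by under eq_fun do rewrite big_cons; exact: HinftyD.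
Qed.

(** Each coordinate costs one derivative: the bound of [f ^+ 2] by means of [f
    ^+ 2] and [g ^+ 2] along a line is iterated, [g] being the derivative
    along that line. *)
Lemma Hinfty_iter_line_mean js f : Hinfty f -> exists G : E -> \bar R,
  [/\ measurable_fun setT G, forall x, (0 <= G x)%E, (\int[leb]_x G x < +oo)%E &
    {ae leb, forall x, ((f x ^+ 2)%:E <= iter_line_mean js G x)%E}].
Proof.
have m2 (p : E -> R) : measurable_fun setT p -> measurable_fun setT (fun y => (2 * p y ^+ 2)%:E).
  by move=> mp; apply/measurable_EFinP; apply: measurable_funM => //; exact: measurable_funX.
have p2 (p : E -> R) y : (0 <= (2 * p y ^+ 2)%:E)%E.
  by rewrite lee_fin mulr_ge0// sqr_ge0.
elim: js f => [|j js IH] f Hf.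
  have /Lfun2P[mf fi] := Hinfty_Lfun2 Hf.
  exists (fun x => (f x ^+ 2)%:E); split=> //; last exact: aeW.
    by apply/measurable_EFinP; exact: measurable_funX.
  by move=> x; rewrite lee_fin sqr_ge0.
have [g fg] : exists g, weak_derivative [:: j] f g by have /HinftyP[_] := Hf; exact.
have Hg := Hinfty_weak_derivative Hf fg.
have fL := Hinfty_Lfun2 Hf; have gL := Hinfty_Lfun2 Hg.
(* doubling an upper bound costs nothing, since iterated means are additive *)
have double p : Hinfty p -> exists G : E -> \bar R,
    [/\ measurable_fun setT G, forall x, (0 <= G x)%E, (\int[leb]_x G x < +oo)%E &
      {ae leb, forall x, ((2 * p x ^+ 2)%:E <= iter_line_mean js G x)%E}].
  move=> /IH[G [mG G0 Goo Gp]]; exists (G \+ G)%E; split.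
  - exact: emeasurable_funD.
  - by move=> x; rewrite adde_ge0.
  - by rewrite ge0_integralD// lte_add_pinfty.
  rewrite iter_line_meanD//; apply: filterS Gp => x px.
  by rewrite mulr_natl mulr2n EFinD leeD.
have [F [mF F0 Foo Ff]] := double f Hf.
have [G [mG G0 Goo Gg]] := double g Hg.
have [mIF IF0] := iter_line_mean_measurable_ge0 js mF F0.
have [mIG IG0] := iter_line_mean_measurable_ge0 js mG G0.
exists (F \+ G)%E; split.
- exact: emeasurable_funD.
- by move=> x; rewrite adde_ge0.
- by rewrite ge0_integralD// lte_add_pinfty.
have incr := increments_weak_derivative fL fg.
have fF := @ae_le_line_mean _ _ l1 1 j _ _ (m2 f (Lfun2_measurable fL)) (p2 f) mIF IF0 Ff.
have gG := @ae_le_line_mean _ _ l1 1 j _ _ (m2 g (Lfun2_measurable gL)) (p2 g) mIG IG0 Gg.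
apply: filterS3 (sqr_le_line_mean fL gL incr) fF gG => x fx fFx gGx.
rewrite /= iter_line_meanD// line_meanD//.
by apply: (le_trans fx); exact: leeD.
Qed.

(** A Sobolev embedding: once the means have been taken along every
    coordinate, the bound is an integral over the whole space and no longer
    depends on the point. *)
Lemma Hinfty_ae_bounded f : Hinfty f -> ae_bounded leb f.
Proof.
move=> /(@Hinfty_iter_line_mean (enum 'I_n))[G [mG G0 Goo fG]].
exists (fine (\int[leb]_x G x)%E); apply: filterS fG => x.
rewrite iter_line_mean_enum// => fx; rewrite -lee_fin fineK//.
by rewrite ge0_fin_numE// integral_ge0.
Qed.

Lemma taylor_Hinfty j f g : Hinfty f -> weak_derivative [:: j] f g -> taylor j f g.
Proof.
move=> Hf fg; have Hg := Hinfty_weak_derivative Hf fg.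
have [k gk] : exists k, weak_derivative [:: j] g k by have /HinftyP[_] := Hg; exact.
have fL := Hinfty_Lfun2 Hf; have gL := Hinfty_Lfun2 Hg.
by apply: (taylor_increments fL gL gk.1); exact: increments_weak_derivative.
Qed.

Lemma taylor_test_function j phi : test_function phi ->
  taylor j phi (partials [:: j] phi).
Proof.
move=> tphi; have tD := test_function_partials [:: j] tphi.
apply: (taylor_increments (test_function_Lfun2 tphi) (test_function_Lfun2 tD)
  (test_function_Lfun2 (test_function_partials [:: j] tD))); exact: increments_test_function.
Qed.

(** A test function has an expansion too, and the integration by parts of the
    two expansions is the definition of a weak derivative. *)
Lemma weak_derivative_taylor j f g : taylor j f g -> weak_derivative [:: j] f g.
Proof.
move=> Tfg; split=> [|phi tphi]; first by case: Tfg.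
have /(taylor_by_parts Tfg) E := taylor_test_function j tphi.
by rewrite expr1 mulN1r E opprK.
Qed.

(** The remainder of a product is a combination of the remainders of the
    factors, with bounded coefficients, and of [h ^+ 2 * f' * g']. *)
Lemma taylorM j f f' g g' : taylor j f f' -> taylor j g g' ->
  ae_bounded leb f -> ae_bounded leb f' -> ae_bounded leb g ->
  taylor j (fun x => f x * g x) (fun x => f' x * g x + f x * g' x).
Proof.
move=> [fL f'L [C fC]] [gL g'L [D gD]] bf bf' bg.
have [mf mf' mg] : [/\ measurable_fun setT f, measurable_fun setT f' & measurable_fun setT g].
  by split; [exact: Lfun2_measurable fL|exact: Lfun2_measurable f'L|exact: Lfun2_measurable gL].
have fgL : (fun x => f x * g x) \in L2 by exact: Lfun2_ae_boundedM.
have dL : (fun x => f' x * g x + f x * g' x) \in L2.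
  by apply: Lfun2D; exact: Lfun2_ae_boundedM.
split=> //.
have [[[A fA] [B fB]] [K gK]] := (bf, bf', bg).
pose M := `|A| + `|B| + `|K|.
have [M0 [AM BM KM]] : 0 <= M /\ [/\ A <= M, B <= M & K <= M].
  have := ler_norm A; have := ler_norm B; have := ler_norm K.
  have := normr_ge0 A; have := normr_ge0 B; have := normr_ge0 K; rewrite /M.
  by move=> *; split; [|split]; lra.
exists (4 * M * (C + D + D + \int[leb]_x (g' x ^+ 2))) => h h1.
have rL := Lfun2_remainder j h fL f'L.
have qL := Lfun2_remainder j h gL g'L.
have rE x : remainder j h (fun x => f x * g x) (fun x => f' x * g x + f x * g' x) x =
    g (shift_row j h x) * remainder j h f f' x + f x * remainder j h g g' x
    + f' x * (h * remainder j h g g' x) + f' x * (h ^+ 2 * g' x).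
  by rewrite /remainder; ring.
pose U x := 4 * M * (remainder j h f f' x ^+ 2 + 2 * remainder j h g g' x ^+ 2
    + (h ^+ 2 * g' x) ^+ 2).
have h21 : h ^+ 2 <= 1 by rewrite -(real_normK (num_real h)) exprn_ile1.
have le4 (a b c d : R) : (a + b + c + d) ^+ 2 <= 4 * (a ^+ 2 + b ^+ 2 + c ^+ 2 + d ^+ 2).
  have := sqr_ge0 (a - b); have := sqr_ge0 (a - c); have := sqr_ge0 (a - d).
  by have := sqr_ge0 (b - c); have := sqr_ge0 (b - d); have := sqr_ge0 (c - d); nra.
have rU : {ae leb, forall x, remainder j h (fun x => f x * g x)
    (fun x => f' x * g x + f x * g' x) x ^+ 2 <= U x}.
  have gh := ae_shift_row j h gK.
  apply: filterS3 fA fB gh => x fx f'x gx.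
  rewrite rE /U; apply: (le_trans (le4 _ _ _ _)); rewrite -mulrA ler_pM2l//.
  rewrite !exprMn.
  set r := remainder j h f f' x ^+ 2; set q := remainder j h g g' x ^+ 2.
  have r0 : 0 <= r by exact: sqr_ge0.
  have q0 : 0 <= q by exact: sqr_ge0.
  have g0 : 0 <= (h ^+ 2) ^+ 2 * g' x ^+ 2 by rewrite mulr_ge0// sqr_ge0.
  have e1 : g (shift_row j h x) ^+ 2 * r <= M * r.
    by rewrite ler_wpM2r// (le_trans gx).
  have e2 : f x ^+ 2 * q <= M * q by rewrite ler_wpM2r// (le_trans fx).
  have e3 : f' x ^+ 2 * (h ^+ 2 * q) <= M * q.
    rewrite ler_pM ?sqr_ge0//; first by rewrite mulr_ge0// sqr_ge0.
      by rewrite (le_trans f'x).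
    by rewrite ler_piMl.
  have e4 : f' x ^+ 2 * ((h ^+ 2) ^+ 2 * g' x ^+ 2) <= M * ((h ^+ 2) ^+ 2 * g' x ^+ 2).
    by rewrite ler_wpM2r// (le_trans f'x).
  by lra.
have hL : (fun x => h ^+ 2 * g' x) \in L2 by exact: Lfun2Z.
have i1 := Lfun2_integrable_sqr rL.
have i2 := Lfun2_integrableM (Lfun2Z 2 qL) qL.
have i3 := Lfun2_integrable_sqr hL.
have i12 := integrableD measurableT i1 i2.
have UE : U = fun x => 4 * M * (remainder j h f f' x ^+ 2 +
    2 * remainder j h g g' x * remainder j h g g' x + (h ^+ 2 * g' x) ^+ 2).
  by apply/funext => x; rewrite /U; ring.
have iS : leb.-integrable setT (fun x => (remainder j h f f' x ^+ 2 +
    2 * remainder j h g g' x * remainder j h g g' x + (h ^+ 2 * g' x) ^+ 2)%:E).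
  exact: (integrableD measurableT i12 i3).
have iU : leb.-integrable setT (EFin \o U).
  by apply: eq_integrable (integrableZl measurableT (4 * M) iS) => // x _; rewrite UE.
apply: (@le_trans _ _ (\int[leb]_x U x)).
  rewrite -lee_fin -Lfun2_integral_sqr; last exact: Lfun2_remainder.
  rewrite [leRHS]fineK; last exact: integrable_fin_num iU.
  apply: ae_ge0_le_integral => //.
  - by move=> x _; rewrite lee_fin sqr_ge0.
  - apply/measurable_EFinP; apply: measurable_funX.
    exact: Lfun2_measurable (Lfun2_remainder j h fgL dL).
  - move=> x _; rewrite lee_fin /U; apply: mulr_ge0; first by rewrite mulr_ge0.
    by rewrite !addr_ge0 ?sqr_ge0// mulr_ge0 ?sqr_ge0.
  - exact: measurable_int iU.
  - by apply: filterS rU => x ? _; rewrite lee_fin.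
have E2 : \int[leb]_x (2 * remainder j h g g' x * remainder j h g g' x) =
    2 * \int[leb]_x (remainder j h g g' x ^+ 2).
  rewrite -RintegralZl//; last exact: Lfun2_integrable_sqr.
  by apply: eq_Rintegral => x _; ring.
have E3 : \int[leb]_x ((h ^+ 2 * g' x) ^+ 2) = h ^+ 4 * \int[leb]_x (g' x ^+ 2).
  rewrite -RintegralZl//; last exact: Lfun2_integrable_sqr.
  by apply: eq_Rintegral => x _; ring.
rewrite UE RintegralZl// -[leRHS]mulrA ler_wpM2l ?mulr_ge0//.
rewrite RintegralD// RintegralD// E2 E3.
have := fC h h1; have := gD h h1; lra.
Qed.

End sobolev_algebra.

(** * Calculus of weak derivatives *)

Section weak_calculus.
Context {R : realType} {n : nat}.
Local Notation E := 'rV[R]_n.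
Local Notation leb := (@lebesgue_row R n).
Local Notation L2 := (Lfun leb 2%:E).
Implicit Types (f g k p q phi : E -> R) (j : 'I_n) (c : R) (s : seq 'I_n).

Lemma wpartialP j f : Hinfty f -> weak_derivative [:: j] f (wpartial j f).
Proof. by move=> /HinftyP[_ /(_ [:: j])[g fg]]; exact: (@xgetPex _ (fun=> 0) [set g | weak_derivative [:: j] f g] (ex_intro _ g fg)). Qed.

Lemma Hinfty_wpartial j f : Hinfty f -> Hinfty (wpartial j f).
Proof. by move=> Hf; apply: Hinfty_weak_derivative (wpartialP j Hf). Qed.

Lemma taylor_wpartial j f : Hinfty f -> taylor j f (wpartial j f).
Proof. by move=> Hf; apply: taylor_Hinfty => //; exact: wpartialP. Qed.

Lemma taylorM_Hinfty j f g : Hinfty f -> Hinfty g ->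
  taylor j (fun x => f x * g x) (fun x => wpartial j f x * g x + f x * wpartial j g x).
Proof.
move=> Hf Hg; apply: taylorM; try exact: taylor_wpartial; apply: Hinfty_ae_bounded => //.
exact: Hinfty_wpartial.
Qed.

Lemma weak_derivative_nil f : f \in L2 -> weak_derivative [::] f f.
Proof. by move=> fL; split=> // phi _; rewrite expr0 mul1r. Qed.

Lemma Hinfty_Lfun2M f g : Hinfty f -> Hinfty g -> (fun x => f x * g x) \in L2.
Proof.
move=> Hf Hg; apply: Lfun2_ae_boundedM.
- exact: Hinfty_Lfun2.
- exact: Hinfty_measurable.
- exact: Hinfty_ae_bounded.
Qed.

(** By induction on the order of derivation: the Leibniz rule gives the first
    derivative as a sum of products of functions of the same kind. *)
Lemma HinftyM f g : Hinfty f -> Hinfty g -> Hinfty (fun x => f x * g x).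
Proof.
move=> Hf Hg; apply/HinftyP; split; first exact: Hinfty_Lfun2M.
move=> s; elim: s f g Hf Hg => [|j s IH] f g Hf Hg.
  by exists (fun x => f x * g x); apply: weak_derivative_nil; exact: Hinfty_Lfun2M.
have [h1 H1] := IH _ _ (Hinfty_wpartial j Hf) Hg.
have [h2 H2] := IH _ _ Hf (Hinfty_wpartial j Hg).
exists (fun x => h1 x + h2 x).
apply: weak_derivative_cons (weak_derivative_taylor (taylorM_Hinfty j Hf Hg)) _.
by apply: weak_derivativeD => //; apply: Hinfty_Lfun2M => //; exact: Hinfty_wpartial.
Qed.

Lemma ae_eq_of_tensor f g : f \in L2 -> g \in L2 ->
  (forall b (M : R), (forall i, smooth1 (b i)) -> (forall i t, M < `|t| -> b i t = 0) ->
    \int[leb]_x (f x * tensor b x) = \int[leb]_x (g x * tensor b x)) ->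
  f = g %[ae leb].
Proof.
move=> fL gL fg.
suff : (fun x => f x - g x) = cst 0 %[ae leb] by apply: filterS => x /(_ I) /subr0_eq.
apply: ae_eq0_of_tensor; first exact: Lfun2B.
move=> b M sb bM; have bL := test_function_Lfun2 (test_function_tensor sb bM).
under eq_Rintegral do rewrite mulrBl.
by rewrite RintegralB ?(fg _ _ sb bM) ?subrr//; exact: Lfun2_integrableM.
Qed.

Lemma weak_derivative_unique s f g g' : weak_derivative s f g -> weak_derivative s f g' ->
  g = g' %[ae leb].
Proof.
move=> [gL fg] [g'L fg']; apply: ae_eq_of_tensor => // b M sb bM.
have tb := test_function_tensor sb bM.
have s0 : (-1) ^+ size s != 0 :> R by rewrite signr_eq0.
by apply: (mulfI s0); rewrite -(fg _ tb) (fg' _ tb).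
Qed.

Lemma wpartial_eq j f g : Hinfty f -> weak_derivative [:: j] f g ->
  wpartial j f = g %[ae leb].
Proof. by move=> Hf; apply: weak_derivative_unique; exact: wpartialP. Qed.

Lemma wpartialD j f g : Hinfty f -> Hinfty g ->
  wpartial j (fun x => f x + g x) = (fun x => wpartial j f x + wpartial j g x) %[ae leb].
Proof.
move=> Hf Hg; apply: wpartial_eq; first exact: HinftyD.
by apply: weak_derivativeD; [exact: Hinfty_Lfun2..|exact: wpartialP|exact: wpartialP].
Qed.

Lemma wpartialZ j c f : Hinfty f ->
  wpartial j (fun x => c * f x) = (fun x => c * wpartial j f x) %[ae leb].
Proof.
move=> Hf; apply: wpartial_eq; first exact: HinftyZ.
by apply: weak_derivativeZ; [exact: Hinfty_Lfun2|exact: wpartialP].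
Qed.

Lemma wpartialB j f g : Hinfty f -> Hinfty g ->
  wpartial j (fun x => f x - g x) = (fun x => wpartial j f x - wpartial j g x) %[ae leb].
Proof.
move=> Hf Hg; apply: filterS2 (wpartialD j Hf (HinftyN Hg)) (wpartialZ j (-1) Hg) => x.
move=> /(_ I) -> /(_ I) E _; rewrite -mulN1r -E; congr (_ + wpartial _ _ _).
by apply/funext => y; rewrite mulN1r.
Qed.

Lemma wpartial_sum j J (r : seq J) (F : J -> E -> R) : (forall i, Hinfty (F i)) ->
  wpartial j (fun x => \sum_(i <- r) F i x) = (fun x => \sum_(i <- r) wpartial j (F i) x) %[ae leb].
Proof.
move=> HF; elim: r => [|i r IH].
  have := wpartialZ j 0 (@Hinfty0 R n); apply: filterS => x /(_ I) E _; rewrite big_nil.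
  rewrite -[RHS](mul0r (wpartial j (fun=> 0) x)) -E; congr (wpartial _ _ _).
  by apply/funext => y; rewrite big_nil mul0r.
apply: filterS2 (wpartialD j (HF i) (Hinfty_sum r HF)) IH => x /(_ I) E1 /(_ I) E2 _.
rewrite big_cons -E2 -E1; congr (wpartial _ _ _).
by apply/funext => y; rewrite big_cons.
Qed.

Lemma wpartialM j f g : Hinfty f -> Hinfty g ->
  wpartial j (fun x => f x * g x) =
  (fun x => wpartial j f x * g x + f x * wpartial j g x) %[ae leb].
Proof.
move=> Hf Hg; apply: wpartial_eq; first exact: HinftyM.
exact/weak_derivative_taylor/taylorM_Hinfty.
Qed.

(** Second derivatives commute when tested against tensor products, which
    suffice to separate functions. *)
Lemma wpartialC j (k : 'I_n) f : Hinfty f ->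
  wpartial j (wpartial k f) = wpartial k (wpartial j f) %[ae leb].
Proof.
move=> Hf.
have [L1 W1] := weak_derivative_cons (wpartialP k Hf) (wpartialP j (Hinfty_wpartial k Hf)).
have [L2 W2] := weak_derivative_cons (wpartialP j Hf) (wpartialP k (Hinfty_wpartial j Hf)).
apply: (ae_eq_of_tensor L1 L2) => b M sb bM.
have tb := test_function_tensor sb bM.
have s2 : (-1) ^+ 2 = 1 :> R by rewrite sqrrN expr1n.
have s20 : (-1) ^+ 2 != 0 :> R by rewrite s2 oner_eq0.
by apply: (mulfI s20); rewrite -[LHS](W1 _ tb) -[RHS](W2 _ tb) (partials_tensorC _ _ sb).
Qed.

Lemma wpartial_by_parts j f g : Hinfty f -> Hinfty g ->
  \int[leb]_x (wpartial j f x * g x) = - \int[leb]_x (f x * wpartial j g x).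
Proof. by move=> Hf Hg; apply: taylor_by_parts; exact: taylor_wpartial. Qed.

Lemma Hinfty_integrableM f g : Hinfty f -> Hinfty g ->
  leb.-integrable setT (fun x => (f x * g x)%:E).
Proof. by move=> Hf Hg; apply: Lfun2_integrableM; exact: Hinfty_Lfun2. Qed.

End weak_calculus.

(** * Transport of half-densities *)

Section transport.
Context {R : realType} {n : nat}.
Local Notation E := 'rV[R]_n.
Local Notation leb := (@lebesgue_row R n).
Implicit Types (f g u : E -> R) (v w : E -> E) (j k : 'I_n) (c : R).

(** Minus the Lie derivative along [v] of the half-density with coefficient
    [u]. *)
Definition transport v u : E -> R := fun x =>
  - (1 / 2) * (u x * div v x) - \sum_j wpartial j u x * v x ord0 j.

Lemma ae_forall_ord (P : 'I_n -> E -> Prop) :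
  (forall j, {ae leb, forall x, P j x}) -> {ae leb, forall x, forall j, P j x}.
Proof. exact: filter_forall. Qed.

Lemma ae_and (P Q : E -> Prop) : {ae leb, forall x, P x} -> {ae leb, forall x, Q x} ->
  {ae leb, forall x, P x /\ Q x}.
Proof. exact: filterI. Qed.

Lemma Hinfty_div v : HinftyV v -> Hinfty (div v).
Proof. by move=> Hv; apply: Hinfty_sum => j; exact: Hinfty_wpartial (Hv j). Qed.

Lemma Hinfty_flow v u : HinftyV v -> Hinfty u ->
  Hinfty (fun x => \sum_j wpartial j u x * v x ord0 j).
Proof.
by move=> Hv Hu; apply: Hinfty_sum => j; apply: HinftyM (Hv j); exact: Hinfty_wpartial.
Qed.

Lemma Hinfty_transport v u : HinftyV v -> Hinfty u -> Hinfty (transport v u).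
Proof.
move=> Hv Hu; apply: HinftyB; last exact: Hinfty_flow.
by apply: HinftyZ; apply: HinftyM => //; exact: Hinfty_div.
Qed.

Lemma transport_lin v c f g : Hinfty f -> Hinfty g ->
  transport v (fun x => c * f x + g x) = (fun x => c * transport v f x + transport v g x)
    %[ae leb].
Proof.
move=> Hf Hg.
have : {ae leb, forall x j, wpartial j (fun x => c * f x + g x) x =
    c * wpartial j f x + wpartial j g x}.
  apply: ae_forall_ord => j.
  apply: filterS2 (wpartialD j (HinftyZ c Hf) Hg) (wpartialZ j c Hf) => x.
  by move=> /(_ I) -> /(_ I) ->.
apply: filterS => x D _; rewrite /transport.
under eq_bigr do rewrite D mulrDl -mulrA.
by rewrite big_split/= -mulr_sumr; ring.
Qed.

Lemma div_lin c v w : HinftyV v -> HinftyV w ->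
  div (fun x => c *: v x + w x) = (fun x => c * div v x + div w x) %[ae leb].
Proof.
move=> Hv Hw.
have : {ae leb, forall x j, wpartial j (fun y => (c *: v y + w y) ord0 j) x =
    c * wpartial j (fun y => v y ord0 j) x + wpartial j (fun y => w y ord0 j) x}.
  apply: ae_forall_ord => j.
  apply: filterS2 (wpartialD j (HinftyZ c (Hv j)) (Hw j)) (wpartialZ j c (Hv j)) => x.
  move=> /(_ I) E1 /(_ I) E2; rewrite -E2 -E1; congr (wpartial _ _ _).
  by apply/funext => y; rewrite !mxE.
apply: filterS => x D _; rewrite /div; under eq_bigr do rewrite D.
by rewrite big_split/= -mulr_sumr.
Qed.

Lemma transportM v f g : Hinfty f -> Hinfty g ->
  transport v (fun x => f x * g x) =
  (fun x => f x * transport v g x - (\sum_j wpartial j f x * v x ord0 j) * g x) %[ae leb].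
Proof.
move=> Hf Hg.
have : {ae leb, forall x j, wpartial j (fun x => f x * g x) x =
    wpartial j f x * g x + f x * wpartial j g x}.
  by apply: ae_forall_ord => j; apply: filterS (wpartialM j Hf Hg) => x /(_ I).
apply: filterS => x D _; rewrite /transport.
rewrite (eq_bigr (fun j => wpartial j f x * v x ord0 j * g x +
    f x * (wpartial j g x * v x ord0 j))); last by move=> j _; rewrite D; ring.
by rewrite big_split/= -mulr_suml -mulr_sumr; ring.
Qed.

(** The product of two half-densities is a density, and the integral of a
    density is preserved by a flow. Infinitesimally, [f * transport v g +
    transport v f * g] is minus the divergence of the field [f * g * v]. *)
Lemma transport_skew v f g : HinftyV v -> Hinfty f -> Hinfty g ->
  \int[leb]_x (f x * transport v g x) = - \int[leb]_x (transport v f x * g x).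
Proof.
move=> Hv Hf Hg.
have Hd := Hinfty_div Hv; have HTf := Hinfty_transport Hv Hf.
have HTg := Hinfty_transport Hv Hg.
have Hvf j : Hinfty (fun x => v x ord0 j * f x) by exact: HinftyM (Hv j) Hf.
have Hvg j : Hinfty (fun x => v x ord0 j * g x) by exact: HinftyM (Hv j) Hg.
have by_parts j : \int[leb]_x (wpartial j (fun x => v x ord0 j * f x) x * g x +
    v x ord0 j * f x * wpartial j g x) = 0.
  rewrite RintegralD//.
  - by rewrite wpartial_by_parts// addNr.
  - by apply: Hinfty_integrableM => //; exact: Hinfty_wpartial.
  - by apply: Hinfty_integrableM => //; exact: Hinfty_wpartial.
have integrable_part j : leb.-integrable setT (fun x =>
    (wpartial j (fun x => v x ord0 j * f x) x * g x + v x ord0 j * f x * wpartial j g x)%:E).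
  have i1 := Hinfty_integrableM (Hinfty_wpartial j (Hvf j)) Hg.
  have i2 := Hinfty_integrableM (Hvf j) (Hinfty_wpartial j Hg).
  exact: (integrableD measurableT i1 i2).
have sum0 : \int[leb]_x (\sum_j (wpartial j (fun x => v x ord0 j * f x) x * g x +
    v x ord0 j * f x * wpartial j g x)) = 0 /\ leb.-integrable setT (fun x =>
    (\sum_j (wpartial j (fun x => v x ord0 j * f x) x * g x +
    v x ord0 j * f x * wpartial j g x))%:E).
  elim: (index_enum _) => [|j r [IH1 IH2]].
    split; first by under eq_Rintegral do rewrite big_nil; rewrite Rintegral_cst// mul0r.
    by under eq_fun do rewrite big_nil; exact: integrable0.
  split.
    under eq_Rintegral do rewrite big_cons.
    by rewrite (RintegralD measurableT (integrable_part j) IH2) by_parts IH1 addr0.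
  under eq_fun do rewrite big_cons.
  exact: (integrableD measurableT (integrable_part j) IH2).
have i1 := Hinfty_integrableM HTf Hg; have i2 := Hinfty_integrableM Hf HTg.
apply/eqP; rewrite -subr_eq0 opprK -RintegralD//; apply/eqP.
rewrite -[RHS]oppr0 -[in RHS]sum0.1 -mulN1r -RintegralZl//; last by have [] := sum0.
apply: ae_eq_Rintegral.
- by apply: measurable_funD; apply: measurable_funM; exact: Hinfty_measurable.
- apply: measurable_funM => //; apply/measurable_EFinP; exact: measurable_int sum0.2.
have : {ae leb, forall x j, wpartial j (fun x => v x ord0 j * f x) x =
    wpartial j (fun x => v x ord0 j) x * f x + v x ord0 j * wpartial j f x}.
  by apply: ae_forall_ord => j; apply: filterS (wpartialM j (Hv j) Hf) => x /(_ I).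
apply: filterS => x D _; rewrite /transport /div.
rewrite [X in _ = _ * X](eq_bigr (fun j => f x * g x * wpartial j (fun x => v x ord0 j) x +
    (wpartial j f x * v x ord0 j * g x + f x * (wpartial j g x * v x ord0 j)))); last first.
  by move=> j _; rewrite D; ring.
by rewrite !big_split/= -mulr_suml -!mulr_sumr; field.
Qed.

(** The values at a point entering the commutator of two transports: [F] and
    [FF] are the first and second derivatives of the half-density [f], [V] and
    [W] the components of the fields, [dV j k] the [j]-th derivative of [V k],
    and [DV] the gradient of the divergence [dv]. Second derivatives of [f]
    cancel by symmetry of the Hessian. *)
Lemma transport_bracket_algebra (V W F DV DW : 'I_n -> R) (dV dW FF : 'I_n -> 'I_n -> R)
    (f dv dw : R) : (forall j k, FF j k = FF k j) ->
  let T U d := - (1 / 2) * (f * d) - \sum_k F k * U k in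
  let DT U d D dU j := - (1 / 2) * (F j * d + f * D j) -
    \sum_k (FF j k * U k + F k * dU j k) in
  (- (1 / 2) * (T W dw * dv) - \sum_j DT W dw DW dW j * V j) -
  (- (1 / 2) * (T V dv * dw) - \sum_j DT V dv DV dV j * W j) =
  - (1 / 2) * (f * (\sum_j W j * DV j - \sum_j V j * DW j)) -
  \sum_k F k * (\sum_j (W j * dV j k - V j * dW j k)).
Proof.
move=> FFC T DT.
have DTE U d D dU Z : \sum_j DT U d D dU j * Z j =
    - (1 / 2) * (d * \sum_j F j * Z j + f * \sum_j Z j * D j)
    - (\sum_j \sum_k FF j k * U k * Z j + \sum_k F k * \sum_j Z j * dU j k).
  transitivity (\sum_j (- (1 / 2) * d * (F j * Z j) + - (1 / 2) * f * (Z j * D j) +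
      - 1 * (\sum_k FF j k * U k * Z j) + - 1 * \sum_k F k * (Z j * dU j k))).
    apply: eq_bigr => j _; rewrite /DT mulrBl mulr_suml.
    rewrite (eq_bigr (fun k => FF j k * U k * Z j + F k * (Z j * dU j k))); last first.
      by move=> k _; ring.
    by rewrite big_split/=; ring.
  rewrite !big_split/= -!mulr_sumr [\sum_i \sum_k F k * _]exchange_big/=.
  rewrite [\sum_j \sum_i F j * _](eq_bigr (fun k => F k * \sum_j Z j * dU j k)); last first.
    by move=> k _; rewrite mulr_sumr.
  by ring.
have swap : \sum_j \sum_k FF j k * W k * V j = \sum_j \sum_k FF j k * V k * W j.
  rewrite exchange_big; apply: eq_bigr => j _; apply: eq_bigr => k _.
  by rewrite FFC; ring.
rewrite !DTE swap /T.
under [X in _ = _ - X]eq_bigr do rewrite sumrB mulrBr.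
by rewrite sumrB; field.
Qed.

(** The terms quadratic in the first derivatives [dV] and [dW] cancel on
    exchanging the indices. Here [ddV k j] is the mixed derivative, along [k]
    and [j], of the component [k]. *)
Lemma div_bracket_algebra (V W : 'I_n -> R) (dV dW ddV ddW : 'I_n -> 'I_n -> R) :
  \sum_k \sum_j (dW k j * dV j k + W j * ddV k j - (dV k j * dW j k + V j * ddW k j)) =
  \sum_j W j * (\sum_k ddV k j) - \sum_j V j * (\sum_k ddW k j).
Proof.
transitivity ((\sum_k \sum_j dW k j * dV j k - \sum_k \sum_j dV k j * dW j k) +
    (\sum_k \sum_j W j * ddV k j - \sum_k \sum_j V j * ddW k j)).
  rewrite -!sumrB -big_split; apply: eq_bigr => k _.
  by rewrite -!sumrB -big_split; apply: eq_bigr => j _ /=; ring.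
have -> : \sum_k \sum_j dW k j * dV j k = \sum_k \sum_j dV k j * dW j k.
  by rewrite exchange_big; apply: eq_bigr => j _; apply: eq_bigr => k _; rewrite mulrC.
rewrite subrr add0r exchange_big [X in _ - X]exchange_big/=.
by congr (_ - _); apply: eq_bigr => j _; rewrite mulr_sumr.
Qed.

(** The vector part of the bracket of the semidirect product. *)
Definition vbracket v w : E -> E := fun x => \row_j \sum_k
  (w x ord0 k * wpartial k (fun y => v y ord0 j) x -
   v x ord0 k * wpartial k (fun y => w y ord0 j) x).

Lemma vbracketE v w j : (fun x => vbracket v w x ord0 j) = fun x => \sum_k
  (w x ord0 k * wpartial k (fun y => v y ord0 j) x -
   v x ord0 k * wpartial k (fun y => w y ord0 j) x).
Proof. by apply/funext => x; rewrite mxE. Qed.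

Lemma Hinfty_vbracket v w : HinftyV v -> HinftyV w -> HinftyV (vbracket v w).
Proof.
move=> Hv Hw j; rewrite vbracketE; apply: Hinfty_sum => k.
by apply: HinftyB; apply: HinftyM => //; exact: Hinfty_wpartial.
Qed.

Lemma div_vbracket v w : HinftyV v -> HinftyV w ->
  div (vbracket v w) = (fun x => \sum_j w x ord0 j * wpartial j (div v) x -
    \sum_j v x ord0 j * wpartial j (div w) x) %[ae leb].
Proof.
move=> Hv Hw.
have D2 z : HinftyV z -> {ae leb, forall x, forall j, wpartial j (div z) x =
    \sum_k wpartial k (wpartial j (fun y => z y ord0 k)) x}.
  move=> Hz; apply: ae_forall_ord => j.
  have C : {ae leb, forall x, forall k, wpartial j (wpartial k (fun y => z y ord0 k)) x =
      wpartial k (wpartial j (fun y => z y ord0 k)) x}.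
    by apply: ae_forall_ord => k; apply: filterS (wpartialC j k (Hz k)) => x /(_ I).
  have S := wpartial_sum j (index_enum 'I_n) (fun k => Hinfty_wpartial k (Hz k)).
  apply: filterS2 C S => x C /(_ I) S.
  by rewrite -[LHS]/(wpartial j (fun x => \sum_k _) x) S; apply: eq_bigr => k _.
have M2 z z' : HinftyV z -> HinftyV z' -> {ae leb, forall x, forall k j,
    wpartial k (fun y => z y ord0 j * wpartial j (fun y => z' y ord0 k) y) x =
    wpartial k (fun y => z y ord0 j) x * wpartial j (fun y => z' y ord0 k) x +
    z x ord0 j * wpartial k (wpartial j (fun y => z' y ord0 k)) x}.
  move=> Hz Hz'; apply: ae_forall_ord => k; apply: ae_forall_ord => j.
  by apply: filterS (wpartialM k (Hz j) (Hinfty_wpartial j (Hz' k))) => x /(_ I).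
have Hterm (z z' : E -> E) j k : HinftyV z -> HinftyV z' ->
    Hinfty (fun y => z y ord0 j * wpartial j (fun y => z' y ord0 k) y).
  by move=> Hz Hz'; apply: HinftyM => //; exact: Hinfty_wpartial.
have B2 : {ae leb, forall x, forall k, wpartial k (fun y => vbracket v w y ord0 k) x =
    \sum_j (wpartial k (fun y => w y ord0 j * wpartial j (fun y => v y ord0 k) y) x -
            wpartial k (fun y => v y ord0 j * wpartial j (fun y => w y ord0 k) y) x)}.
  apply: ae_forall_ord => k.
  have B j : Hinfty (fun y => w y ord0 j * wpartial j (fun y => v y ord0 k) y -
      v y ord0 j * wpartial j (fun y => w y ord0 k) y).
    by apply: HinftyB; exact: Hterm.
  have S := wpartial_sum k (index_enum 'I_n) B.
  have D : {ae leb, forall x, forall j, wpartial k (fun y =>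
      w y ord0 j * wpartial j (fun y => v y ord0 k) y -
      v y ord0 j * wpartial j (fun y => w y ord0 k) y) x =
      wpartial k (fun y => w y ord0 j * wpartial j (fun y => v y ord0 k) y) x -
      wpartial k (fun y => v y ord0 j * wpartial j (fun y => w y ord0 k) y) x}.
    apply: ae_forall_ord => j.
    have := wpartialB k (Hterm w v j k Hw Hv) (Hterm v w j k Hv Hw).
    by apply: filterS => x /(_ I).
  apply: filterS2 S D => x /(_ I) S D.
  by rewrite vbracketE S; apply: eq_bigr => j _; exact: D.
have DD := ae_and (D2 v Hv) (D2 w Hw).
have MM := ae_and (M2 w v Hw Hv) (M2 v w Hv Hw).
have := ae_and B2 (ae_and DD MM).
apply: filterS => x [B [[Dv Dw] [Mw Mv]]] _.
rewrite -[LHS]/(\sum_k wpartial k (fun y => vbracket v w y ord0 k) x).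
rewrite (eq_bigr (fun k => \sum_j (
    wpartial k (fun y => w y ord0 j) x * wpartial j (fun y => v y ord0 k) x +
    w x ord0 j * wpartial k (wpartial j (fun y => v y ord0 k)) x -
    (wpartial k (fun y => v y ord0 j) x * wpartial j (fun y => w y ord0 k) x +
    v x ord0 j * wpartial k (wpartial j (fun y => w y ord0 k)) x)))); last first.
  by move=> k _; rewrite B; apply: eq_bigr => j _; rewrite Mw Mv.
under [X in _ = X - _]eq_bigr do rewrite Dv.
under [X in _ = _ - X]eq_bigr do rewrite Dw.
exact: (@div_bracket_algebra (fun k => v x ord0 k) (fun k => w x ord0 k)
  (fun k j => wpartial k (fun y => v y ord0 j) x) (fun k j => wpartial k (fun y => w y ord0 j) x)
  (fun k j => wpartial k (wpartial j (fun y => v y ord0 k)) x)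
  (fun k j => wpartial k (wpartial j (fun y => w y ord0 k)) x)).
Qed.

(** Half-densities carry a representation of the Lie algebra of vector fields.
    At each point this is [transport_bracket_algebra], once the product rule
    and the commutation of derivatives have been applied. *)
Lemma transport_vbracket v w f : HinftyV v -> HinftyV w -> Hinfty f ->
  transport (vbracket v w) f =
  (fun x => transport v (transport w f) x - transport w (transport v f) x) %[ae leb].
Proof.
move=> Hv Hw Hf.
have DT z : HinftyV z -> {ae leb, forall x, forall j, wpartial j (transport z f) x =
    - (1 / 2) * (wpartial j f x * div z x + f x * wpartial j (div z) x) -
    \sum_k (wpartial j (wpartial k f) x * z x ord0 k +
      wpartial k f x * wpartial j (fun y => z y ord0 k) x)}.
  move=> Hz; have Hd := Hinfty_div Hz.
  apply: ae_forall_ord => j.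
  have B := wpartialB j (HinftyZ (- (1 / 2)) (HinftyM Hf Hd)) (Hinfty_flow Hz Hf).
  have Z := wpartialZ j (- (1 / 2)) (HinftyM Hf Hd).
  have M := wpartialM j Hf Hd.
  have S := wpartial_sum j (index_enum 'I_n)
    (fun k => HinftyM (Hinfty_wpartial k Hf) (Hz k)).
  have MS : {ae leb, forall x, forall k, wpartial j (fun x => wpartial k f x * z x ord0 k) x =
      wpartial j (wpartial k f) x * z x ord0 k +
      wpartial k f x * wpartial j (fun y => z y ord0 k) x}.
    apply: ae_forall_ord => k.
    by apply: filterS (wpartialM j (Hinfty_wpartial k Hf) (Hz k)) => x /(_ I).
  have BZ := ae_and B Z; have SM := ae_and S MS.
  have := ae_and M (ae_and BZ SM).
  apply: filterS => x [/(_ I) M1 [[/(_ I) B1 /(_ I) Z1] [/(_ I) S1 M2]]].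
  rewrite -[LHS]/(wpartial j (fun x => - (1 / 2) * (f x * div z x) - \sum_k _) x).
  by rewrite B1 Z1 M1 S1; congr (_ - _); apply: eq_bigr => k _.
have C : {ae leb, forall x, forall j k, wpartial j (wpartial k f) x =
    wpartial k (wpartial j f) x}.
  apply: ae_forall_ord => j; apply: ae_forall_ord => k.
  by apply: filterS (wpartialC j k Hf) => x /(_ I).
have DD := ae_and (DT v Hv) (DT w Hw).
have := ae_and (div_vbracket Hv Hw) (ae_and C DD).
apply: filterS => x [/(_ I) dB [FC [Tv Tw]]] _.
rewrite {1}/transport dB; apply/esym.
rewrite {1}/transport [transport w (transport v f) x]/transport.
under eq_bigr do rewrite Tw.
under [X in _ - (_ - X) = _]eq_bigr do rewrite Tv.
under [X in _ = _ - X]eq_bigr do rewrite mxE.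
exact: (@transport_bracket_algebra (fun k => v x ord0 k) (fun k => w x ord0 k)
  (fun k => wpartial k f x) (fun j => wpartial j (div v) x) (fun j => wpartial j (div w) x)
  (fun j k => wpartial j (fun y => v y ord0 k) x) (fun j k => wpartial j (fun y => w y ord0 k) x)
  (fun j k => wpartial j (wpartial k f) x) (f x) (div v x) (div w x) FC).
Qed.

End transport.

Local Open Scope complex_scope.

(** * The action on wave functions *)

Section complex_parts.
Context {R : realType}.
Implicit Types (z w : R[i]) (a : R).

Lemma complexP z w : complex.Re z = complex.Re w -> complex.Im z = complex.Im w -> z = w.
Proof. by case: z w => [a b] [c d] /= -> ->. Qed.

Lemma cReD z w : complex.Re (z + w) = complex.Re z + complex.Re w.
Proof. by case: z w => [a b] [c d]. Qed.

Lemma cImD z w : complex.Im (z + w) = complex.Im z + complex.Im w.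
Proof. by case: z w => [a b] [c d]. Qed.

Lemma cReN z : complex.Re (- z) = - complex.Re z.
Proof. by case: z. Qed.

Lemma cImN z : complex.Im (- z) = - complex.Im z.
Proof. by case: z. Qed.

Lemma cReM z w :
  complex.Re (z * w) = complex.Re z * complex.Re w - complex.Im z * complex.Im w.
Proof. by case: z w => [a b] [c d]. Qed.

Lemma cImM z w :
  complex.Im (z * w) = complex.Re z * complex.Im w + complex.Im z * complex.Re w.
Proof. by case: z w => [a b] [c d]. Qed.

Lemma cRe_sum I (r : seq I) (F : I -> R[i]) :
  complex.Re (\sum_(i <- r) F i) = \sum_(i <- r) complex.Re (F i).
Proof. by elim: r => [|i r IH]; rewrite ?big_nil// !big_cons cReD IH. Qed.

Lemma cIm_sum I (r : seq I) (F : I -> R[i]) :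
  complex.Im (\sum_(i <- r) F i) = \sum_(i <- r) complex.Im (F i).
Proof. by elim: r => [|i r IH]; rewrite ?big_nil// !big_cons cImD IH. Qed.

Lemma cReJ z : complex.Re (conjc z) = complex.Re z.
Proof. by case: z. Qed.

Lemma cImJ z : complex.Im (conjc z) = - complex.Im z.
Proof. by case: z. Qed.

Lemma half_complex : 1 / 2 = (1 / 2)%:C :> R[i].
Proof. by rewrite rmorphM fmorphV rmorph1 rmorph_nat. Qed.

Lemma two_complex : 2 = 2%:C :> R[i].
Proof. by rewrite rmorph_nat. Qed.

Lemma cReC a : complex.Re a%:C = a. Proof. by []. Qed.

Lemma cImC a : complex.Im a%:C = 0 :> R. Proof. by []. Qed.

Lemma cRe_iM z : complex.Re ('i * z) = - complex.Im z.
Proof. by case: z => a b /=; rewrite mul0r mul1r sub0r. Qed.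

Lemma cIm_iM z : complex.Im ('i * z) = complex.Re z.
Proof. by case: z => a b /=; rewrite mul0r mul1r add0r. Qed.

Lemma cReB z w : complex.Re (z - w) = complex.Re z - complex.Re w.
Proof. by rewrite cReD cReN. Qed.

Lemma cImB z w : complex.Im (z - w) = complex.Im z - complex.Im w.
Proof. by rewrite cImD cImN. Qed.

Lemma cRe_lin a z w : complex.Re (a%:C * z + w) = a * complex.Re z + complex.Re w.
Proof. by rewrite cReD cReM cReC cImC mul0r subr0. Qed.

Lemma cIm_lin a z w : complex.Im (a%:C * z + w) = a * complex.Im z + complex.Im w.
Proof. by rewrite cImD cImM cReC cImC mul0r addr0. Qed.

Definition partsE := (cReD, cImD, cReN, cImN, cRe_iM, cIm_iM, cReM, cImM, cRe_sum, cIm_sum, cReJ, cImJ, cReC, cImC).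

End complex_parts.

Section madelung.
Context {R : realType} {n : nat}.
Local Notation E := 'rV[R]_n.
Local Notation C := R[i].
Local Notation leb := (@lebesgue_row R n).
Implicit Types (psi phi chi : E -> C) (v w : E -> E) (alpha beta : E -> R) (j k : 'I_n).

Local Notation re psi := (fun x => complex.Re (psi x)).
Local Notation im psi := (fun x => complex.Im (psi x)).

(** On real and imaginary parts the action is the real operator [transport v],
    to which [alpha] adds an infinitesimal rotation of the phase. *)
Lemma Re_xi_Psi v alpha psi x : complex.Re (xi_Psi (v, alpha) psi x) =
  transport v (re psi) x + alpha x * complex.Im (psi x).
Proof.
rewrite /xi_Psi half_complex -['i * _ * _]mulrA !partsE /transport.
rewrite (eq_bigr (fun j => wpartial j (re psi) x * v x ord0 j)); first by ring.
by move=> j _; rewrite !partsE mulr0 subr0.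
Qed.

Lemma Im_xi_Psi v alpha psi x : complex.Im (xi_Psi (v, alpha) psi x) =
  transport v (im psi) x - alpha x * complex.Re (psi x).
Proof.
rewrite /xi_Psi half_complex -['i * _ * _]mulrA !partsE /transport.
rewrite (eq_bigr (fun j => wpartial j (im psi) x * v x ord0 j)); first by ring.
by move=> j _; rewrite !partsE mulr0 add0r.
Qed.

Lemma re_xi_Psi v alpha psi : re (xi_Psi (v, alpha) psi) =
  (fun x => transport v (re psi) x + alpha x * complex.Im (psi x)).
Proof. by apply/funext => x; exact: Re_xi_Psi. Qed.

Lemma im_xi_Psi v alpha psi : im (xi_Psi (v, alpha) psi) =
  (fun x => transport v (im psi) x - alpha x * complex.Re (psi x)).
Proof. by apply/funext => x; exact: Im_xi_Psi. Qed.

Lemma Psi_xi_Psi v alpha psi : HinftyV v -> Hinfty alpha -> Psi psi ->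
  Psi (xi_Psi (v, alpha) psi).
Proof.
move=> Hv Ha [Hr Hi]; split.
  by rewrite re_xi_Psi; apply: HinftyD; [exact: Hinfty_transport|exact: HinftyM].
by rewrite im_xi_Psi; apply: HinftyB; [exact: Hinfty_transport|exact: HinftyM].
Qed.

Lemma re_lin (a : R) psi phi : re (fun x => a%:C * psi x + phi x) =
  (fun x => a * complex.Re (psi x) + complex.Re (phi x)).
Proof. by apply/funext => x; rewrite cRe_lin. Qed.

Lemma im_lin (a : R) psi phi : im (fun x => a%:C * psi x + phi x) =
  (fun x => a * complex.Im (psi x) + complex.Im (phi x)).
Proof. by apply/funext => x; rewrite cIm_lin. Qed.

Lemma Psi_lin (a : R) psi phi : Psi psi -> Psi phi -> Psi (fun x => a%:C * psi x + phi x).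
Proof.
move=> [Hr Hi] [Kr Ki]; split; first by rewrite re_lin; apply: HinftyD => //; exact: HinftyZ.
by rewrite im_lin; apply: HinftyD => //; exact: HinftyZ.
Qed.

Lemma xi_Psi_linear (v : E -> E) alpha (a : R) psi phi : HinftyV v -> Psi psi -> Psi phi ->
  xi_Psi (v, alpha) (fun x => a%:C * psi x + phi x) =
  (fun x => a%:C * xi_Psi (v, alpha) psi x + xi_Psi (v, alpha) phi x) %[ae leb].
Proof.
move=> Hv [Hr Hi] [Kr Ki].
apply: filterS2 (transport_lin v a Hr Kr) (transport_lin v a Hi Ki) => x /(_ I) Er /(_ I) Ei _.
apply: complexP.
  by rewrite [RHS]cRe_lin !Re_xi_Psi re_lin Er cIm_lin; ring.
by rewrite [RHS]cIm_lin !Im_xi_Psi im_lin Ei cRe_lin; ring.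
Qed.

Lemma xi_Psi_additive (a : R) (xi eta : @salg_carrier R n) psi : salg xi -> salg eta ->
  xi_Psi (a *: xi + eta) psi = (fun x => a%:C * xi_Psi xi psi x + xi_Psi eta psi x) %[ae leb].
Proof.
case: xi eta => [v alpha] [w beta] [/= Hv Ha] [/= Hw Hb].
apply: filterS (div_lin a Hv Hw) => x /(_ I) D _.
have T f : transport (fun x => a *: v x + w x) f x = a * transport v f x + transport w f x.
  rewrite /transport D (eq_bigr (fun j => a * (wpartial j f x * v x ord0 j) +
    wpartial j f x * w x ord0 j)); last by move=> j _; rewrite !mxE; ring.
  by rewrite big_split/= -mulr_sumr; ring.
rewrite -[LHS]/(xi_Psi (fun x => a *: v x + w x, fun x => a * alpha x + beta x) psi x).
apply: complexP.
  by rewrite [RHS]cRe_lin !Re_xi_Psi T; ring.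
by rewrite [RHS]cIm_lin !Im_xi_Psi T; ring.
Qed.

Lemma salg_bracketE v alpha w beta : salg_bracket (v, alpha) (w, beta) =
  (vbracket v w, fun x => \sum_k (w x ord0 k * wpartial k alpha x -
    v x ord0 k * wpartial k beta x)).
Proof. by []. Qed.

Lemma salg_bracket_closed (xi eta : @salg_carrier R n) : salg xi -> salg eta ->
  salg (salg_bracket xi eta).
Proof.
case: xi eta => [v alpha] [w beta] [Hv Ha] [Hw Hb].
rewrite salg_bracketE; split; first exact: Hinfty_vbracket.
apply: Hinfty_sum => k; apply: HinftyB; apply: HinftyM; try exact: Hinfty_wpartial.
  exact: Hw.
exact: Hv.
Qed.

(** The vector parts are handled by [transport_vbracket]; [alpha] and [beta],
    as multipliers, are only differentiated by transports, and their rotations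
    commute with each other. *)
Lemma xi_Psi_bracket v w alpha beta psi : HinftyV v -> HinftyV w ->
  Hinfty alpha -> Hinfty beta -> Psi psi ->
  xi_Psi (salg_bracket (v, alpha) (w, beta)) psi =
  (fun x => xi_Psi (v, alpha) (xi_Psi (w, beta) psi) x -
            xi_Psi (w, beta) (xi_Psi (v, alpha) psi) x) %[ae leb].
Proof.
move=> Hv Hw Ha Hb [Hr Hi]; rewrite salg_bracketE.
(* the real and imaginary parts of a function acted upon once, acted upon again *)
have again (v1 v2 : E -> E) (c : R) (b f g : E -> R) : HinftyV v1 -> HinftyV v2 ->
    Hinfty b -> Hinfty f -> Hinfty g ->
    {ae leb, forall x, transport v1 (fun x => transport v2 f x + c * (b x * g x)) x =
      transport v1 (transport v2 f) x +
      c * (b x * transport v1 g x - (\sum_j wpartial j b x * v1 x ord0 j) * g x)}.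
  move=> Hv1 Hv2 Hb' Hf Hg.
  have L := transport_lin v1 c (HinftyM Hb' Hg) (Hinfty_transport Hv2 Hf).
  apply: filterS2 L (transportM v1 Hb' Hg) => x /(_ I) L1 /(_ I) <-.
  rewrite addrC -L1; congr (transport _ _ _).
  by apply/funext => y; rewrite addrC.
have A1 := ae_and (again v w 1 beta _ _ Hv Hw Hb Hr Hi) (again v w (-1) beta _ _ Hv Hw Hb Hi Hr).
have A2 := ae_and (again w v 1 alpha _ _ Hw Hv Ha Hr Hi) (again w v (-1) alpha _ _ Hw Hv Ha Hi Hr).
have B := ae_and (transport_vbracket Hv Hw Hr) (transport_vbracket Hv Hw Hi).
have := ae_and B (ae_and A1 A2); apply: filterS.
move=> x [[/(_ I) Br /(_ I) Bi] [[A1r A1i] [A2r A2i]]] _.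
have plus (f g : E -> R) : (fun x => f x + g x) = (fun x => f x + 1 * g x).
  by apply/funext => y; rewrite mul1r.
have minus (f g : E -> R) : (fun x => f x - g x) = (fun x => f x + -1 * g x).
  by apply/funext => y; rewrite mulN1r.
have G : \sum_k (w x ord0 k * wpartial k alpha x - v x ord0 k * wpartial k beta x) =
    \sum_k wpartial k alpha x * w x ord0 k - \sum_k wpartial k beta x * v x ord0 k.
  by rewrite -sumrB; apply: eq_bigr => k _; ring.
apply: complexP.
  rewrite [RHS]cReB !Re_xi_Psi Br G !re_xi_Psi !Im_xi_Psi.
  rewrite (plus (transport w _)) (plus (transport v _)) A1r A2r; ring.
rewrite [RHS]cImB !Im_xi_Psi Bi G !im_xi_Psi !Re_xi_Psi.
rewrite (minus (transport w _)) (minus (transport v _)) A1i A2i; ring.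
Qed.

End madelung.

(** * The Madelung transform as a momentum map *)

Section gradients.
Context {R : realType} {n : nat}.
Local Notation E := 'rV[R]_n.
Local Notation leb := (@lebesgue_row R n).
Implicit Types (psi phi chi g : E -> R[i]) (v w : E -> E) (alpha : E -> R).

Local Notation re psi := (fun x => complex.Re (psi x)).
Local Notation im psi := (fun x => complex.Im (psi x)).

Lemma innerE g phi : inner g phi = \int[leb]_x (complex.Re (g x) * complex.Re (phi x) +
  complex.Im (g x) * complex.Im (phi x)).
Proof. by apply: eq_Rintegral => x _; rewrite cReM cReJ cImJ mulNr opprK. Qed.

(** The difference of two gradients is itself an admissible direction, and it
    is orthogonal to itself. *)
Lemma has_gradient_unique (F : (E -> R[i]) -> R) psi g g' :
  has_gradient F psi g -> has_gradient F psi g' -> g = g' %[ae leb].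
Proof.
move=> [Hg gF] [Hg' g'F].
pose phi := fun x => (-1)%:C * g' x + g x.
have Hphi : Psi phi by exact: Psi_lin.
have re_phi x : complex.Re (phi x) = complex.Re (g x) - complex.Re (g' x).
  by rewrite cRe_lin mulN1r addrC.
have im_phi x : complex.Im (phi x) = complex.Im (g x) - complex.Im (g' x).
  by rewrite cIm_lin mulN1r addrC.
have [Hr Hi] := Hphi; have [Gr Gi] := Hg; have [Gr' Gi'] := Hg'.
have same : inner g phi = inner g' phi.
  by have [_ <-] := gF _ Hphi; have [_ <-] := g'F _ Hphi.
have ir := Hinfty_integrableM Hr Hr; have ii := Hinfty_integrableM Hi Hi.
have sum0 : \int[leb]_x (complex.Re (phi x) * complex.Re (phi x)) +
    \int[leb]_x (complex.Im (phi x) * complex.Im (phi x)) = 0.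
  rewrite -RintegralD//; move/eqP: same; rewrite -subr_eq0 !innerE -RintegralB//; first last.
  - have i1 := Hinfty_integrableM Gr' Hr; have i2 := Hinfty_integrableM Gi' Hi.
    exact: (integrableD measurableT i1 i2).
  - have i1 := Hinfty_integrableM Gr Hr; have i2 := Hinfty_integrableM Gi Hi.
    exact: (integrableD measurableT i1 i2).
  by move=> /eqP <-; apply: eq_Rintegral => x _; rewrite re_phi im_phi; ring.
have r0 : 0 <= \int[leb]_x (complex.Re (phi x) * complex.Re (phi x)).
  by apply: Rintegral_ge0 => x _; rewrite -expr2 sqr_ge0.
have i0 : 0 <= \int[leb]_x (complex.Im (phi x) * complex.Im (phi x)).
  by apply: Rintegral_ge0 => x _; rewrite -expr2 sqr_ge0.
have zr := @Lfun2_sqr_eq0 _ _ _ leb _ (Hinfty_Lfun2 Hr).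
have zi := @Lfun2_sqr_eq0 _ _ _ leb _ (Hinfty_Lfun2 Hi).
have zr0 : re phi = cst 0 %[ae leb] by apply: zr; lra.
have zi0 : im phi = cst 0 %[ae leb] by apply: zi; lra.
apply: filterS2 zr0 zi0 => x /(_ I) /= Er /(_ I) /= Ei _.
by apply: complexP; apply/subr0_eq; rewrite -?re_phi -?im_phi.
Qed.

Lemma gradientP (F : (E -> R[i]) -> R) psi : (exists g, has_gradient F psi g) ->
  has_gradient F psi (gradient F psi).
Proof. by move=> [g Fg]; exact: (@xgetPex _ (fun=> 0) [set g | has_gradient F psi g] (ex_intro _ g Fg)). Qed.

Lemma is_derive_quadratic (a b c : R) : is_derive (0 : R) (1 : R) (fun e : R => a + e * b + e ^+ 2 * c) b.
Proof.
have -> : (fun e : R => a + e * b + e ^+ 2 * c) =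
    cst a + (b \*: id) + (c \*: (id * id)) :> (R -> R).
  apply/funext => e; rewrite !fctE/=.
  by rewrite -[b *: e]/(b * e) -[c *: _]/(c * (e * e)); ring.
apply: is_derive_eq.
by rewrite !scale0r addr0 scaler0 addr0 add0r; exact: mulr1.
Qed.

Lemma Rintegral_quadratic (e : R) (a b b' c : E -> R) :
  leb.-integrable setT (EFin \o a) -> leb.-integrable setT (EFin \o b) ->
  leb.-integrable setT (EFin \o b') -> leb.-integrable setT (EFin \o c) ->
  leb.-integrable setT (fun x => (a x + e * (b x + b' x) + e ^+ 2 * c x)%:E) /\
  \int[leb]_x (a x + e * (b x + b' x) + e ^+ 2 * c x) =
  \int[leb]_x a x + e * (\int[leb]_x b x + \int[leb]_x b' x) + e ^+ 2 * \int[leb]_x c x.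
Proof.
move=> ia ib ib' ic.
have ibb : leb.-integrable setT (fun x => (b x + b' x)%:E).
  exact: (integrableD measurableT ib ib').
have ieb : leb.-integrable setT (fun x => (e * (b x + b' x))%:E).
  exact: (integrableZl measurableT e ibb).
have iec : leb.-integrable setT (fun x => (e ^+ 2 * c x)%:E).
  exact: (integrableZl measurableT (e ^+ 2) ic).
have iab : leb.-integrable setT (fun x => (a x + e * (b x + b' x))%:E).
  exact: (integrableD measurableT ia ieb).
split; first exact: (integrableD measurableT iab iec).
rewrite (RintegralD measurableT iab iec) (RintegralD measurableT ia ieb).
by rewrite (RintegralZl _ measurableT ibb) (RintegralZl _ measurableT ic) (RintegralD measurableT ib ib').
Qed.

(** Integrated, this is the bilinear form whose quadratic form is the pairing
    of the Madelung transform with [(v, alpha)]. *)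
Definition madelung_form v alpha psi chi : E -> R := fun x =>
  complex.Re (psi x) * (alpha x * complex.Re (chi x)) +
  complex.Im (psi x) * (alpha x * complex.Im (chi x)) +
  complex.Im (psi x) * transport v (re chi) x -
  complex.Re (psi x) * transport v (im chi) x.

Lemma pairing_madelung v alpha psi :
  pairing (madelung psi) (v, alpha) = \int[leb]_x madelung_form v alpha psi psi x.
Proof.
apply: eq_Rintegral => x _; rewrite /madelung_form /transport.
rewrite (eq_bigr (fun j => complex.Re (psi x) * (wpartial j (im psi) x * v x ord0 j) -
    complex.Im (psi x) * (wpartial j (re psi) x * v x ord0 j))); last first.
  by move=> j _; rewrite mxE cImM cReJ cImJ /=; ring.
rewrite -[(madelung psi).2 x]/(complex.Re (conjc (psi x) * psi x)).
by rewrite sumrB -!mulr_sumr cReM cReJ cImJ /=; ring.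
Qed.

Section fixed_element.
Context (v : E -> E) (alpha : E -> R) (Hv : HinftyV v) (Ha : Hinfty alpha).
Local Notation form := (madelung_form v alpha).

Lemma integrable_madelung_form psi chi : Psi psi -> Psi chi ->
  leb.-integrable setT (EFin \o form psi chi).
Proof.
move=> [Hr Hi] [Kr Ki].
have i1 := Hinfty_integrableM Hr (HinftyM Ha Kr).
have i2 := Hinfty_integrableM Hi (HinftyM Ha Ki).
have i3 := Hinfty_integrableM Hi (Hinfty_transport Hv Kr).
have i4 := Hinfty_integrableM Hr (Hinfty_transport Hv Ki).
exact: (integrableB measurableT (integrableD measurableT (integrableD measurableT i1 i2) i3) i4).
Qed.

(** The form has the multiplication by [alpha] on the diagonal and opposite
    transports off the diagonal: it is symmetric because transport is skew. *)
Lemma madelung_formC psi chi : Psi psi -> Psi chi ->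
  \int[leb]_x form psi chi x = \int[leb]_x form chi psi x.
Proof.
move=> Hpsi Hchi; have [Hr Hi] := Hpsi; have [Kr Ki] := Hchi.
have T u : Hinfty u -> Hinfty (transport v u) by exact: Hinfty_transport.
have i1 := Hinfty_integrableM Hi (T _ Kr); have i2 := Hinfty_integrableM (T _ Hi) Kr.
have i3 := Hinfty_integrableM Hr (T _ Ki); have i4 := Hinfty_integrableM (T _ Hr) Ki.
apply/eqP; rewrite -subr_eq0 -RintegralB//; try exact: integrable_madelung_form.
have -> : \int[leb]_x (form psi chi x - form chi psi x) =
    \int[leb]_x ((complex.Im (psi x) * transport v (re chi) x +
      transport v (im psi) x * complex.Re (chi x)) -
     (complex.Re (psi x) * transport v (im chi) x +
      transport v (re psi) x * complex.Im (chi x))).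
  by apply: eq_Rintegral => x _; rewrite /madelung_form; ring.
rewrite RintegralB//; [|exact: (integrableD measurableT i1 i2)|exact: (integrableD measurableT i3 i4)].
by rewrite !RintegralD// !transport_skew// !addNr subrr.
Qed.

(** The gradient of the quadratic form of a symmetric bilinear form is twice
    the operator representing that form, and this operator is [xi_Psi]
    followed by multiplication by [i]. *)
Lemma has_gradient_pairing psi : Psi psi ->
  has_gradient (fun psi => pairing (madelung psi) (v, alpha)) psi
    (fun x => 2%:C * ('i * xi_Psi (v, alpha) psi x)).
Proof.
move=> Hpsi; have [Hr Hi] := Hpsi; have [Xr Xi] := Psi_xi_Psi Hv Ha Hpsi.
have re_g : re (fun x => 2%:C * ('i * xi_Psi (v, alpha) psi x)) =
    (fun x => 2 * - complex.Im (xi_Psi (v, alpha) psi x)).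
  by apply/funext => x; rewrite cReM cRe_iM cIm_iM cReC cImC mul0r subr0.
have im_g : im (fun x => 2%:C * ('i * xi_Psi (v, alpha) psi x)) =
    (fun x => 2 * complex.Re (xi_Psi (v, alpha) psi x)).
  by apply/funext => x; rewrite cImM cRe_iM cIm_iM cReC cImC mul0r addr0.
split.
  split; first by rewrite re_g; apply: HinftyZ; exact: HinftyN.
  by rewrite im_g; exact: HinftyZ.
move=> phi Hphi; have [Kr Ki] := Hphi.
have -> : inner (fun x => 2%:C * ('i * xi_Psi (v, alpha) psi x)) phi =
    \int[leb]_x form psi phi x + \int[leb]_x form phi psi x.
  rewrite madelung_formC// -RintegralD//; try exact: integrable_madelung_form.
  rewrite innerE; apply: eq_Rintegral => x _.
  rewrite -[complex.Re (2%:C * _)]/(re (fun x => 2%:C * ('i * xi_Psi (v, alpha) psi x)) x) re_g.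
  rewrite -[complex.Im (2%:C * _)]/(im (fun x => 2%:C * ('i * xi_Psi (v, alpha) psi x)) x) im_g.
  by rewrite Re_xi_Psi Im_xi_Psi /madelung_form; ring.
have expand (e : R) : pairing (madelung (fun x => psi x + e%:C * phi x)) (v, alpha) =
    \int[leb]_x form psi psi x + e * (\int[leb]_x form psi phi x + \int[leb]_x form phi psi x)
    + e ^+ 2 * \int[leb]_x form phi phi x.
  have [iq <-] := Rintegral_quadratic e (integrable_madelung_form Hpsi Hpsi)
    (integrable_madelung_form Hpsi Hphi) (integrable_madelung_form Hphi Hpsi)
    (integrable_madelung_form Hphi Hphi).
  rewrite pairing_madelung.
  have E1 : (fun x => psi x + e%:C * phi x) = (fun x => e%:C * phi x + psi x).
    by apply/funext => x; rewrite addrC.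
  have Hsum : Psi (fun x => psi x + e%:C * phi x) by rewrite E1; exact: Psi_lin.
  apply: ae_eq_Rintegral.
  - by apply/measurable_EFinP; exact: measurable_int (integrable_madelung_form Hsum Hsum).
  - by apply/measurable_EFinP; exact: measurable_int iq.
  apply: filterS2 (transport_lin v e Kr Hr) (transport_lin v e Ki Hi) => x /(_ I) Tr /(_ I) Ti _.
  by rewrite E1 {1}/madelung_form re_lin im_lin Tr Ti cRe_lin cIm_lin /madelung_form; ring.
under eq_fun do rewrite expand.
exact: is_derive_quadratic.
Qed.

(** The chosen gradient agrees almost everywhere with the one found above, and
    [- (i/2) * 2 * i = 1]. *)
Lemma ham_field_pairing psi : Psi psi ->
  ham_field (fun psi => pairing (madelung psi) (v, alpha)) psi = xi_Psi (v, alpha) psi %[ae leb].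
Proof.
move=> Hpsi; have G := has_gradient_pairing Hpsi.
have GG := gradientP (ex_intro _ _ G).
apply: filterS (has_gradient_unique GG G) => x /(_ I) E _; rewrite /ham_field E -two_complex.
have ii : 'i * 'i = -1 :> R[i] by apply: complexP; rewrite ?cRe_iM ?cIm_iM//= oppr0.
by rewrite (_ : - ('i / 2) * _ = - ('i * 'i) * xi_Psi (v, alpha) psi x);
  [rewrite ii opprK mul1r|field].
Qed.

End fixed_element.

(** Density and momentum are sums of products of functions of [H^oo] and their
    derivatives. *)
Lemma sdual_madelung psi : Psi psi -> sdual (madelung psi).
Proof.
move=> [Hr Hi]; split=> [j|] /=.
  rewrite (_ : (fun x => _) = (fun x => complex.Re (psi x) * wpartial j (im psi) x -
    complex.Im (psi x) * wpartial j (re psi) x)).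
    by apply: HinftyB; apply: HinftyM => //; exact: Hinfty_wpartial.
  by apply/funext => x; rewrite mxE cImM cReJ cImJ /= mulNr.
rewrite (_ : (fun x => _) = (fun x => complex.Re (psi x) * complex.Re (psi x) +
    complex.Im (psi x) * complex.Im (psi x))).
  by apply: HinftyD; exact: HinftyM.
by apply/funext => x; rewrite cReM cReJ cImJ mulNr opprK.
Qed.

Lemma momentum_map_madelung : momentum_map (@xi_Psi R n) (@madelung R n).
Proof.
split; first exact: sdual_madelung.
move=> [v alpha] [Hv Ha]; split=> psi Hpsi.
  by eexists; exact: has_gradient_pairing.
exact: ham_field_pairing.
Qed.

Lemma lie_algebra_action_xi_Psi : lie_algebra_action (@xi_Psi R n).
Proof.
split.
- by move=> [v alpha] psi [Hv Ha] Hpsi; exact: Psi_xi_Psi.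
- by move=> [v alpha] a psi phi [Hv Ha] Hpsi Hphi; exact: xi_Psi_linear.
- by move=> a xi eta psi Hxi Heta _; exact: xi_Psi_additive.
- move=> [v alpha] [w beta] Hxi Heta; split; first exact: salg_bracket_closed.
  by move: Hxi Heta => [Hv Ha] [Hw Hb] psi Hpsi; exact: xi_Psi_bracket.
Qed.

End gradients.

Theorem theorem3p5 (R : realType) (n : nat) :
  lie_algebra_action (@xi_Psi R n) /\
  admits_momentum_map (@xi_Psi R n) /\
  momentum_map (@xi_Psi R n) (@madelung R n).
Proof.
have M := @momentum_map_madelung R n.
split; first exact: lie_algebra_action_xi_Psi.
by split=> //; exists (@madelung R n).
Qed.
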